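(* Let $0\le n\le l$. The quiver Schur algebra $S_n^l$ (with its differential $\partial$ and anti-involution $*$) is a $p$-DG quasi-hereditary cellular algebra.
   Context: **$p$-DG conventions.** $\Bbbk$ is a field of characteristic $p>0$; everything is $\mathbb{Z}$-graded over $\Bbbk$. A $p$-DG algebra is a graded algebra with a degree-2 derivation $\partial$, $\partial^p=0$; $p$-DG (bi)modules carry compatible degree-2 $\partial$ with $\partial^p=0$. $\mathrm{HOM}_A(M,N)$ (homs of all degrees) carries $\partial(f)=\partial f-f\partial$. A $p$-DG module $K$ over $A$ has property P if it has an increasing, possibly infinite, exhaustive $\partial$-stable filtration whose subquotients are isomorphic to direct sums of $p$-DG direct summands of (grading shifts of) $A$; $K$ is cofibrant if it is a $p$-DG direct summand of a property-P module. **$p$-DG cellular algebras.** Let $A$ be a $p$-DG algebra with an anti-involution $*$ (not required to commute with $\partial$). For a left $A$-module $\Delta$, $\Delta^\circ$ denotes the same vector space with right action $x\cdot a=a^**x$ (i.e. $a^*$ applied to $x$); $\Delta^\circ$ may carry a different differential from $\Delta$. A graded ideal $J$ is a $p$-DG cellular ideal if $\partial(J)\subset J$, $J^*=J$, and there are a left $p$-DG module $\Delta$ (with a right $p$-DG module structure on $\Delta^\circ$) and an isomorphism of $p$-DG $(A,A)$-bimodules $\phi:\Delta\otimes\Delta^\circ\to J$ with $\phi(x\otimes y)^*=\phi(y\otimes x)$. $A$ is $p$-DG cellular if it has a filtration $0=J_{m+1}\subset J_m\subset\cdots\subset J_1=A$ by $\partial$- and $*$-stable graded ideals such that $J_i/J_{i+1}$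 is a $p$-DG cellular ideal of $A/J_{i+1}$ for all $i$. A $p$-DG cellular ideal is $p$-DG quasi-hereditary if $\Delta$ is a cofibrant $p$-DG $A$-module; $A$ is $p$-DG quasi-hereditary cellular if there is such a chain with each $J_i/J_{i+1}$ a $p$-DG quasi-hereditary ideal in $A/J_{i+1}$. **Quiver Schur algebra.** $\mathrm{NH}_n^l$ is generated by $y_1,\dots,y_n$ (degree 2), $\psi_1,\dots,\psi_{n-1}$ (degree $-2$) with $y_iy_j=y_jy_i$, $y_i\psi_j=\psi_jy_i$ ($i\ne j,j+1$), $y_i\psi_i-\psi_iy_{i+1}=1=\psi_iy_i-y_{i+1}\psi_i$, $\psi_i^2=0$, $\psi_i\psi_j=\psi_j\psi_i$ ($|i-j|>1$), $\psi_i\psi_{i+1}\psi_i=\psi_{i+1}\psi_i\psi_{i+1}$, $y_1^l=0$; $\partial y_i=y_i^2$, $\partial\psi_i=-y_i\psi_i-\psi_iy_{i+1}$; $*$ is the anti-automorphism fixing the generators. $\mathcal{P}_n^l=\{\lambda\in\{0,1\}^l:\sum\lambda^i=n\}$; if the ones of $\lambda$ are at $j_1<\dots<j_n$, then $y^\lambda=y_1^{l-j_1}\cdots y_n^{l-j_n}$ and $G(\lambda)$ is the right $p$-DG module $y^\lambda\mathrm{NH}_n^l$ with grading shifted by $-nl+j_1+\cdots+j_n$. $S_n^l=\mathrm{END}_{\mathrm{NH}_n^l}(\bigoplus_{\lambda\in\mathcal{P}_n^l}G(\lambda))$ with $\partial(f)=\partial f-f\partial$. A homomorphism $f:G(\nu)\to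 G(\mu)$ is determined by $f(y^\nu)\in y^\mu\mathrm{NH}_n^l\cap\mathrm{NH}_n^ly^\nu$; the anti-involution of $S_n^l$ sends $f$ to $f^*:G(\mu)\to G(\nu)$ with $f^*(y^\mu)=f(y^\nu)^*$. *)

(* Defs.v *)
From HB Require Import structures.
From mathcomp Require Import all_boot all_algebra finmap.
From mathcomp Require Import zify.
From mathcomp Require Import boolp functions.
From mathcomp.multinomials Require Import monalg.

Set Implicit Arguments.
Unset Strict Implicit.
Unset Printing Implicit Defensive.

Import GRing.Theory.
Local Open Scope ring_scope.
Local Open Scope quotient_scope.

Section Subspaces.
Context (k : fieldType).

Record subspace (V : lmodType k) := Subspace {
  sub_pred :> {pred V};
  sub_closed : submod_closed sub_pred
}.

HB.instance Definition _ (V : lmodType k) (U : subspace V) :=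
  GRing.isSubmodClosed.Build k V (sub_pred U)
    (GRing.submod_closed_semi (sub_closed U)).

Context (V : lmodType k) (U : subspace V).

Definition quotv : Type := Quotient.quot (sub_pred U).

HB.instance Definition _ := GRing.Zmodule.on quotv.

(** The projection and the choice of representatives are locked to keep
    unification from computing with them. *)
Fact quot_key : unit. Proof. by []. Qed.

Definition qpi : V -> quotv :=
  locked_with quot_key (fun x => \pi_(Quotient.quot (sub_pred U)) x).
Definition qrepr : quotv -> V :=
  locked_with quot_key (fun x : Quotient.quot (sub_pred U) => repr x).

Lemma qreprK x : qpi (qrepr x) = x.
Proof. by rewrite /qpi /qrepr !locked_withE; exact: reprK. Qed.

Lemma qpi_eq x y : qpi x = qpi y <-> x - y \in U.
Proof.
by rewrite /qpi !locked_withE Quotient.idealrBE; split => [/eqP|/eqP].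
Qed.

Lemma qpi_eq0 x : qpi x = 0 <-> x \in U.
Proof.
have <- : qpi 0 = 0 by rewrite /qpi !locked_withE; exact: raddf0.
by rewrite qpi_eq subr0.
Qed.

Lemma qpiD x y : qpi (x + y) = qpi x + qpi y.
Proof. by rewrite /qpi !locked_withE; exact: raddfD. Qed.

Lemma qpi_ind (P : quotv -> Prop) : (forall x, P (qpi x)) -> forall x, P x.
Proof. by move=> h x; rewrite -(qreprK x). Qed.

Lemma qreprP x : qrepr (qpi x) - x \in U.
Proof. by apply/qpi_eq; rewrite qreprK. Qed.

Definition quotv_scale (c : k) (x : quotv) : quotv := qpi (c *: qrepr x).

Lemma quotv_scaleE c x : quotv_scale c (qpi x) = qpi (c *: x).
Proof.
apply/qpi_eq; rewrite -scalerBr.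
by apply: rpredZ; exact: qreprP.
Qed.

Lemma quotv_scaleA a b x :
  quotv_scale a (quotv_scale b x) = quotv_scale (a * b) x.
Proof. by elim/qpi_ind: x => x; rewrite !quotv_scaleE scalerA. Qed.

Lemma quotv_scale1 : left_id 1 quotv_scale.
Proof. by elim/qpi_ind => x; rewrite quotv_scaleE scale1r. Qed.

Lemma quotv_scaleDr : right_distributive quotv_scale +%R.
Proof.
move=> c; elim/qpi_ind => x; elim/qpi_ind => y.
by rewrite -qpiD !quotv_scaleE scalerDr qpiD.
Qed.

Lemma quotv_scaleDl x : {morph quotv_scale^~ x : a b / a + b}.
Proof. by elim/qpi_ind: x => x a b; rewrite !quotv_scaleE scalerDl qpiD. Qed.

HB.instance Definition _ := GRing.Zmodule_isLmodule.Build k quotv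
  quotv_scaleA quotv_scale1 quotv_scaleDr quotv_scaleDl.

Lemma qpiZ c x : qpi (c *: x) = c *: qpi x.
Proof. by rewrite -quotv_scaleE. Qed.

Lemma qpi_is_linear : linear qpi.
Proof. by move=> c x y; rewrite qpiD qpiZ. Qed.

HB.instance Definition _ := GRing.isLinear.Build k V quotv *:%R qpi
  qpi_is_linear.

Definition subv : Type := {x : V | x \in U}.

HB.instance Definition _ := SubChoice.on subv.
HB.instance Definition _ := [SubChoice_isSubLmodule of subv by <:].

End Subspaces.

Section Tensor.
Context (k : fieldType) (V W : lmodType k).

Local Notation free := {malg k[(V * W)%type]}.

Inductive tens_rel : free -> Prop :=
| TensRel0 : tens_rel 0
| TensRelLin c x y of tens_rel x & tens_rel y : tens_rel (c *: x + y)
| TensRell c x x' y :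
    tens_rel (<< (c *: x + x', y) >> - c *: << (x, y) >> - << (x', y) >>)
| TensRelr c x y y' :
    tens_rel (<< (x, c *: y + y') >> - c *: << (x, y) >> - << (x, y') >>).

Definition tens_pred : {pred free} := fun x => `[< tens_rel x >].

Lemma tens_closed : submod_closed tens_pred.
Proof.
split=> [|c x y]; rewrite !unfold_in => *; first exact/asboolP/TensRel0.
by apply/asboolP/TensRelLin; apply/asboolP.
Qed.

Definition tensor : lmodType k := quotv (Subspace tens_closed).

Definition tens (x : V) (y : W) : tensor := qpi _ << (x, y) >>.

Lemma tens_linearl y : linear (tens^~ y).
Proof.
move=> c x x'; rewrite /tens -linearP; apply/qpi_eq.
by rewrite opprD addrA; apply/asboolP/TensRell.
Qed.

Lemma tens_linearr x : linear (tens x).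
Proof.
move=> c y y'; rewrite /tens -linearP; apply/qpi_eq.
by rewrite opprD addrA; apply/asboolP/TensRelr.
Qed.

End Tensor.

(** The carriers, operations, homogeneous components and differentials are
    bundled as raw data; the axioms are the predicates [is_pcomplex],
    [is_pdg_alg], [is_pdg_lmod] and [is_pdg_rmod].  Algebras are not required to
    be nontrivial (unlike [algType]), so that every quotient is an algebra. *)

Section PDG.
Context (k : fieldType) (p : nat).

Record dgspace := DGSpace {
  dg_car :> lmodType k;
  dg_deg : int -> dg_car -> Prop;
  dg_d : dg_car -> dg_car
}.

(** [V] is the (internal) direct sum of the subspaces [H i]. *)
Definition is_grading (V : lmodType k) (H : int -> V -> Prop) : Prop :=
  [/\ forall i, H i 0 /\ forall c x y, H i x -> H i y -> H i (c *: x + y),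
      forall x, exists (s : seq int) (f : int -> V),
        (forall i, H i (f i)) /\ x = \sum_(i <- s) f i
    & forall (s : seq int) (f : int -> V), uniq s -> (forall i, H i (f i)) ->
        \sum_(i <- s) f i = 0 -> forall i, i \in s -> f i = 0].

Definition is_pcomplex (V : dgspace) : Prop :=
  [/\ is_grading (@dg_deg V),
      linear (@dg_d V),
      forall i (x : V), dg_deg i x -> dg_deg (i + 2) (dg_d x)
    & forall x : V, iter p (@dg_d V) x = 0].

Definition is_subspace (V : lmodType k) (F : V -> Prop) : Prop :=
  F 0 /\ forall c x y, F x -> F y -> F (c *: x + y).

(** [F] is spanned by its homogeneous elements. *)
Definition is_graded_sub (V : dgspace) (F : V -> Prop) : Prop :=
  forall x, F x -> exists (s : seq int) (f : int -> V),
    (forall i, dg_deg i (f i) /\ F (f i)) /\ x = \sum_(i <- s) f i.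

Definition d_stable (V : dgspace) (F : V -> Prop) : Prop :=
  forall x, F x -> F (dg_d x).

Record dgalg := DGAlg {
  dga_sp :> dgspace;
  dga_one : dga_sp;
  dga_mul : dga_sp -> dga_sp -> dga_sp
}.

Local Notation "x ** y" := (dga_mul x y) (at level 40, left associativity).

Definition is_pdg_alg (A : dgalg) : Prop :=
  [/\ is_pcomplex A,
      [/\ associative (@dga_mul A),
          left_id (dga_one A) (@dga_mul A) &
          right_id (dga_one A) (@dga_mul A)],
      (forall x : A, linear (fun y => x ** y) /\ linear (fun y => y ** x)),
      dg_deg 0 (dga_one A) /\
      (forall i j (x y : A), dg_deg i x -> dg_deg j y ->
         dg_deg (i + j) (x ** y))
    & forall x y : A, dg_d (x ** y) = dg_d x ** y + x ** dg_d y].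

(** The anti-involution need not commute with the differential. *)
Definition is_anti_involution (A : dgalg) (star : A -> A) : Prop :=
  [/\ linear star,
      forall x y, star (x ** y) = star y ** star x,
      involutive star
    & forall i x, dg_deg i x -> dg_deg i (star x)].

Definition is_ideal (A : dgalg) (J : A -> Prop) : Prop :=
  is_subspace J /\ forall a x, J x -> J (a ** x) /\ J (x ** a).

Record dgmod (A : dgalg) := DGMod {
  dgm_sp :> dgspace;
  dgm_act : A -> dgm_sp -> dgm_sp
}.

Definition is_pdg_lmod (A : dgalg) (M : dgmod A) : Prop :=
  [/\ is_pcomplex M,
      (forall x : M, dgm_act (dga_one A) x = x) /\
      (forall (a b : A) (x : M), dgm_act (a ** b) x = dgm_act a (dgm_act b x)),
      (forall a : A, linear (@dgm_act A M a)) /\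
      (forall x : M, linear (fun a : A => dgm_act a x)),
      forall i j (a : A) (x : M), dg_deg i a -> dg_deg j x ->
        dg_deg (i + j) (dgm_act a x)
    & forall (a : A) (x : M),
        dg_d (dgm_act a x) = dgm_act (dg_d a) x + dgm_act a (dg_d x)].

Definition is_pdg_rmod (A : dgalg) (M : dgspace) (act : M -> A -> M) : Prop :=
  [/\ is_pcomplex M,
      (forall x : M, act x (dga_one A) = x) /\
      (forall (x : M) (a b : A), act x (a ** b) = act (act x a) b),
      (forall a : A, linear (fun x => act x a)) /\
      (forall x : M, linear (act x)),
      forall i j (x : M) (a : A), dg_deg i x -> dg_deg j a ->
        dg_deg (i + j) (act x a)
    & forall (x : M) (a : A),
        dg_d (act x a) = act (dg_d x) a + act x (dg_d a)].

Section Modules.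
Context (A : dgalg).

Definition is_dgm_hom (M N : dgmod A) (f : M -> N) : Prop :=
  [/\ linear f,
      forall a x, f (dgm_act a x) = dgm_act a (f x),
      forall i x, dg_deg i x -> dg_deg i (f x)
    & forall x, f (dg_d x) = dg_d (f x)].

(** [N] is isomorphic to the direct sum of the [P i]: the universal maps
    [iota i] jointly give every element of [N] a unique expression as a finite
    sum. *)
Definition is_direct_sum (I : choiceType) (P : I -> dgmod A) (N : dgmod A) :
    Prop :=
  exists iota : forall i, P i -> N,
    [/\ forall i, is_dgm_hom (iota i),
        forall x, exists (s : seq I) (f : forall i, P i),
          x = \sum_(i <- s) iota i (f i)
      & forall (s : seq I) (f : forall i, P i), uniq s ->
          \sum_(i <- s) iota i (f i) = 0 -> forall i, i \in s -> f i = 0].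

Definition dg_summand (N M : dgmod A) : Prop :=
  exists N', is_pdg_lmod N' /\
    is_direct_sum (fun b : bool => if b then N else N') M.

Definition regular_shift (s : int) : dgmod A :=
  @DGMod A (@DGSpace A (fun i => @dg_deg A (i + s)) (@dg_d A)) (@dga_mul A).

Definition is_pdg_submod (M : dgmod A) (F : M -> Prop) : Prop :=
  [/\ is_subspace F, is_graded_sub F, d_stable F
    & forall a x, F x -> F (dgm_act a x)].

(** [F' / F] is isomorphic to [N] for submodules [F] of [F'] of [M]: there is a
    surjective morphism from [F'] to [N] with kernel [F].  It is given by a
    function on [M] whose values outside [F'] are irrelevant. *)
Definition subquotient_iso (M : dgmod A) (F' F : M -> Prop) (N : dgmod A) :
    Prop :=
  exists q : M -> N,
    [/\ (forall c x y, F' x -> F' y -> q (c *: x + y) = c *: q x + q y) /\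
        (forall a x, F' x -> q (dgm_act a x) = dgm_act a (q x)),
        (forall i x, F' x -> dg_deg i x -> dg_deg i (q x)) /\
        (forall x, F' x -> q (dg_d x) = dg_d (q x)),
        forall z, exists2 x, F' x & q x = z
      & forall x, F' x -> (q x = 0 <-> F x)].

Definition property_P (M : dgmod A) : Prop :=
  exists F : nat -> M -> Prop,
    [/\ (forall x, F 0 x <-> x = 0) /\ (forall x, exists i, F i x),
        forall i, is_pdg_submod (F i),
        forall i x, F i x -> F i.+1 x
      & forall i, exists N : dgmod A, exists I : choiceType,
          exists P : I -> dgmod A,
          [/\ is_pdg_lmod N /\ subquotient_iso (F i.+1) (F i) N,
              is_direct_sum P N
            & forall j, is_pdg_lmod (P j) /\
                exists s, dg_summand (P j) (regular_shift s)]].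

Definition cofibrant (K : dgmod A) : Prop :=
  exists M, [/\ is_pdg_lmod M, property_P M & dg_summand K M].

End Modules.

(** [Delta] carries a differential [d'] making [Delta^o] (same graded space,
    right action through [star]) a right p-DG module, and [phi] is an
    isomorphism of p-DG bimodules from [Delta ⊗ Delta^o] onto [J] compatible
    with [star].  The structure maps of the tensor product are expressed on
    pure tensors. *)
Definition is_cell_module (A : dgalg) (star : A -> A) (J : A -> Prop)
    (Delta : dgmod A) : Prop :=
  is_pdg_lmod Delta /\
  exists (d' : Delta -> Delta) (phi : {linear tensor Delta Delta -> A}),
    let Delta_o := @DGSpace Delta (@dg_deg Delta) d' in
    let act_o (x : Delta_o) (a : A) : Delta_o := dgm_act (star a) x in
    [/\ is_pdg_rmod act_o,
        injective phi /\ (forall a, J a <-> exists t, a = phi t),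
        (forall a (x y : Delta),
          phi (tens (dgm_act a x) y) = a ** phi (tens x y)) /\
        (forall a (x y : Delta),
          phi (tens x (act_o y a)) = phi (tens x y) ** a),
        (forall i j (x y : Delta), dg_deg i x -> dg_deg j y ->
          dg_deg (i + j) (phi (tens x y))) /\
        (forall x y : Delta,
          dg_d (phi (tens x y)) = phi (tens (dg_d x) y) + phi (tens x (d' y)))
      & forall x y : Delta, star (phi (tens x y)) = phi (tens y x)].

Definition is_stable_ideal (A : dgalg) (star : A -> A) (J : A -> Prop) : Prop :=
  [/\ is_ideal J, is_graded_sub J, d_stable J
    & forall x, J x <-> exists2 y, J y & x = star y].

Definition pdg_cellular_ideal (A : dgalg) (star : A -> A) (J : A -> Prop) :
    Prop :=
  is_stable_ideal star J /\ exists Delta, is_cell_module star J Delta.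

Definition pdg_qh_ideal (A : dgalg) (star : A -> A) (J : A -> Prop) : Prop :=
  is_stable_ideal star J /\
  exists Delta, is_cell_module star J Delta /\ cofibrant Delta.

(** The quotient of [A] by [J]; the operations are well defined when [J] is a
    two-sided ideal stable under the differential and [star]. *)
Definition quot_dgspace (V : dgspace) (U : subspace V) : dgspace :=
  @DGSpace (quotv U)
    (fun i x => exists2 y, dg_deg i y & x = qpi U y)
    (fun x => qpi U (dg_d (qrepr x))).

Definition quot_dgalg (A : dgalg) (J : subspace A) : dgalg :=
  @DGAlg (quot_dgspace J) (qpi J (dga_one A))
    (fun x y => qpi J (qrepr x ** qrepr y)).

Definition quot_star (A : dgalg) (star : A -> A) (J : subspace A) :
    quot_dgalg J -> quot_dgalg J :=
  fun x => qpi J (star (qrepr x)).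

(** [A] is a p-DG algebra with anti-involution [star] having a chain of ideals
    whose successive quotients are ideals of the given kind [C]; the ideal
    [J i] here is [J_(i+1)] in the usual numbering from [1] to [m+1]. *)
Definition has_cell_chain
    (C : forall B : dgalg, (B -> B) -> (B -> Prop) -> Prop)
    (A : dgalg) (star : A -> A) : Prop :=
  [/\ is_pdg_alg A, is_anti_involution star &
    exists (m : nat) (J : nat -> subspace A),
      [/\ (forall x, x \in J 0) /\ (forall x, x \in J m -> x = 0),
          forall i, (i < m)%N -> {subset J i.+1 <= J i},
          forall i, (i <= m)%N -> is_stable_ideal star (fun x => x \in J i)
        & forall i, (i < m)%N ->
            C (quot_dgalg (J i.+1)) (@quot_star A star (J i.+1))
              (fun x => exists2 y, y \in J i & x = qpi (J i.+1) y)]].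

Definition pdg_cellular (A : dgalg) (star : A -> A) : Prop :=
  has_cell_chain pdg_cellular_ideal star.

Definition pdg_qh_cellular (A : dgalg) (star : A -> A) : Prop :=
  has_cell_chain pdg_qh_ideal star.

End PDG.

(** Noncommutative identities expressing that the differential preserves the
    defining relations. *)
Section Leibniz.
Context (R : pzRingType).
Implicit Types a b c s t x : R.

Local Ltac cancel_head :=
  match goal with
  | |- (- ?v + _ = _) =>
      repeat first [rewrite (addKr v) | rewrite (addNr v) | rewrite (addrCA (- v))]
  | |- (?v + _ = _) =>
      repeat first [rewrite (addNKr v) | rewrite (subrr v) | rewrite (addrCA v)]
  end.
Local Ltac cancel :=
  rewrite ?(opprD, opprK, oppr0) -?addrA ?(addr0, add0r); repeat (cancel_head; rewrite ?(addr0, add0r)).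

Lemma leib_comm a b x z : x * b = b * x -> a * z = z * a ->
  x * b + a * z - (z * a + b * x) = 0.
Proof. by move=> -> ->; rewrite [X in X - _]addrC subrr. Qed.

Lemma leib_nil1 a b s (x := - (a * s) - s * b) :
  a * a * s + a * x - (x * b + s * (b * b)) = 0.
Proof.
by rewrite /x mulrBr mulrBl mulrN mulNr !mulrA; cancel.
Qed.

Lemma leib_nil2 a b s (x := - (a * s) - s * b) :
  a * b = b * a -> s * a = b * s + 1 ->
  x * a + s * (a * a) - (b * b * s + b * x) = 0.
Proof.
move=> ab sa.
have sba : s * b * a = b * s * b + b by rewrite -mulrA -ab mulrA sa mulrDl mul1r.
have asa : a * s * a = a * b * s + a by rewrite -mulrA sa mulrDr mulr1 mulrA.
have saa : s * (a * a) = b * b * s + b + a.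
  by rewrite mulrA sa mulrDl mul1r -mulrA sa mulrDr mulr1 mulrA.
rewrite /x saa mulrBr mulrBl mulrN mulNr !mulrA sba asa -ab.
by cancel.
Qed.

Lemma leib_psi2 a b s (x := - (a * s) - s * b) :
  a * s = s * b + 1 -> s * a = b * s + 1 -> s * s = 0 ->
  x * s + s * x = 0.
Proof.
move=> as_ sa ss.
have sbs : s * b * s = - s.
  have : s * (a * s) = s by rewrite mulrA sa mulrDl mul1r -mulrA ss mulr0 add0r.
  have -> : s * b = a * s - 1 by rewrite as_ addrK.
  by rewrite mulrBl mul1r -mulrA ss mulr0 sub0r.
have sas : s * a * s = s by rewrite sa mulrDl mul1r -mulrA ss mulr0 add0r.
rewrite /x mulrBr mulrBl mulrN mulNr !mulrA sas sbs ss mul0r.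
by rewrite -mulrA ss mulr0; cancel.
Qed.

Lemma leib_braid a b c s t (x := - (a * s) - s * b) (z := - (b * t) - t * c) :
  a * s = s * b + 1 -> s * a = b * s + 1 ->
  b * t = t * c + 1 ->
  s * c = c * s -> t * a = a * t -> s * s = 0 ->
  s * t * s = t * s * t ->
  (x * t + s * z) * s + s * t * x - ((z * s + t * x) * t + t * s * z) = 0.
Proof.
move=> as_ sa bt sc ta ss br.
set X := s * t * s in br *.
have e1 : s * b * t * s = a * X - t * s.
  by have -> : s * b = a * s - 1 by [rewrite as_ addrK]; rewrite !mulrBl mul1r !mulrA.
have e2 : s * t * c * s = X * c by rewrite /X -!mulrA sc.
have e3 : s * t * a * s = X * b + s * t.
  by rewrite -mulrA as_ mulrDr mulr1 mulrA.
have e4 : t * c * s * t = b * X - s * t.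
  have -> : t * c = b * t - 1 by rewrite bt addrK.
  by rewrite !mulrBl mul1r br !mulrA.
have e5 : t * a * s * t = a * X by rewrite ta br !mulrA.
have e6 : t * s * b * t = X * c + t * s by rewrite -mulrA bt mulrDr mulr1 mulrA br.
have aX : a * X = X * c + t * s.
  by rewrite /X !mulrA as_ !mulrDl mul1r -(mulrA s b t) bt mulrDr mulr1 mulrDl ss addr0 !mulrA e2.
have bX : b * X = X * b + s * t - t * s.
  rewrite -e3 /X !mulrA; have -> : b * s = s * a - 1 by rewrite sa addrK.
  by rewrite !mulrBl mul1r -(mulrA s a t) -ta !mulrA.
rewrite /x /z !(mulrBr, mulrBl, mulrDl, mulrDr, mulrN, mulNr) !mulrA.
have h1 : a * s * t * s = a * X by rewrite /X !mulrA.
have h2 : b * t * s * t = b * X by rewrite br !mulrA.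
rewrite h1 e1 e2 e3 h2 e4 e5 e6 -br !aX bX.
by cancel.
Qed.
Lemma leib_commd a b s t : t * a = a * t -> t * b = b * t -> t * s = s * t ->
  t * (- (a * s) - s * b) = (- (a * s) - s * b) * t.
Proof.
move=> ha hb hs; rewrite mulrBr mulrBl mulrN mulNr !mulrA ha hs.
by rewrite -!mulrA hs hb.
Qed.

Lemma leib_commsq a b : a * b = b * a -> a * (b * b) = b * b * a.
Proof. by move=> h; rewrite mulrA h -mulrA h mulrA. Qed.

End Leibniz.

Section FreeAlgebra.
Context (k : fieldType) (n : nat).

(** [inl i] is the generator y_(i+1) and [inr j] is psi_(j+1). *)
Definition gen : Type := ('I_n + 'I_n.-1)%type.
HB.instance Definition _ := Choice.on gen.

Definition word : Type := seq gen.
HB.instance Definition _ := Choice.on word.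

Lemma word_unitm (u v : word) : u ++ v = [::] -> u = [::] /\ v = [::].
Proof. by case: u. Qed.

HB.instance Definition _ := Choice_isMonomialDef.Build word
  (@catA gen) (@cat0s gen) (@cats0 gen) word_unitm.

(** The free associative algebra on the generators, i.e. the monoid algebra of
    the words; its product is locked for the same reason as above. *)
Definition free_alg : Type := {malg k[word]}.
HB.instance Definition _ := GRing.Lmodule.on free_alg.

Fact free_key : unit. Proof. by []. Qed.

Definition mono : word -> free_alg := locked_with free_key (fun w => << w >>).
Definition free_mul : free_alg -> free_alg -> free_alg :=
  locked_with free_key (@fgmul word k).

Lemma free_mulE : free_mul = @fgmul word k.
Proof. by rewrite /free_mul !locked_withE. Qed.

Lemma free_mulA : associative free_mul.
Proof. by rewrite free_mulE; exact: fgmulA. Qed.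
Lemma free_mul1x : left_id (mono [::]) free_mul.
Proof. by rewrite free_mulE /mono !locked_withE; exact: fgmul1g. Qed.
Lemma free_mulx1 : right_id (mono [::]) free_mul.
Proof. by rewrite free_mulE /mono !locked_withE; exact: fgmulg1. Qed.
Lemma free_mulDl : left_distributive free_mul +%R.
Proof. by rewrite free_mulE; exact: fgmulgDl. Qed.
Lemma free_mulDr : right_distributive free_mul +%R.
Proof. by rewrite free_mulE; exact: fgmulgDr. Qed.
Lemma free_one_neq0 : mono [::] != 0.
Proof. by rewrite /mono !locked_withE; exact: fgoner_eq0. Qed.

HB.instance Definition _ := GRing.Zmodule_isNzRing.Build free_alg
  free_mulA free_mul1x free_mulx1 free_mulDl free_mulDr free_one_neq0.

Lemma free_scalerAl c (x z : free_alg) : c *: (x * z) = (c *: x : free_alg) * z.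
Proof.
rewrite /GRing.mul /= free_mulE.
exact: (@scalerAl k {malg k[word]}).
Qed.

HB.instance Definition _ := GRing.Lmodule_isLalgebra.Build k free_alg
  free_scalerAl.

Definition fy (i : 'I_n) : free_alg := mono [:: inl i].
Definition fpsi (j : 'I_n.-1) : free_alg := mono [:: inr j].

(** For psi_j these are the indices of y_j and y_(j+1). *)
Definition lo (j : 'I_n.-1) : 'I_n := widen_ord (leq_pred n) j.
Lemma hi_subproof (j : 'I_n.-1) : (j.+1 < n)%N.
Proof. by rewrite -ltn_predRL. Qed.
Definition hi (j : 'I_n.-1) : 'I_n := Ordinal (hi_subproof j).

Definition gen_deg (g : gen) : int :=
  match g with inl _ => 2 | inr _ => - 2 end.
Definition word_deg (w : word) : int := \sum_(g <- w) gen_deg g.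
Definition free_deg (i : int) (x : free_alg) : Prop :=
  forall w, w \in msupp (x : {malg k[word]}) -> word_deg w = i.

Definition gen_d (g : gen) : free_alg :=
  match g with
  | inl i => fy i ^+ 2
  | inr j => - fy (lo j) * fpsi j - fpsi j * fy (hi j)
  end.

(** The Leibniz rule on words. *)
Fixpoint word_d (w : word) : free_alg :=
  if w is g :: w' then gen_d g * mono w' + mono [:: g] * word_d w' else 0.

Definition lin_ext (f : word -> free_alg) (x : free_alg) : free_alg :=
  \sum_(w <- msupp (x : {malg k[word]})) (x : {malg k[word]})@_w *: f w.

Definition free_d : free_alg -> free_alg :=
  locked_with free_key (lin_ext word_d).
Definition free_star : free_alg -> free_alg :=
  locked_with free_key (lin_ext (fun w => mono (rev w))).

Definition free_dga : dgalg k :=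
  @DGAlg k (@DGSpace k free_alg free_deg free_d) 1 *%R.

Lemma free_sum (x : free_alg) :
  x = \sum_(w <- msupp (x : {malg k[word]})) (x : {malg k[word]})@_w *: mono w.
Proof.
rewrite {1}(monalgE x); apply: eq_bigr => w _.
by apply/malgP => v; rewrite /mono !locked_withE mcoeffZ !mcoeffU mulrnAr mulr1.
Qed.

Lemma lin_extw f (x : free_alg) (d : {fset word}) :
  (msupp (x : {malg k[word]}) `<=` d)%fset ->
  lin_ext f x = \sum_(w <- d) (x : {malg k[word]})@_w *: f w.
Proof.
move=> sxd; rewrite /lin_ext (big_fset_incl _ sxd) //= => w _.
by move/mcoeff_outdom ->; rewrite scale0r.
Qed.

Lemma lin_ext_is_linear f : linear (lin_ext f).
Proof.
move=> c x y.
pose d := (msupp (x : {malg k[word]}) `|` msupp (y : {malg k[word]}))%fset.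
rewrite (@lin_extw f x d) ?fsubsetUl // (@lin_extw f y d) ?fsubsetUr //.
rewrite (@lin_extw f _ d); last first.
  apply: fsubset_trans (msuppD_le _ _) _; apply: fsetSU; exact: msuppZ_le.
rewrite scaler_sumr -big_split /=; apply: eq_bigr => w _.
by rewrite mcoeffD mcoeffZ scalerDl scalerA.
Qed.

HB.instance Definition _ f :=
  GRing.isLinear.Build k free_alg free_alg *:%R (lin_ext f) (lin_ext_is_linear f).

Lemma free_d_is_linear : linear free_d.
Proof. by rewrite /free_d locked_withE; exact: lin_ext_is_linear. Qed.
Lemma free_star_is_linear : linear free_star.
Proof. by rewrite /free_star locked_withE; exact: lin_ext_is_linear. Qed.

HB.instance Definition _ :=
  GRing.isLinear.Build k free_alg free_alg *:%R free_d free_d_is_linear.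
HB.instance Definition _ :=
  GRing.isLinear.Build k free_alg free_alg *:%R free_star free_star_is_linear.

Lemma lin_ext_mono f w : lin_ext f (mono w) = f w.
Proof.
by rewrite /lin_ext /mono !locked_withE msuppU1 big_seq_fset1 mcoeffUU scale1r.
Qed.

Lemma free_d_mono w : free_d (mono w) = word_d w.
Proof. by rewrite {1}/free_d locked_withE lin_ext_mono. Qed.

Lemma free_star_mono w : free_star (mono w) = mono (rev w).
Proof. by rewrite {1}/free_star locked_withE lin_ext_mono. Qed.

Lemma free_ind (P : free_alg -> Prop) :
  P 0 -> (forall c x y, P x -> P y -> P (c *: x + y)) ->
  (forall w, P (mono w)) -> forall x, P x.
Proof.
move=> P0 Plin Pm x; rewrite (free_sum x).
elim/big_rec: _ => [|w y _ Py]; first exact: P0.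
exact: Plin.
Qed.

Lemma monoM u v : mono (u ++ v) = mono u * mono v.
Proof. by rewrite /GRing.mul /= free_mulE /mono !locked_withE fgmulUU mulr1. Qed.

Lemma mono1 : mono [::] = 1. Proof. by []. Qed.

Lemma free_scalerAr c (x y : free_alg) : c *: (x * y) = x * (c *: y).
Proof.
elim/free_ind: y c => [c|a y y' IH IH' c|v c]; first by rewrite !(mulr0, scaler0).
  by rewrite scalerDr !mulrDr scalerDr IH' -IH !scalerA IH.
have sc w : c *: mono w = << c *g w >>.
  by apply/malgP => z; rewrite /mono !locked_withE mcoeffZ !mcoeffU mulrnAr mulr1.
rewrite (free_sum x) mulr_suml scaler_sumr mulr_suml; apply: eq_bigr => u _.
rewrite -!scalerAl scalerA mulrC -scalerA; congr (_ *: _).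
rewrite sc -monoM sc /GRing.mul /= free_mulE /mono !locked_withE.
by rewrite fgmulUU mul1r.
Qed.

Lemma word_d_cat u v : word_d (u ++ v) = word_d u * mono v + mono u * word_d v.
Proof.
elim: u => [|g u IH] /=; first by rewrite mul0r add0r mul1r.
rewrite IH monoM mulrDr mulrDl !mulrA -addrA; congr (_ + (_ + _)).
by rewrite -monoM.
Qed.

Lemma free_dP c x y : free_d (c *: x + y) = c *: free_d x + free_d y.
Proof. exact: linearP. Qed.

Lemma free_d0 : free_d 0 = 0. Proof. exact: linear0. Qed.

Lemma free_starP c x y :
  free_star (c *: x + y) = c *: free_star x + free_star y.
Proof. exact: linearP. Qed.

Lemma free_star0 : free_star 0 = 0. Proof. exact: linear0. Qed.

Lemma free_dM x y : free_d (x * y) = free_d x * y + x * free_d y.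
Proof.
elim/free_ind: x => [|c x x' IH IH'|u]; first by rewrite mul0r free_d0 !mul0r addr0.
  rewrite mulrDl -scalerAl !free_dP IH IH' scalerDr !mulrDl -!scalerAl.
  by rewrite addrACA.
elim/free_ind: y => [|c y y' IH IH'|v]; first by rewrite mulr0 free_d0 !mulr0 addr0.
  rewrite mulrDr -free_scalerAr !free_dP IH IH' scalerDr !mulrDr -!free_scalerAr.
  by rewrite addrACA.
by rewrite -monoM !free_d_mono word_d_cat.
Qed.

Lemma free_d1 : free_d 1 = 0.
Proof. by rewrite -mono1 free_d_mono. Qed.

Lemma free_d_gen g : free_d (mono [:: g]) = gen_d g.
Proof. by rewrite free_d_mono /= mulr0 addr0 mulr1. Qed.

Lemma free_starM x y : free_star (x * y) = free_star y * free_star x.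
Proof.
elim/free_ind: x => [|c x x' IH IH'|u]; first by rewrite mul0r free_star0 !mulr0.
  by rewrite mulrDl -scalerAl !free_starP IH IH' !mulrDr -!free_scalerAr.
elim/free_ind: y => [|c y y' IH IH'|v]; first by rewrite mulr0 free_star0 !mul0r.
  by rewrite mulrDr -free_scalerAr !free_starP IH IH' !mulrDl -!scalerAl.
by rewrite -monoM !free_star_mono rev_cat monoM.
Qed.

Lemma free_star1 : free_star 1 = 1.
Proof. by rewrite -mono1 free_star_mono. Qed.

Lemma free_star_gen g : free_star (mono [:: g]) = mono [:: g].
Proof. by rewrite free_star_mono. Qed.

End FreeAlgebra.

Section NilHecke.
Context (k : fieldType) (n l : nat).
Local Notation FA := (free_alg k n).
Local Notation y := (@fy k n).
Local Notation psi := (@fpsi k n).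

Inductive nh_rel : FA -> Prop :=
| RelYY i j : nh_rel (y i * y j - y j * y i)
| RelYPsi i j of i != lo j & i != hi j : nh_rel (y i * psi j - psi j * y i)
| RelNil1 j : nh_rel (y (lo j) * psi j - psi j * y (hi j) - 1)
| RelNil2 j : nh_rel (psi j * y (lo j) - y (hi j) * psi j - 1)
| RelPsi2 j : nh_rel (psi j ^+ 2)
| RelPsiFar (i j : 'I_n.-1) of (i.+1 < j)%N || (j.+1 < i)%N :
    nh_rel (psi i * psi j - psi j * psi i)
| RelBraid (i j : 'I_n.-1) of j = i.+1 :> nat :
    nh_rel (psi i * psi j * psi i - psi j * psi i * psi j)
| RelCyc (i : 'I_n) of i = 0 :> nat : nh_rel (y i ^+ l).

Inductive nh_ideal_rel : FA -> Prop :=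
| NhRel x of nh_rel x : nh_ideal_rel x
| NhZero : nh_ideal_rel 0
| NhAdd x z of nh_ideal_rel x & nh_ideal_rel z : nh_ideal_rel (x + z)
| NhMull a x of nh_ideal_rel x : nh_ideal_rel (a * x)
| NhMulr a x of nh_ideal_rel x : nh_ideal_rel (x * a).

Definition nh_ideal_pred : {pred FA} := fun x => `[< nh_ideal_rel x >].

Lemma nh_ideal_closed : submod_closed nh_ideal_pred.
Proof.
split=> [|c x z]; rewrite !unfold_in => *; first exact/asboolP/NhZero.
apply/asboolP/NhAdd; last exact/asboolP.
by rewrite -[x]mul1r scalerAl; apply/NhMull/asboolP.
Qed.

Definition nh_ideal : subspace FA := Subspace nh_ideal_closed.

Lemma nh_idealP x : x \in nh_ideal <-> nh_ideal_rel x.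
Proof. by split=> [/asboolP|h] //; apply/asboolP. Qed.

Definition nh_dga : dgalg k := @quot_dgalg k (free_dga k n) nh_ideal.

Definition nh : Type := quotv nh_ideal.
HB.instance Definition _ := GRing.Lmodule.on nh.

Definition nhpi (x : FA) : nh := qpi nh_ideal x.
Definition nh_one : nh := dga_one nh_dga.
Definition nh_mul (x z : nh) : nh := @dga_mul k nh_dga x z.
Definition nh_d (x : nh) : nh := @dg_d k nh_dga x.
Definition nh_deg (i : int) (x : nh) : Prop := @dg_deg k nh_dga i x.
Definition nh_star (x : nh) : nh := @quot_star k (free_dga k n) (@free_star k n) nh_ideal x.

Lemma nhpi_ind (P : nh -> Prop) : (forall x, P (nhpi x)) -> forall x, P x.
Proof. exact: qpi_ind. Qed.

Lemma nh_mulE x z : nh_mul (nhpi x) (nhpi z) = nhpi (x * z).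
Proof.
apply/qpi_eq/nh_idealP; rewrite /=.
set x' := qrepr _; set z' := qrepr _.
have -> : x' * z' - x * z = (x' - x) * z' + x * (z' - z).
  by rewrite mulrBl mulrBr addrA subrK.
by apply: NhAdd; [apply: NhMulr|apply: NhMull]; apply/nh_idealP; apply: qreprP.
Qed.

Lemma nhpiD : {morph nhpi : x z / x + z}. Proof. exact: qpiD. Qed.

Lemma nh_mulA : associative nh_mul.
Proof.
elim/nhpi_ind => x; elim/nhpi_ind => z; elim/nhpi_ind => t.
by rewrite !nh_mulE mulrA.
Qed.

Lemma nh_mul1x : left_id nh_one nh_mul.
Proof. by elim/nhpi_ind => x; rewrite [nh_mul _ _]nh_mulE mul1r. Qed.

Lemma nh_mulx1 : right_id nh_one nh_mul.
Proof. by elim/nhpi_ind => x; rewrite [nh_mul _ _]nh_mulE mulr1. Qed.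

Lemma nh_mulDl : left_distributive nh_mul +%R.
Proof.
elim/nhpi_ind => x; elim/nhpi_ind => z; elim/nhpi_ind => t.
by rewrite -nhpiD !nh_mulE -nhpiD mulrDl.
Qed.

Lemma nh_mulDr : right_distributive nh_mul +%R.
Proof.
elim/nhpi_ind => x; elim/nhpi_ind => z; elim/nhpi_ind => t.
by rewrite -nhpiD !nh_mulE -nhpiD mulrDr.
Qed.

HB.instance Definition _ := GRing.Zmodule_isPzRing.Build nh
  nh_mulA nh_mul1x nh_mulx1 nh_mulDl nh_mulDr.

Lemma nhpiM : {morph nhpi : x z / x * z}.
Proof. by move=> x z; rewrite -nh_mulE. Qed.

Lemma nhpi_is_linear : linear nhpi.
Proof. exact: qpi_is_linear. Qed.

HB.instance Definition _ := GRing.isLinear.Build k FA nh *:%R nhpi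
  nhpi_is_linear.
HB.instance Definition _ := GRing.isMonoidMorphism.Build FA nh nhpi
  (conj erefl nhpiM).

Lemma nhpi0 x : nhpi x = 0 <-> nh_ideal_rel x.
Proof. by rewrite qpi_eq0 nh_idealP. Qed.

Lemma nhpi_rel x : nh_rel x -> nhpi x = 0.
Proof. by move=> h; apply/nhpi0/NhRel. Qed.

Lemma nhpiZ c x : nhpi (c *: x) = c *: nhpi x.
Proof. exact: qpiZ. Qed.

Lemma nhpi1 : nhpi 1 = 1. Proof. by []. Qed.

Lemma nhpiN x : nhpi (- x) = - nhpi x. Proof. exact: raddfN. Qed.

Lemma nhpi_eq x z : nh_rel (x - z) -> nhpi x = nhpi z.
Proof. by move=> h; apply/qpi_eq/nh_idealP/NhRel. Qed.

Lemma nh_scalerAl c (x z : nh) : c *: (x * z) = (c *: x) * z.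
Proof.
elim/nhpi_ind: x => x; elim/nhpi_ind: z => z.
by rewrite -nhpiM -!nhpiZ -nhpiM scalerAl.
Qed.

Lemma nh_scalerAr c (x z : nh) : c *: (x * z) = x * (c *: z).
Proof.
elim/nhpi_ind: x => x; elim/nhpi_ind: z => z.
by rewrite -nhpiM -!nhpiZ -nhpiM free_scalerAr.
Qed.

Definition ynh (i : 'I_n) : nh := nhpi (y i).
Definition psinh (j : 'I_n.-1) : nh := nhpi (psi j).

Lemma nhpi_comm a b c d : nh_rel (a * b - c * d) ->
  nhpi a * nhpi b = nhpi c * nhpi d.
Proof. by move/nhpi_eq; rewrite !nhpiM. Qed.

Lemma nh_yy i j : ynh i * ynh j = ynh j * ynh i.
Proof. exact: nhpi_comm (RelYY i j). Qed.

Lemma nh_ypsi i j : i != lo j -> i != hi j -> ynh i * psinh j = psinh j * ynh i.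
Proof. by move=> h1 h2; exact: nhpi_comm (RelYPsi h1 h2). Qed.

Lemma nhpi_nil a b c d : nh_rel (a * b - c * d - 1) ->
  nhpi a * nhpi b = nhpi c * nhpi d + 1.
Proof. by rewrite -addrA -opprD => /nhpi_eq; rewrite nhpiD !nhpiM. Qed.

Lemma nh_nil1 j : ynh (lo j) * psinh j = psinh j * ynh (hi j) + 1.
Proof. exact: nhpi_nil (RelNil1 j). Qed.

Lemma nh_nil2 j : psinh j * ynh (lo j) = ynh (hi j) * psinh j + 1.
Proof. exact: nhpi_nil (RelNil2 j). Qed.

Lemma nhpi_sqr a : nh_rel (a ^+ 2) -> nhpi a * nhpi a = 0.
Proof. by move/NhRel/nhpi0; rewrite expr2 nhpiM. Qed.

Lemma nh_psi2 j : psinh j * psinh j = 0.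
Proof. exact: nhpi_sqr (RelPsi2 j). Qed.

Lemma nh_far (i j : 'I_n.-1) : (i.+1 < j)%N || (j.+1 < i)%N ->
  psinh i * psinh j = psinh j * psinh i.
Proof. by move=> h; exact: nhpi_comm (RelPsiFar h). Qed.

Lemma nhpi_braid a b c d e f : nh_rel (a * b * c - d * e * f) ->
  nhpi a * nhpi b * nhpi c = nhpi d * nhpi e * nhpi f.
Proof. by move/nhpi_eq; rewrite !nhpiM. Qed.

Lemma nh_braid (i j : 'I_n.-1) : j = i.+1 :> nat ->
  psinh i * psinh j * psinh i = psinh j * psinh i * psinh j.
Proof. by move=> h; exact: nhpi_braid (RelBraid h). Qed.

Lemma nhpi_dy i : nhpi (free_d (y i)) = ynh i * ynh i.
Proof. by rewrite free_d_gen; exact: nhpiM. Qed.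

Lemma nhpi_dpsi_aux a b c :
  nhpi (- a * b - b * c) = - (nhpi a * nhpi b) - nhpi b * nhpi c.
Proof. by rewrite nhpiD nhpiN !nhpiM nhpiN mulNr. Qed.

Lemma nhpi_dpsi j :
  nhpi (free_d (psi j)) = - (ynh (lo j) * psinh j) - psinh j * ynh (hi j).
Proof. by rewrite free_d_gen; exact: nhpi_dpsi_aux. Qed.

Lemma nhpi_dM x z : nhpi (free_d (x * z)) =
  nhpi (free_d x) * nhpi z + nhpi x * nhpi (free_d z).
Proof. by rewrite free_dM nhpiD !nhpiM. Qed.

Lemma free_dD x z : free_d (x + z) = free_d x + free_d z :> FA.
Proof. exact: raddfD. Qed.

Lemma free_dB x z : free_d (x - z) = free_d x - free_d z :> FA.
Proof. exact: raddfB. Qed.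

Lemma nhpi_dB x z : nhpi (free_d (x - z)) = nhpi (free_d x) - nhpi (free_d z).
Proof. by rewrite free_dB nhpiD nhpiN. Qed.

Lemma free_dX (x : FA) m : free_d x = x ^+ 2 -> free_d (x ^+ m) = x ^+ m.+1 *+ m.
Proof.
move=> dx; elim: m => [|m IH]; first by rewrite free_d1.
rewrite exprS free_dM IH dx -exprD mulrnAr -exprS.
by rewrite -mulrS.
Qed.

Lemma nhpi_d_comm a b :
  nhpi (free_d a) * nhpi b = nhpi b * nhpi (free_d a) ->
  nhpi a * nhpi (free_d b) = nhpi (free_d b) * nhpi a ->
  nhpi (free_d (a * b - b * a)) = 0.
Proof.
move=> h1 h2; rewrite nhpi_dB.
rewrite [X in X - _](nhpi_dM a b) [X in _ - X](nhpi_dM b a).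
exact: leib_comm.
Qed.

Lemma nhpi_d_nil a b c e : nhpi (free_d (a * b - c * e - 1)) =
  nhpi (free_d a) * nhpi b + nhpi a * nhpi (free_d b) -
  (nhpi (free_d c) * nhpi e + nhpi c * nhpi (free_d e)).
Proof.
rewrite nhpi_dB free_d1 (raddf0 nhpi) subr0 nhpi_dB.
by rewrite [X in X - _ = _](nhpi_dM a b) [X in _ - X = _](nhpi_dM c e).
Qed.

Lemma nhpi_d_triple a b c : nhpi (free_d (a * b * c)) =
  (nhpi (free_d a) * nhpi b + nhpi a * nhpi (free_d b)) * nhpi c
  + nhpi a * nhpi b * nhpi (free_d c).
Proof. by rewrite (nhpi_dM (a * b)) (nhpi_dM a b) (nhpiM a b). Qed.

Lemma comm_dpsi (x : nh) j :
  x * ynh (lo j) = ynh (lo j) * x -> x * ynh (hi j) = ynh (hi j) * x ->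
  x * psinh j = psinh j * x ->
  x * nhpi (free_d (psi j)) = nhpi (free_d (psi j)) * x.
Proof.
move=> h1 h2 h3; have -> := nhpi_dpsi j.
exact: (leib_commd h1 h2 h3).
Qed.

Lemma nh_comm_psi_y i j : i != lo j -> i != hi j ->
  psinh j * ynh i = ynh i * psinh j.
Proof. by move=> h1 h2; rewrite nh_ypsi. Qed.

Lemma nh_rel_d x : nh_rel x -> nhpi (free_d x) = 0.
Proof.
case=> {x} [i j|i j h1 h2|j|j|j|i j h|i j h|i h].
- apply: nhpi_d_comm.
    by have -> := nhpi_dy i; apply/esym/leib_commsq/nh_yy.
  by have -> := nhpi_dy j; exact/leib_commsq/nh_yy.
- apply: nhpi_d_comm.
    by have -> := nhpi_dy i; apply/esym/leib_commsq/nh_comm_psi_y.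
  by apply: comm_dpsi; [exact: nh_yy|exact: nh_yy|exact: nh_ypsi].
- by rewrite nhpi_d_nil !nhpi_dy nhpi_dpsi; exact: leib_nil1.
- rewrite nhpi_d_nil !nhpi_dy nhpi_dpsi; apply: leib_nil2; first exact: nh_yy.
  exact: nh_nil2.
- rewrite expr2 nhpi_dM nhpi_dpsi; apply: leib_psi2; last exact: nh_psi2.
    exact: nh_nil1.
  exact: nh_nil2.
- have hne (u v : 'I_n.-1) : (u.+1 < v)%N || (v.+1 < u)%N ->
      [/\ lo u != lo v, lo u != hi v, hi u != lo v & hi u != hi v].
    by move=> uv; split; apply/eqP => /(congr1 val) /=; lia.
  have h' : (j.+1 < i)%N || (i.+1 < j)%N by rewrite orbC.
  have [n1 n2 n3 n4] := hne _ _ h; have [m1 m2 m3 m4] := hne _ _ h'.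
  apply: nhpi_d_comm.
    apply: esym; apply: comm_dpsi; last exact: nh_far.
      exact: nh_comm_psi_y.
    exact: nh_comm_psi_y.
  apply: comm_dpsi; last exact: nh_far; exact: nh_comm_psi_y.
- have hl : lo j = hi i by apply: val_inj; rewrite /= h.
  rewrite nhpi_dB !nhpi_d_triple !nhpi_dpsi hl; apply: leib_braid.
  + exact: nh_nil1.
  + exact: nh_nil2.
  + by rewrite -hl; exact: nh_nil1.
  + by apply: nh_comm_psi_y; apply/eqP => /(congr1 val) /=; lia.
  + by apply: nh_comm_psi_y; apply/eqP => /(congr1 val) /=; lia.
  + exact: nh_psi2.
  + exact: nh_braid.
- rewrite free_dX; last by rewrite free_d_gen.
  apply/nhpi0; rewrite exprS -mulr_natl.
  by do 2!apply: NhMull; apply/NhRel/RelCyc.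
Qed.

Lemma nh_ideal_d x : nh_ideal_rel x -> nh_ideal_rel (free_d x).
Proof.
move=> h; apply/nhpi0; elim: h => {x} [x|||a x|a x].
- exact: nh_rel_d.
- by rewrite free_d0 (raddf0 nhpi).
- by move=> x z _ h1 _ h2; rewrite free_dD nhpiD h1 h2 addr0.
- by move=> /nhpi0 h1 h2; rewrite nhpi_dM h1 h2 !mulr0 addr0.
- by move=> /nhpi0 h1 h2; rewrite nhpi_dM h1 h2 !mul0r addr0.
Qed.

Lemma nh_dE x : nh_d (nhpi x) = nhpi (free_d x).
Proof.
apply/qpi_eq/nh_idealP; rewrite /= -free_dB.
by apply/nh_ideal_d/nh_idealP; exact: qreprP.
Qed.

Lemma nh_dM : forall x z, nh_d (x * z) = nh_d x * z + x * nh_d z.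
Proof.
elim/nhpi_ind => x; elim/nhpi_ind => z.
by rewrite -nhpiM !nh_dE nhpi_dM.
Qed.

Lemma nh_d_is_linear : linear nh_d.
Proof.
move=> c; elim/nhpi_ind => x; elim/nhpi_ind => z.
by rewrite -nhpiZ -nhpiD !nh_dE -nhpiZ -nhpiD free_dP.
Qed.

HB.instance Definition _ := GRing.isLinear.Build k nh nh *:%R nh_d
  nh_d_is_linear.

Lemma nh_d_y i : nh_d (ynh i) = ynh i ^+ 2.
Proof. by rewrite nh_dE nhpi_dy expr2. Qed.

Lemma nh_d_psi j :
  nh_d (psinh j) = - (ynh (lo j) * psinh j) - psinh j * ynh (hi j).
Proof. by rewrite nh_dE nhpi_dpsi. Qed.

Lemma free_starD x z : free_star (x + z) = free_star x + free_star z :> FA.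
Proof. exact: raddfD. Qed.

Lemma free_starB x z : free_star (x - z) = free_star x - free_star z :> FA.
Proof. exact: raddfB. Qed.

Lemma free_starX (x : FA) m : free_star x = x -> free_star (x ^+ m) = x ^+ m.
Proof.
move=> sx; elim: m => [|m IH]; first by rewrite free_star1.
by rewrite exprS free_starM IH sx -exprSr exprS.
Qed.

Lemma nh_ideal_star_comm a b : free_star a = a -> free_star b = b ->
  nhpi a * nhpi b = nhpi b * nhpi a -> nhpi (free_star (a * b - b * a)) = 0.
Proof.
by move=> sa sb ab; rewrite free_starB !free_starM sa sb nhpiD nhpiN !nhpiM ab subrr.
Qed.

Lemma nh_ideal_star_nil a b c e : free_star a = a -> free_star b = b ->
  free_star c = c -> free_star e = e ->
  nhpi b * nhpi a = nhpi e * nhpi c + 1 ->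
  nhpi (free_star (a * b - c * e - 1)) = 0.
Proof.
move=> sa sb sc se h; rewrite !free_starB !free_starM free_star1 sa sb sc se.
by rewrite !nhpiD !nhpiN !nhpiM h nhpi1 addrAC addrK subrr.
Qed.

Lemma nh_ideal_star_braid a b : free_star a = a -> free_star b = b ->
  nhpi a * nhpi b * nhpi a = nhpi b * nhpi a * nhpi b ->
  nhpi (free_star (a * b * a - b * a * b)) = 0.
Proof.
move=> sa sb h; rewrite free_starB !free_starM sa sb nhpiD nhpiN !nhpiM !mulrA.
by rewrite h subrr.
Qed.

Lemma nh_ideal_star x : nh_ideal_rel x -> nh_ideal_rel (free_star x).
Proof.
have sy i : free_star (y i) = y i by exact: free_star_gen.
have sp j : free_star (psi j) = psi j by exact: free_star_gen.
move=> h; elim: h => {x} [x|||a x _|a x _].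
- case=> {x} [i j|i j h1 h2|j|j|j|i j h|i j h|i h].
  + by apply/nhpi0/nh_ideal_star_comm => //; exact: nh_yy.
  + by apply/nhpi0/nh_ideal_star_comm => //; exact: nh_ypsi.
  + by apply/nhpi0/nh_ideal_star_nil => //; exact: nh_nil2.
  + by apply/nhpi0/nh_ideal_star_nil => //; exact: nh_nil1.
  + by rewrite free_starX //; apply/NhRel/RelPsi2.
  + by apply/nhpi0/nh_ideal_star_comm => //; exact: nh_far.
  + by apply/nhpi0/nh_ideal_star_braid => //; exact: nh_braid.
  + by rewrite free_starX //; apply/NhRel/RelCyc.
- by rewrite free_star0; exact: NhZero.
- by move=> x z _ h1 _ h2; rewrite free_starD; apply: NhAdd.
- by move=> h; rewrite free_starM; apply: NhMulr.
- by move=> h; rewrite free_starM; apply: NhMull.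
Qed.

Lemma nh_starE x : nh_star (nhpi x) = nhpi (free_star x).
Proof.
apply/qpi_eq/nh_idealP; rewrite /= -free_starB.
by apply/nh_ideal_star/nh_idealP; exact: qreprP.
Qed.

Lemma nh_starM : forall x z, nh_star (x * z) = nh_star z * nh_star x.
Proof.
elim/nhpi_ind => x; elim/nhpi_ind => z.
by rewrite -nhpiM !nh_starE -nhpiM free_starM.
Qed.

Lemma nh_star_y i : nh_star (ynh i) = ynh i.
Proof. by rewrite nh_starE; congr nhpi; exact: free_star_gen. Qed.

Lemma nh_star_psi j : nh_star (psinh j) = psinh j.
Proof. by rewrite nh_starE; congr nhpi; exact: free_star_gen. Qed.

End NilHecke.

Section QuiverSchur.
Context (k : fieldType) (n l : nat).
Local Notation NH := (nh k n l).
Local Notation nhd := (@nh_d k n l).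

(** The 0/1-sequences of length [l] with [n] ones. *)
Definition partn : Type := {la : l.-tuple bool | count id la == n}.
HB.instance Definition _ := Finite.on partn.

(** The increasing sequence j_1 < ... < j_n of the positions (counted from 1)
    of the ones of [la]. *)
Definition ones (la : partn) : seq nat :=
  [seq i.+1 | i <- iota 0 l & nth false (val la) i].

Definition ylam (la : partn) : NH :=
  \prod_(i < n) ynh k l i ^+ (l - nth 0%N (ones la) i).

Definition shift_lam (la : partn) : int :=
  - (n * l)%N%:Z + \sum_(j <- ones la) j%:Z.

(** The direct sum of the right ideals [G(la)] generated by [ylam la]. *)
Definition in_qs_mod (x : {ffun partn -> NH}) : Prop :=
  forall la, exists h, x la = ylam la * h.

Definition qs_mod_pred : {pred {ffun partn -> NH}} := fun x => `[< in_qs_mod x >].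

Lemma qs_mod_closed : submod_closed qs_mod_pred.
Proof.
split=> [|c x z]; rewrite !unfold_in.
  by apply/asboolP => la; exists 0; rewrite ffunE mulr0.
move=> /asboolP hx /asboolP hz; apply/asboolP => la.
have [h eh] := hx la; have [h' eh'] := hz la.
by exists (c *: h + h'); rewrite !ffunE eh eh' mulrDr nh_scalerAr.
Qed.

Definition qs_mod : Type := subv (Subspace qs_mod_closed).
HB.instance Definition _ := GRing.Lmodule.on qs_mod.

Definition qs_coord (x : qs_mod) : {ffun partn -> NH} := val x.

Lemma qs_modP (x : qs_mod) : in_qs_mod (qs_coord x).
Proof. exact/asboolP/(valP x). Qed.

Definition mk_qs_mod (x : {ffun partn -> NH}) (h : in_qs_mod x) : qs_mod :=
  exist _ x (introT (asboolP (in_qs_mod x)) h).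

Lemma qs_coordK x h : qs_coord (@mk_qs_mod x h) = x.
Proof. by []. Qed.

Lemma qs_coord_inj : injective qs_coord.
Proof. exact: val_inj. Qed.

Lemma qs_coordP c (x z : qs_mod) :
  qs_coord (c *: x + z) = c *: qs_coord x + qs_coord z.
Proof. by []. Qed.

Lemma qs_act_subproof (x : qs_mod) (h : NH) :
  in_qs_mod [ffun la => qs_coord x la * h].
Proof.
by move=> la; have [g eg] := qs_modP x la; exists (g * h); rewrite ffunE eg mulrA.
Qed.

Definition qs_act (x : qs_mod) (h : NH) : qs_mod :=
  mk_qs_mod (qs_act_subproof x h).

(** [ylam la] is an eigenvector of the differential up to a right factor,
    because the [ynh i] commute. *)
Lemma nh_d_ylam la : exists h, nhd (ylam la) = ylam la * h.
Proof.
pose T (z : NH) := forall w, (forall i, w * ynh k l i = ynh k l i * w) ->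
  w * z = z * w.
pose C (z : NH) := forall i, z * ynh k l i = ynh k l i * z.
pose P (z : NH) := T z /\ C z /\ exists h, [/\ T h, C h & nhd z = z * h].
have P1 : P 1.
  split; first by move=> w _; rewrite mulr1 mul1r.
  split; first by move=> i; rewrite mulr1 mul1r.
  exists 0; split; rewrite ?mulr0.
  - by move=> w _; rewrite mulr0 mul0r.
  - by move=> i; rewrite mulr0 mul0r.
  - by rewrite -[1](@nhpi1 k n l) nh_dE free_d1 (raddf0 (@nhpi k n l)).
have PM z w : P z -> P w -> P (z * w).
  move=> [Tz [Cz [h [Th Ch eh]]]] [Tw [Cw [g [Tg Cg eg]]]].
  split; first by move=> v Cv; rewrite mulrA (Tz v Cv) -mulrA (Tw v Cv) mulrA.
  split; first by move=> i; rewrite -mulrA (Cw i) mulrA (Cz i) mulrA.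
  exists (h + g); split.
  - by move=> v Cv; rewrite mulrDr mulrDl (Th v Cv) (Tg v Cv).
  - by move=> i; rewrite mulrDr mulrDl (Ch i) (Cg i).
  - rewrite nh_dM eh eg mulrDr !mulrA; congr (_ + _).
    by rewrite -!mulrA; congr (_ * _); exact: (Tw h Ch).
have Py i : P (ynh k l i).
  split; first by move=> w Cw; exact: Cw.
  split; first by move=> j; exact: nh_yy.
  exists (ynh k l i); split; last by rewrite nh_d_y expr2.
    by move=> w Cw; exact: Cw.
  by move=> j; exact: nh_yy.
have [_ [_ [h [_ _ eh]]]] : P (ylam la); last by exists h.
rewrite /ylam; elim/big_ind: _ => // i _.
by elim: (_ - _)%N => [|m IH]; rewrite ?expr0 // exprS; apply: PM.
Qed.

Lemma qs_mod_d_subproof (x : qs_mod) : in_qs_mod [ffun la => nhd (qs_coord x la)].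
Proof.
move=> la; have [g eg] := qs_modP x la; have [h eh] := nh_d_ylam la.
by exists (h * g + nhd g); rewrite ffunE eg nh_dM eh mulrDr mulrA.
Qed.

Definition qs_mod_d (x : qs_mod) : qs_mod := mk_qs_mod (qs_mod_d_subproof x).

(** In [G(la)] an element of degree [a] of the nilHecke algebra is placed in
    degree [a + shift_lam la]. *)
Definition qs_mod_deg (i : int) (x : qs_mod) : Prop :=
  forall la, nh_deg (i - shift_lam la) (qs_coord x la).

Lemma qs_mod_d_linear : linear qs_mod_d.
Proof.
move=> c x z; apply: qs_coord_inj.
rewrite qs_coordP !qs_coordK; apply/ffunP => la.
by rewrite !ffunE linearP.
Qed.

Lemma qs_mod_d_act x h :
  qs_mod_d (qs_act x h) = qs_act (qs_mod_d x) h + qs_act x (nhd h).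
Proof.
apply: qs_coord_inj; rewrite -[X in X + _]scale1r qs_coordP scale1r !qs_coordK.
by apply/ffunP => la; rewrite !ffunE nh_dM.
Qed.

Lemma qs_act_linear h : linear (qs_act^~ h).
Proof.
move=> c x z; apply: qs_coord_inj; rewrite qs_coordP !qs_coordK.
by apply/ffunP => la; rewrite !ffunE mulrDl nh_scalerAl.
Qed.

(** The endomorphisms of the right module.  As the module is finitely
    generated, every endomorphism is a sum of homogeneous ones. *)
Definition is_qs_end (f : qs_mod -> qs_mod) : Prop :=
  linear f /\ forall x h, f (qs_act x h) = qs_act (f x) h.

Definition qs_end_pred : {pred (qs_mod -> qs_mod)} := fun f => `[< is_qs_end f >].

Lemma qs_end_closed : submod_closed qs_end_pred.
Proof.
split=> [|c f g]; rewrite !unfold_in.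
  apply/asboolP; split=> [c x z|x h] /=; first by rewrite scaler0 addr0.
  apply: qs_coord_inj; rewrite qs_coordK.
  by apply/ffunP => la; rewrite !ffunE mul0r.
move=> /asboolP[lf hf] /asboolP[lg hg].
have E x : (c *: f + g) x = c *: f x + g x by [].
apply/asboolP; split=> [a x z|x h].
  by rewrite !E lf lg !scalerDr !scalerA mulrC addrACA.
by rewrite !E hf hg qs_act_linear.
Qed.

Definition qschur : Type := subv (Subspace qs_end_closed).
HB.instance Definition _ := GRing.Lmodule.on qschur.

Definition qs_fun (f : qschur) : qs_mod -> qs_mod := val f.
Coercion qs_fun : qschur >-> Funclass.

Lemma qs_endP (f : qschur) : is_qs_end f.
Proof. exact/asboolP/(valP f). Qed.

Definition mk_qschur (f : qs_mod -> qs_mod) (h : is_qs_end f) : qschur :=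
  exist _ f (introT (asboolP (is_qs_end f)) h).

Lemma qs_id_subproof : is_qs_end id. Proof. by []. Qed.

Lemma qs_comp_subproof (f g : qschur) : is_qs_end (f \o g).
Proof.
have [lf hf] := qs_endP f; have [lg hg] := qs_endP g.
by split=> [c x z|x h] /=; rewrite ?lg ?lf ?hg ?hf.
Qed.

Lemma qs_d_subproof (f : qschur) :
  is_qs_end (fun x => qs_mod_d (f x) - f (qs_mod_d x)).
Proof.
have [lf hf] := qs_endP f; have ld := qs_mod_d_linear.
have fD x z : f (x + z) = f x + f z.
  by have := lf 1 x z; rewrite !scale1r.
have aD x z h : qs_act (x - z) h = qs_act x h - qs_act z h.
  have := qs_act_linear h (-1) z x.
  by rewrite !scaleN1r ![- _ + _]addrC.
split=> [c x z|x h].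
  rewrite lf !ld lf scalerBr -!addrA; congr (_ + _).
  by rewrite opprD addrCA.
rewrite hf !qs_mod_d_act fD !hf aD opprD -!addrA; congr (_ + _).
by rewrite addrCA subrr addr0.
Qed.

Definition qs_d (f : qschur) : qschur := mk_qschur (qs_d_subproof f).

Definition qs_deg (i : int) (f : qschur) : Prop :=
  forall j x, qs_mod_deg j x -> qs_mod_deg (i + j) (f x).

Definition qschur_dga : dgalg k :=
  @DGAlg k (@DGSpace k qschur qs_deg qs_d) (mk_qschur qs_id_subproof)
    (fun f g => mk_qschur (qs_comp_subproof f g)).

(** The generator [ylam la] of the summand [G(la)]. *)
Lemma qs_gen_subproof (la : partn) :
  in_qs_mod [ffun nu => if nu == la then ylam la else 0].
Proof.
move=> nu; rewrite ffunE; case: eqP => [->|_]; first by exists 1; rewrite mulr1.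
by exists 0; rewrite mulr0.
Qed.

Definition qs_gen (la : partn) : qs_mod := mk_qs_mod (qs_gen_subproof la).

(** [g = f^*]: for all [mu], [nu], if [f'] and [g'] are the components of [f]
    and [g] from [G(nu)] to [G(mu)] and from [G(mu)] to [G(nu)] respectively,
    then [g' (ylam mu) = (f' (ylam nu))^*]. *)
Definition is_qs_adjoint (f g : qschur) : Prop :=
  forall mu nu : partn,
    qs_coord (g (qs_gen mu)) nu = nh_star (qs_coord (f (qs_gen nu)) mu).

Definition is_qs_star (star : qschur -> qschur) : Prop :=
  forall f, is_qs_adjoint f (star f).

Lemma qs_mod_gen_ext (f g : qschur) :
  (forall mu, f (qs_gen mu) = g (qs_gen mu)) -> f = g.
Proof.
move=> fg; apply: val_inj; apply: funext => x; rewrite -!/(qs_fun _ _).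
have [h eh] : exists h : partn -> NH, forall la, qs_coord x la = ylam la * h la.
  by have /choice[h] := qs_modP x; exists h.
have -> : x = \sum_la qs_act (qs_gen la) (h la).
  apply: qs_coord_inj; rewrite /qs_coord raddf_sum /=; apply/ffunP => mu.
  rewrite -/(qs_coord x) eh sum_ffunE (bigD1 mu) //= !ffunE eqxx big1 ?addr0 //.
  by move=> nu /negPf ne; rewrite !ffunE eq_sym ne mul0r.
have sumE (u : qschur) :
    u (\sum_la qs_act (qs_gen la) (h la)) =
    \sum_la qs_act (u (qs_gen la)) (h la).
  have [lu hu] := qs_endP u.
  have uD x1 x2 : u (x1 + x2) = u x1 + u x2.
    by have := lu 1 x1 x2; rewrite !scale1r.
  have u0 : u 0 = 0 by apply: (addrI (u 0)); rewrite -uD !addr0.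
  rewrite (big_morph _ uD u0); apply: eq_bigr => la _; exact: hu.
by rewrite !sumE; apply: eq_bigr => la _; rewrite fg.
Qed.

Lemma qs_star_unique (s s' : qschur -> qschur) :
  is_qs_star s -> is_qs_star s' -> s =1 s'.
Proof.
move=> h h' f; apply: qs_mod_gen_ext => mu; apply: qs_coord_inj.
by apply/ffunP => nu; rewrite h h'.
Qed.

End QuiverSchur.

(* Main.v *)
Require Import Defs.
From HB Require Import structures.
From mathcomp Require Import all_boot fingroup perm all_algebra finmap.
From mathcomp Require Import zify ring.
From mathcomp Require Import boolp functions.
From mathcomp.multinomials Require Import monalg.

Set Implicit Arguments.
Unset Strict Implicit.
Unset Printing Implicit Defensive.

Import GRing.Theory.
Local Open Scope ring_scope.

(** The nilHecke algebra acts on polynomials by Demazure operators, and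
    [tau_la], the alternating sum of the coefficients at the permutations of the
    exponent of [y^la], makes these operators self-adjoint; so the functionals
    [x |-> tau_la (f * x g)] descend to the cyclotomic quotient.  They kill the
    ideal of [y^ka] unless [ka] is [la] or has a larger sum of positions of
    ones, and on the elements [psi_c y^la psi_c'^*], where [c] and [c'] index
    reduced words of permutations, they are products of a factor for [c] and a
    factor for [c'], both triangular.  Hence these elements are free.  A count
    by Lehmer codes shows that those divisible by [y^mu] on the left span
    [y^mu NH]; by symmetry those divisible on both sides span
    [y^mu NH :&: NH y^nu], the space of morphisms from [G(nu)] to [G(mu)].  Thus
    the quiver Schur algebra has a cellular basis.  Its cell ideals are generated
    by the projections onto the [G(la)], taken by decreasing sum: each of these
    idempotents is fixed by the anti-involution, homogeneous of degree 0 and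
    killed by the differential, so the cell module it generates modulo the later
    idempotents is a direct summand of the quotient algebra. *)

(** * Free families, gradings and tensor products *)

(** No basis theorem for the cyclotomic quotient is assumed. The functionals bound dimensions from
    below, normal forms bound them from above, and the count makes the bounds meet, so the normal
    forms turn out free as well. This freeness is used again: that a morphism out of G(nu) sends
    y^nu into NH y^nu is not formal. One only sees that every right annihilator of y^nu kills the
    image. Writing the image in the elements psi_c^* with polynomial coefficients reduces the claim
    to the commutative algebra of polynomials in the y_i, where a nondegenerate trace form, the
    functional of the staircase exponents l-1, ..., l-n, gives the double annihilator property.
    Another obstacle is that the anti-involution does not commute with the differential: the right
    module of a cell carries the conjugate differential. Ordering by the sum of positions serves
    twice: the functionals of a partition vanish on the ideals of other partitions of equal or
    smaller sum, and a cell element into or out of G(la) through another partition goes through one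
    of smaller sum. *)

Section LinearAlgebra.
Context (k : fieldType) (V : lmodType k).

Definition free_fam (T : finType) (b : T -> V) : Prop :=
  forall c : T -> k, \sum_t c t *: b t = 0 -> forall t, c t = 0.

Definition in_span (T : finType) (b : T -> V) (x : V) : Prop :=
  exists c : T -> k, x = \sum_t c t *: b t.

Lemma in_spanD (T : finType) (b : T -> V) a x y :
  in_span b x -> in_span b y -> in_span b (a *: x + y).
Proof.
move=> [c ->] [d ->]; exists (fun t => a * c t + d t).
rewrite scaler_sumr -big_split; apply: eq_bigr => t _.
by rewrite scalerDl scalerA.
Qed.

Lemma in_span0 (T : finType) (b : T -> V) : in_span b 0.
Proof. by exists (fun=> 0); rewrite big1 // => t _; rewrite scale0r. Qed.

Lemma in_spanZ (T : finType) (b : T -> V) a x : in_span b x -> in_span b (a *: x).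
Proof. by move=> h; rewrite -[_ *: _]addr0; apply: in_spanD h (in_span0 b). Qed.

Lemma in_span_add (T : finType) (b : T -> V) x y :
  in_span b x -> in_span b y -> in_span b (x + y).
Proof. by move=> hx hy; rewrite -[x]scale1r; apply: in_spanD. Qed.

Lemma in_span_sum (T : finType) (b : T -> V) (I : Type) (r : seq I) (P : pred I) (F : I -> V) :
  (forall i, P i -> in_span b (F i)) -> in_span b (\sum_(i <- r | P i) F i).
Proof.
by move=> h; elim/big_ind: _ => //; [exact: in_span0 | exact: in_span_add].
Qed.

Lemma in_span_mem (T : finType) (b : T -> V) t : in_span b (b t).
Proof.
exists (fun u => (u == t)%:R); rewrite (bigD1 t) //= eqxx scale1r big1 ?addr0 //.
by move=> u /negPf ->; rewrite scale0r.
Qed.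

Lemma in_span_trans (T U : finType) (b : T -> V) (u : U -> V) x :
  (forall t, in_span u (b t)) -> in_span b x -> in_span u x.
Proof. by move=> h [c ->]; apply: in_span_sum => t _; apply: in_spanZ. Qed.

(** The matrix of [b] in terms of [u] has independent rows because [b] is free, so [#|U| <= #|T|]
    forces it to be invertible; its inverse writes [u] in terms of [b] and transports freeness. *)
Lemma free_spans (T U : finType) (b : T -> V) (u : U -> V) :
  (#|U| <= #|T|)%N -> free_fam b -> (forall t, in_span u (b t)) ->
  (forall s, in_span b (u s)) /\ free_fam u.
Proof.
move=> leUT fb /choice[C hC].
pose P : 'M[k]_(#|T|, #|U|) := \matrix_(i, j) C (enum_val i) (enum_val j).
have reT (W : finType) (F : W -> V) : \sum_(i < #|W|) F (enum_val i) = \sum_w F w.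
  by rewrite -(@big_enum_val _ _ _ W W).
have fP : row_free P.
  rewrite -kermx_eq0; apply/rowV0P => v /sub_kermxP vP.
  have := fb (fun t => v 0 (enum_rank t)); rewrite -reT => h.
  apply/rowP => i; rewrite mxE -(enum_valK i); apply: h.
  under eq_bigr => j _ do rewrite enum_valK hC scaler_sumr -reT.
  rewrite exchange_big big1 //= => j _.
  under eq_bigr => i' _ do rewrite scalerA.
  rewrite -scaler_suml; have /rowP/(_ j) := vP; rewrite !mxE => e.
  by under eq_bigr => i' _ do (rewrite -[C _ _]/(C (enum_val i') (enum_val j)));
     rewrite (_ : \sum_(_ < _) _ = 0) ?scale0r // -[RHS]e; apply: eq_bigr => i' _; rewrite mxE.
have rP : \rank P = #|T| by apply/eqP.
have /row_fullP[B BP] : row_full P.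
  by rewrite /row_full eqn_leq rank_leq_col rP.
have bE i : b (enum_val i) = \sum_j P i j *: u (enum_val j).
  by rewrite hC -reT; apply: eq_bigr => j _; rewrite mxE.
have uE j : u (enum_val j) = \sum_i B j i *: b (enum_val i).
  under eq_bigr => i _ do rewrite bE scaler_sumr.
  rewrite exchange_big /=.
  under eq_bigr => j' _ do (under eq_bigr => i _ do rewrite scalerA; rewrite -scaler_suml).
  rewrite (bigD1 j) //= [X in _ = _ + X]big1 => [|j' ne].
    have := congr1 (fun M : 'M_ _ => M j j) BP; rewrite !mxE eqxx /= => ->.
    by rewrite scale1r addr0.
  have := congr1 (fun M : 'M_ _ => M j j') BP; rewrite !mxE eq_sym (negPf ne) /= => ->.
  by rewrite scale0r.
split=> [s|c hc s].
  rewrite -(enum_rankK s) uE; exists (fun t => B (enum_rank s) (enum_rank t)).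
  by rewrite -[RHS]reT; apply: eq_bigr => i _; rewrite enum_valK.
pose r : 'rV[k]_#|U| := \row_j c (enum_val j).
suff r0 : r *m B = 0.
  have : r *m B *m P = r by rewrite -mulmxA BP mulmx1.
  rewrite r0 mul0mx => /esym/rowP/(_ (enum_rank s)).
  by rewrite !mxE enum_rankK.
apply/rowP => i; rewrite mxE [RHS]mxE -(enum_valK i).
have := fb (fun t => \sum_j r 0 j * B j (enum_rank t)); apply.
rewrite -[LHS]reT -[RHS]hc -[RHS]reT.
under [RHS]eq_bigr => j _ do rewrite uE scaler_sumr.
rewrite exchange_big /=; apply: eq_bigr => i' _.
by rewrite scaler_suml; apply: eq_bigr => j _; rewrite enum_valK scalerA mxE.
Qed.

End LinearAlgebra.

Section Bilinear.
Context (k : fieldType).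

Lemma in_span_lin (V W : lmodType k) (f : V -> W) (T : finType) (b : T -> V) x : linear f ->
  in_span b x -> in_span (f \o b) (f x).
Proof.
move=> fl [c ->]; exists c.
have fD : {morph f : y z / y + z} by move=> y z; have := fl 1 y z; rewrite !scale1r.
have f0 : f 0 = 0 by apply: (addrI (f 0)); rewrite -fD !addr0.
rewrite (big_morph _ fD f0); apply: eq_bigr => t _.
by have := fl (c t) (b t) 0; rewrite f0 !addr0.
Qed.

Lemma in_span_bilin (V W Z : lmodType k) (f : V -> W -> Z) (T U : finType) (b : T -> V) (c : U -> W) x y :
  (forall y, linear (f^~ y)) -> (forall x, linear (f x)) ->
  in_span b x -> in_span c y -> in_span (fun u : T * U => f (b u.1) (c u.2)) (f x y).
Proof.
move=> fl fr hx hy.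
apply: in_span_trans (in_span_lin (fl y) hx) => t.
apply: in_span_trans (in_span_lin (fr (b t)) hy) => u.
exact: (in_span_mem (fun w : T * U => f (b w.1) (c w.2)) (t, u)).
Qed.

End Bilinear.

Section TriangularFunctionals.
Context (k : fieldType) (T : finType) (X : Type) (a : T -> X -> k) (w : T -> nat).

(** Induction from the heaviest index downwards: the test point [f] of [c] sees only [c] and heavier
    indices, whose coefficients are already known to vanish. *)
Lemma triangular_free :
  (forall c, exists f, a c f != 0 /\
     forall c', a c' f != 0 -> c' = c \/ (w c < w c')%N) ->
  forall C : T -> k, (forall f, \sum_c C c * a c f = 0) -> forall c, C c = 0.
Proof.
move=> tri C hC c; apply/eqP/negP => /negP.
have [m] := ubnP (\max_c' w c' - w c); elim: m c => // m IH c lem Cc.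
have [f [af hf]] := tri c.
have := hC f; rewrite (bigD1 c) //=.
have [h|/existsNP[c' /negP]] :=
    pselect (forall c', ~~ [&& c' != c, C c' != 0 & a c' f != 0]).
  rewrite big1 => [|c' ne].
    by move/eqP; rewrite addr0 mulf_eq0 (negPf Cc) (negPf af).
  by have := h c'; rewrite ne /= negb_and !negbK => /orP[] /eqP ->;
     rewrite ?mul0r ?mulr0.
rewrite negbK => /and3P[ne Cc' ac'] _.
have [e|lt] := hf _ ac'; first by rewrite e eqxx in ne.
apply: (IH c') => //.
have := @leq_bigmax T w c'; lia.
Qed.

End TriangularFunctionals.

Section Leibniz.
Context (U V W : zmodType) (m : U -> V -> W) (dU : U -> U) (dV : V -> V) (dW : W -> W).
Hypothesis dD : {morph dW : x y / x + y}.
Hypothesis dM : forall u v, dW (m u v) = m (dU u) v + m u (dV v).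

Lemma iter_leibniz r u v :
  iter r dW (m u v) = \sum_(i < r.+1) m (iter (r - i) dU u) (iter i dV v) *+ 'C(r, i).
Proof.
have d0 : dW 0 = 0 by apply: (addrI (dW 0)); rewrite -dD !addr0.
have dMn x j : dW (x *+ j) = dW x *+ j.
  by elim: j => [|j IH]; rewrite ?mulr0n // !mulrS dD IH.
elim: r => [|r IH]; first by rewrite big_ord1 /= bin0 mulr1n.
rewrite iterS IH (big_morph _ dD d0).
under eq_bigr => i _ do rewrite dMn dM mulrnDl -!iterS.
rewrite big_split /= [RHS]big_ord_recl /= ?subn0 ?bin0.
under [in RHS]eq_bigr => i _ do rewrite /bump add1n subSS binS mulrnDr.
rewrite big_split /= addrA; congr (_ + _).
rewrite big_ord_recl /= ?subn0 ?bin0 [in RHS]big_ord_recr /= bin_small // mulr0n addr0.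
congr (_ + _); apply: eq_bigr => i _; rewrite /bump add1n.
by rewrite -iterS subnSK.
Qed.

(** The inner binomial coefficients are divisible by [p], so the [p]-th iterate again obeys the
    Leibniz rule and nilpotence can be checked on generators. The pairing [m] is general because it
    is applied both to products and to the evaluation of an endomorphism at a vector. *)
Lemma iter_leibniz_pchar p u v : prime p -> (forall w : W, w *+ p = 0) ->
  iter p dW (m u v) = m (iter p dU u) v + m u (iter p dV v).
Proof.
move=> pp W0; rewrite iter_leibniz big_ord_recl /= ?subn0 ?bin0 mulr1n; congr (_ + _).
case: p pp W0 => // p pp W0; rewrite big_ord_recr /= big1 => [|i _].
  by rewrite add0r /bump add1n subnn binn mulr1n.
have /dvdnP[q ->] : (p.+1 %| 'C(p.+1, bump 0 i))%N.
  by apply: prime_dvd_bin => //; rewrite /bump; have := ltn_ord i; lia.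
by rewrite mulrnA W0.
Qed.

End Leibniz.

(** * Homogeneous decompositions and projections *)

Section Gradings.
Context (k : fieldType) (V : lmodType k) (H : int -> V -> Prop).

(** For a grading, vanishing off [s] makes [F] depend on [x] only and not on the list of degrees. *)
Definition is_decomp (x : V) (s : seq int) (F : int -> V) : Prop :=
  [/\ uniq s, forall i, H i (F i), forall i, i \notin s -> F i = 0 &
      x = \sum_(i <- s) F i].

(** The components as functions: in this form a grading passes to quotients and subspaces by
    explicit formulas. *)
Definition is_proj (pr : int -> V -> V) : Prop :=
  [/\ forall i, linear (pr i),
      forall i x, H i (pr i x),
      forall i x, H i x -> forall j, pr j x = if j == i then x else 0
    & forall x, exists s, is_decomp x s (pr^~ x)].

Lemma sum_sub_uniq (s t : seq int) (F : int -> V) : uniq s -> uniq t ->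
  {subset s <= t} -> (forall i, i \notin s -> F i = 0) ->
  \sum_(i <- t) F i = \sum_(i <- s) F i.
Proof.
move=> us ut st F0; rewrite (bigID (mem s)) /= [X in _ + X]big1 ?addr0 //.
rewrite -big_filter; apply: perm_big; apply: uniq_perm => //.
  exact: filter_uniq.
by move=> i; rewrite mem_filter; apply: andb_idr => /st.
Qed.

Hypothesis H_sub : forall i, H i 0 /\ forall c x y, H i x -> H i y -> H i (c *: x + y).

Lemma decompP c x y s t F G : is_decomp x s F -> is_decomp y t G ->
  is_decomp (c *: x + y) (undup (s ++ t)) (fun i => c *: F i + G i).
Proof.
move=> [us HF F0 ->] [ut HG G0 ->]; split; first exact: undup_uniq.
- by move=> i; apply: (H_sub i).2.
- by move=> i; rewrite mem_undup mem_cat negb_or => /andP[/F0 -> /G0 ->]; rewrite scaler0 addr0.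
- rewrite big_split /= -scaler_sumr; congr (_ *: _ + _); symmetry; apply: sum_sub_uniq => //;
    rewrite ?undup_uniq // => i; rewrite mem_undup mem_cat => ->; rewrite ?orbT //.
Qed.

Lemma decomp_single i x : H i x -> is_decomp x [:: i] (fun j => if j == i then x else 0).
Proof.
move=> hx; split=> //; last by rewrite big_seq1 eqxx.
- by move=> j; case: eqP => [->|_] //; exact: (H_sub j).1.
- by move=> j; rewrite inE => /negPf ->.
Qed.

Lemma decomp0 : is_decomp 0 [::] (fun=> 0).
Proof. by split=> // [i|]; [exact: (H_sub i).1 | rewrite big_nil]. Qed.

Lemma decomp_sum (I : Type) (r : seq I) (d : I -> int) (F : I -> V) :
  (forall i, H (d i) (F i)) -> exists s G, is_decomp (\sum_(i <- r) F i) s G.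
Proof.
move=> hF; elim/big_rec: _ => [|i x _ [s [G hG]]].
  by exists [::], (fun=> 0); exact: decomp0.
rewrite -[F i]scale1r; eexists; eexists; apply: decompP hG; exact: decomp_single.
Qed.

Lemma proj_grading pr : is_proj pr -> is_grading H.
Proof.
move=> [lpr Hpr prE dec]; split=> // [x|s f us Hf sf0 i si].
  by have [s [_ _ _ xE]] := dec x; exists s, (pr^~ x).
have pr0 : pr i 0 = 0 by have := lpr i (-1) 0 0; rewrite !scaleN1r !addNr.
have prD : {morph pr i : x y / x + y} by move=> x y; have := lpr i 1 x y; rewrite !scale1r.
have := congr1 (pr i) sf0; rewrite (big_morph _ prD pr0) pr0 (big_rem i) //=.
rewrite (prE i) // eqxx big_seq big1 ?addr0 // => j.
by rewrite mem_rem_uniq // inE => /andP[/negPf ne _]; rewrite (prE j) // eq_sym ne.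
Qed.

End Gradings.

Section GradingProj.
Context (k : fieldType) (V : lmodType k) (H : int -> V -> Prop).
Hypothesis gH : is_grading H.

Let H_sub : forall i, H i 0 /\ forall c x y, H i x -> H i y -> H i (c *: x + y).
Proof. by case: gH. Qed.

Lemma decomp_unique x s t F G : is_decomp H x s F -> is_decomp H x t G -> F =1 G.
Proof.
move=> dF dG i.
have := decompP H_sub (-1) dF dG; rewrite scaleN1r addNr => -[u HFG FG0 s0].
have [iu|iu] := boolP (i \in undup (s ++ t)).
  have [_ _ h] := gH; have := h _ _ u HFG (esym s0) i iu.
  by rewrite scaleN1r addrC => /subr0_eq.
by have := FG0 i iu; rewrite scaleN1r addrC => /subr0_eq.
Qed.

Lemma grading_proj : exists pr, is_proj H pr.
Proof.
have /choice[S /choice[P dec]] : forall x, exists s F, is_decomp H x s F.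
  by have [_ ex _] := gH => x; have [s [f [hf ->]]] := ex x; exact: (@decomp_sum _ _ _ H_sub _ s id f).
exists (fun i x => P x i); split.
- by move=> i c x y; apply: (decomp_unique (dec _) (decompP H_sub c (dec x) (dec y))).
- by move=> i x; have [_ h _ _] := dec x.
- by move=> i x hx j; apply: (decomp_unique (dec x) (decomp_single H_sub hx)).
- by move=> x; exists (S x).
Qed.

End GradingProj.

Section ProjTheory.
Context (k : fieldType) (V : lmodType k) (H : int -> V -> Prop) (pr : int -> V -> V).
Hypothesis prP : is_proj H pr.

Lemma pr0 i : pr i 0 = 0.
Proof.
have [l _ _ _] := prP.
by have := l i (-1) 0 0; rewrite !scaleN1r !addNr.
Qed.

Lemma prD i : {morph pr i : x y / x + y}.
Proof. by have [l _ _ _] := prP => x y; have := l i 1 x y; rewrite !scale1r. Qed.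

Lemma pr_sum i (I : Type) (r : seq I) (P : pred I) F :
  pr i (\sum_(j <- r | P j) F j) = \sum_(j <- r | P j) pr i (F j).
Proof. exact: (big_morph _ (prD i) (pr0 i)). Qed.

Lemma pr_id i x : H i x -> pr i x = x.
Proof. by have [_ _ h _] := prP => /h ->; rewrite eqxx. Qed.

Lemma pr_hom i x : H i (pr i x). Proof. by have [_ h _ _] := prP. Qed.

Lemma pr_decomp x : exists2 s, uniq s & x = \sum_(i <- s) pr i x.
Proof. by have [_ _ _ h] := prP; have [s [u _ _ e]] := h x; exists s. Qed.

(** Applied to multiplication by [ylam k la], this shows that the components of elements of a
    principal one-sided ideal stay in it and have homogeneous cofactors. *)
Lemma pr_morph (W : lmodType k) (HW : int -> W -> Prop) (prW : int -> W -> W)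
    (f : V -> W) d : is_proj HW prW -> {morph f : x y / x + y} ->
  (forall i x, H i x -> HW (i + d) (f x)) -> forall i x, prW (i + d) (f x) = f (pr i x).
Proof.
move=> prWP fD fH i x; have [_ _ hW _] := prWP; have [_ _ h _] := prP.
have f0 : f 0 = 0 by apply: (addrI (f 0)); rewrite -fD !addr0.
have [lW _ _ _] := prWP.
have WD : {morph prW (i + d) : x y / x + y} by move=> y z; have := lW (i + d) 1 y z; rewrite !scale1r.
have W0 : prW (i + d) 0 = 0 by apply: (addrI (prW (i + d) 0)); rewrite -WD !addr0.
have [s _ ->] := pr_decomp x.
rewrite (big_morph _ fD f0) (big_morph _ WD W0) pr_sum (big_morph _ fD f0).
apply: eq_bigr => j _.
rewrite (hW (j + d)); last exact/fH/pr_hom.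
rewrite (h j (pr j x)); last exact: pr_hom.
by rewrite (inj_eq (addIr d)); case: eqP => // _; rewrite f0.
Qed.

End ProjTheory.

Section QuotientGrading.
Context (k : fieldType) (V : dgspace k) (U : subspace V).
Hypothesis gV : is_grading (@dg_deg k V).
Hypothesis gU : is_graded_sub (fun x : V => x \in U).

Lemma graded_sub_pr pr : is_proj (@dg_deg k V) pr -> forall i x, x \in U -> pr i x \in U.
Proof.
move=> prP i x /gU[s [f [fP ->]]]; rewrite (pr_sum prP); apply: rpred_sum => j _.
have [_ _ h _] := prP; rewrite (h _ _ (fP j).1).
by case: eqP => _; [exact: (fP j).2 | exact: rpred0].
Qed.

Lemma quot_grading : is_grading (@dg_deg k (quot_dgspace U)).
Proof.
have [pr prP] := grading_proj gV; have [sV _ _] := gV.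
have prU := graded_sub_pr prP.
(* Independence of the representative: components of elements of [U] stay in [U]. *)
have prE i x : qpi U (pr i (qrepr (qpi U x))) = qpi U (pr i x).
  apply/qpi_eq; have [lp _ _ _] := prP.
  have -> : pr i (qrepr (qpi U x)) - pr i x = pr i (qrepr (qpi U x) - x).
    by rewrite [in RHS]addrC -[in RHS]scaleN1r lp scaleN1r addrC.
  by apply: prU; exact: qreprP.
apply: (@proj_grading _ _ _ _ (fun i x => qpi U (pr i (qrepr x)))).
  move=> i; split; first by exists 0; [exact: (sV i).1 | rewrite linear0].
  move=> c _ _ [x hx ->] [y hy ->]; exists (c *: x + y); first exact: (sV i).2.
  by rewrite linearP.
split.
- move=> i c; elim/qpi_ind => x; elim/qpi_ind => y.
  by rewrite -linearP !prE; have [lp _ _ _] := prP; rewrite lp linearP.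
- by move=> i x; exists (pr i (qrepr x)) => //; exact: (pr_hom prP).
- move=> i _ [x hx ->] j; rewrite prE; have [_ _ h _] := prP; rewrite (h _ _ hx).
  by case: eqP => // _; rewrite linear0.
- move=> x; have [_ _ _ h] := prP; have [s [us _ s0 e]] := h (qrepr x); exists s; split=> //.
  + by move=> i; exists (pr i (qrepr x)) => //; exact: (pr_hom prP).
  + by move=> i /s0 ->; rewrite linear0.
  + by rewrite -[LHS]qreprK {1}e raddf_sum.
Qed.

End QuotientGrading.

Section SubGrading.
Context (k : fieldType) (V : dgspace k) (F : V -> Prop).

End SubGrading.

(** * Linear maps out of a tensor product *)

Section LinearExtension.
Context (k : fieldType) (K : choiceType) (V : lmodType k).

Definition lext (f : K -> V) (x : {malg k[K]}) : V := \sum_(w <- msupp x) x@_w *: f w.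

Lemma lextw f (x : {malg k[K]}) (d : {fset K}) : (msupp x `<=` d)%fset ->
  lext f x = \sum_(w <- d) x@_w *: f w.
Proof.
move=> sxd; rewrite /lext (big_fset_incl _ sxd) //= => w _.
by move/mcoeff_outdom ->; rewrite scale0r.
Qed.

Lemma lext_linear f : linear (lext f).
Proof.
move=> c x y; pose d := (msupp x `|` msupp y)%fset.
rewrite (@lextw f x d) ?fsubsetUl // (@lextw f y d) ?fsubsetUr // (@lextw f _ d).
  rewrite scaler_sumr -big_split /=; apply: eq_bigr => w _.
  by rewrite mcoeffD mcoeffZ scalerDl scalerA.
by apply: fsubset_trans (msuppD_le _ _) _; apply: fsetSU; exact: msuppZ_le.
Qed.

HB.instance Definition _ f :=
  GRing.isLinear.Build k {malg k[K]} V *:%R (lext f) (lext_linear f).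

Lemma lextU f w : lext f << w >> = f w.
Proof. by rewrite /lext msuppU oner_eq0 big_seq_fset1 mcoeffUU scale1r. Qed.

End LinearExtension.

Section TensorLift.
Context (k : fieldType) (V W Z : lmodType k) (b : V -> W -> Z).
Hypothesis bl : forall y, linear (b^~ y).
Hypothesis br : forall x, linear (b x).

(** The linear extension to the free module on pairs kills the defining relations, so its value on a
    representative does not depend on the choice. *)
Lemma tens_lift : exists phi : {linear tensor V W -> Z}, forall x y, phi (tens x y) = b x y.
Proof.
pose g := lext (fun u : V * W => b u.1 u.2).
have gl : linear g by exact: lext_linear.
have gU u : g << u >> = b u.1 u.2 by exact: lextU.
have gB u v : g (u - v) = g u - g v by exact: raddfB.
have gZ c u : g (c *: u) = c *: g u by exact: linearZ.
have g0 x : tens_rel x -> g x = 0.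
  elim=> {x} [|c x y _ h1 _ h2|c x x' y|c x y y']; first exact: linear0.
  - by rewrite gl h1 h2 scaler0 addr0.
  - by rewrite !gB gZ !gU /= bl -addrA -opprD subrr.
  - by rewrite !gB gZ !gU /= br -addrA -opprD subrr.
pose f (t : tensor V W) := g (qrepr t).
have fE x : f (qpi _ x) = g x.
  apply/eqP; rewrite -subr_eq0 /f /g -linearB; apply/eqP/g0.
  by have /asboolP := qreprP (Subspace (@tens_closed k V W)) x.
have fl : linear f.
  by move=> c; elim/qpi_ind => x; elim/qpi_ind => y; rewrite -linearP !fE /g linearP.
pose fL := GRing.isLinear.Build k (tensor V W) Z *:%R f fl.
exists (HB.pack_for {linear tensor V W -> Z} f fL) => x y /=.
by rewrite fE gU.
Qed.

Lemma tensor_sum (t : tensor V W) : exists (n : nat) (x : 'I_n -> V) (y : 'I_n -> W),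
  t = \sum_(i < n) tens (x i) (y i).
Proof.
elim/qpi_ind: t => t.
have -> : t = \sum_(w <- msupp t) t@_w *: << w >>.
  rewrite {1}(monalgE t); apply: eq_bigr => w _.
  by apply/malgP => v; rewrite mcoeffZ !mcoeffU mulrnAr mulr1.
rewrite raddf_sum /= big_tnth.
pose w i := tnth (in_tuple (enum_fset (msupp t))) i.
exists (size (enum_fset (msupp t))), (fun i => t@_(w i) *: (w i).1), (fun i => (w i).2).
apply: eq_bigr => i _; rewrite linearZ /= -/(w i).
have := @tens_linearl k V W (w i).2 t@_(w i) (w i).1 0.
have -> : tens (0 : V) (w i).2 = 0.
  have := @tens_linearl k V W (w i).2 (-1) 0 0.
  by rewrite !scaleN1r !addNr.
by rewrite !addr0 => ->; case: (w i).
Qed.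

End TensorLift.

(** * Cell ideals generated by an idempotent *)

Section SubComplex.
Context (k : fieldType) (p : nat) (V : dgspace k) (U : subspace V).
Hypothesis dU : forall x : V, x \in U -> dg_d x \in U.

Definition sub_d (x : subv U) : subv U := exist _ (dg_d (val x)) (dU (valP x)).

Definition sub_dgspace : dgspace k :=
  @DGSpace k (subv U) (fun i x => @dg_deg k V i (val x)) sub_d.

Lemma sub_pcomplex : is_pcomplex p V -> is_graded_sub (fun x : V => x \in U) ->
  is_pcomplex p sub_dgspace.
Proof.
move=> [gV dl dd dp] gU; have [pr prP] := grading_proj gV; have [sV _ _] := gV.
have prU := graded_sub_pr gU prP.
split=> //=.
- apply: (@proj_grading _ _ _ _ (fun i x => exist _ (pr i (val x)) (prU i _ (valP x)) : subv U)).
    by move=> i; split; [exact: (sV i).1 | move=> c x y; exact: (sV i).2].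
  have [lp hp prE dec] := prP; split.
  + by move=> i c x y; apply: val_inj; rewrite /= lp.
  + by move=> i x; exact: hp.
  + by move=> i x hx j; apply: val_inj; rewrite /= (prE _ _ hx); case: eqP.
  + move=> x; have [s [us _ s0 e]] := dec (val x); exists s; split=> //.
    * by move=> i; exact: hp.
    * by move=> i /s0 e'; apply: val_inj.
    * by apply: val_inj; rewrite [LHS]e raddf_sum.
- by move=> c x y; apply: val_inj; rewrite /= dl.
- by move=> i x hx; exact: dd.
- move=> x; apply: val_inj; rewrite -[RHS](dp (val x)).
  by elim: p => //= r ->.
Qed.

End SubComplex.

Section PdgAlgebra.
Context (k : fieldType) (p : nat) (B : dgalg k).
Hypothesis hB : is_pdg_alg p B.
Local Notation "x ** y" := (dga_mul x y) (at level 40, left associativity).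
Implicit Types x y z : B.

Lemma dgmA x y z : x ** (y ** z) = x ** y ** z.
Proof. by case: hB => _ [h _ _] _ _ _; exact: h. Qed.
Lemma dgm1x x : dga_one B ** x = x.
Proof. by case: hB => _ [_ h _] _ _ _; exact: h. Qed.
Lemma dgmx1 x : x ** dga_one B = x.
Proof. by case: hB => _ [_ _ h] _ _ _; exact: h. Qed.
Lemma dgmPr x c y z : x ** (c *: y + z) = c *: (x ** y) + x ** z.
Proof. by case: hB => _ _ h _ _; have [h1 _] := h x; exact: h1. Qed.
Lemma dgmPl x c y z : (c *: y + z) ** x = c *: (y ** x) + z ** x.
Proof. by case: hB => _ _ h _ _; have [_ h1] := h x; exact: h1. Qed.
Lemma dgmDr x y z : x ** (y + z) = x ** y + x ** z.
Proof. by have := dgmPr x 1 y z; rewrite !scale1r. Qed.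
Lemma dgmDl x y z : (y + z) ** x = y ** x + z ** x.
Proof. by have := dgmPl x 1 y z; rewrite !scale1r. Qed.
Lemma dgm0r x : x ** 0 = 0.
Proof. by apply: (addrI (x ** 0)); rewrite -dgmDr !addr0. Qed.
Lemma dgm0l x : 0 ** x = 0.
Proof. by apply: (addrI (0 ** x)); rewrite -dgmDl !addr0. Qed.
Lemma dgmZr x c y : x ** (c *: y) = c *: (x ** y).
Proof. by have := dgmPr x c y 0; rewrite dgm0r !addr0. Qed.
Lemma dgmZl x c y : (c *: y) ** x = c *: (y ** x).
Proof. by have := dgmPl x c y 0; rewrite dgm0l !addr0. Qed.
Lemma dgmBr x y z : x ** (y - z) = x ** y - x ** z.
Proof. by rewrite -scaleN1r dgmDr dgmZr scaleN1r. Qed.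
Lemma dgmBl x y z : (y - z) ** x = y ** x - z ** x.
Proof. by rewrite -scaleN1r dgmDl dgmZl scaleN1r. Qed.
Lemma dgm_sumr x (I : Type) (r : seq I) (P : pred I) F :
  x ** (\sum_(i <- r | P i) F i) = \sum_(i <- r | P i) x ** F i.
Proof. exact: (big_morph _ (dgmDr x) (dgm0r x)). Qed.
Lemma dgm_suml x (I : Type) (r : seq I) (P : pred I) F :
  (\sum_(i <- r | P i) F i) ** x = \sum_(i <- r | P i) F i ** x.
Proof. exact: (big_morph _ (dgmDl x) (dgm0l x)). Qed.
Lemma dgmH i j x y : dg_deg i x -> dg_deg j y -> dg_deg (i + j) (x ** y).
Proof. by case: hB => _ _ _ [_ h] _; exact: h. Qed.
Lemma dg_pcomplex : is_pcomplex p B. Proof. by case: hB. Qed.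
Lemma dg_grading : is_grading (@dg_deg k B). Proof. by case: dg_pcomplex. Qed.
Lemma dg_dM x y : dg_d (x ** y) = dg_d x ** y + x ** dg_d y.
Proof. by case: hB => _ _ _ _ h; exact: h. Qed.
Lemma dg_dP c x y : dg_d (c *: x + y) = c *: dg_d x + dg_d y.
Proof. by case: dg_pcomplex => _ h _ _; exact: h. Qed.
Lemma dg_dD x y : dg_d (x + y) = dg_d x + dg_d y.
Proof. by have := dg_dP 1 x y; rewrite !scale1r. Qed.
Lemma dg_d0 : dg_d (0 : B) = 0.
Proof. by apply: (addrI (dg_d (0 : B))); rewrite -dg_dD !addr0. Qed.
Lemma dg_dB x y : dg_d (x - y) = dg_d x - dg_d y.
Proof. by rewrite addrC -scaleN1r dg_dP scaleN1r addrC. Qed.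
Lemma dg_d1 : dg_d (dga_one B) = 0.
Proof.
have := dg_dM (dga_one B) (dga_one B); rewrite !dgmx1 dgm1x.
by move/eqP; rewrite -subr_eq0 opprD addrA subrr sub0r oppr_eq0 => /eqP.
Qed.

(** Degree 0 and [dg_d e = 0] make the left ideal [B e] graded and stable under the differential,
    and likewise its complement [B (1 - e)]. *)
Definition dg_idem (e : B) : Prop := [/\ dg_deg 0 e, dg_d e = 0 & e ** e = e].

Section Cyclic.
Context (e : B) (he : dg_idem e).

(** The left ideal [B e] given by an equation, so that every element is its own cofactor. *)
Definition cyc_pred : {pred B} := fun x => x ** e == x.

Lemma cyc_closed : submod_closed cyc_pred.
Proof.
split=> [|c x y]; rewrite !unfold_in; first by rewrite dgm0l.
by move=> /eqP hx /eqP hy; rewrite dgmPl hx hy.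
Qed.

Definition cyc_sub : subspace B := Subspace cyc_closed.

Lemma cycP x : reflect (x ** e = x) (x \in cyc_sub). Proof. exact: eqP. Qed.

Lemma cyc_d x : x \in cyc_sub -> dg_d x \in cyc_sub.
Proof.
have [_ de _] := he; move=> /cycP h; apply/cycP.
by rewrite -{2}h dg_dM de dgm0r addr0.
Qed.

Lemma cyc_act_subproof a x : x \in cyc_sub -> a ** x \in cyc_sub.
Proof. by move=> /cycP h; apply/cycP; rewrite -dgmA h. Qed.

Lemma cyc_graded : is_graded_sub (fun x : B => x \in cyc_sub).
Proof.
have [e0 _ ee] := he; have [pr prP] := grading_proj dg_grading => x /cycP hx.
have [s _ xE] := pr_decomp prP x; exists s, (fun i => pr i x ** e); split; last first.
  by rewrite -{1}hx {1}xE dgm_suml.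
move=> i; split; last by apply/cycP; rewrite -dgmA ee.
by rewrite -[i]addr0; apply: dgmH => //; rewrite addr0; exact: (pr_hom prP).
Qed.

Definition cyc_act (a : B) (x : subv cyc_sub) : subv cyc_sub :=
  exist _ (a ** val x) (cyc_act_subproof a (valP x)).

Definition cyc : dgmod B := @DGMod k B (sub_dgspace cyc_d) cyc_act.

Definition mk_cyc x (h : x ** e = x) : cyc := exist _ x (introT (cycP x) h).

Lemma cyc_valP (x : cyc) : val x ** e = val x. Proof. exact/cycP/(valP x). Qed.

Lemma cyc_lmod : is_pdg_lmod p cyc.
Proof.
split.
- exact: sub_pcomplex dg_pcomplex cyc_graded.
- by split=> [x|a b x]; apply: val_inj; rewrite /= ?dgm1x ?dgmA.
- by split=> [a c x y|x c a b]; apply: val_inj; rewrite /= ?dgmPr ?dgmPl.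
- by move=> i j a x ha hx; exact: dgmH.
- by move=> a x; apply: val_inj; rewrite /= dg_dM.
Qed.

End Cyclic.

Lemma regular_lmod : is_pdg_lmod p (regular_shift B 0).
Proof.
have [[gB dl dd dp] _ _ _ _] := hB.
have degE : (fun i => @dg_deg k B (i + 0)) = @dg_deg k B by apply: funext => i; rewrite addr0.
split=> //=.
- by split=> //=; rewrite ?degE // => i x; rewrite !addr0; exact: dd.
- by split; [exact: dgm1x | move=> a b x; rewrite dgmA].
- by split=> [a c x y|x c a b]; rewrite ?dgmPr ?dgmPl.
- by move=> i j a x; rewrite !addr0; exact: dgmH.
- exact: dg_dM.
Qed.

Section Summands.
Context (g : bool -> B) (hg : forall b, dg_idem (g b)).
Hypotheses (g0 : forall b, g b ** g (~~ b) = 0) (g1 : g true + g false = dga_one B).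

Lemma cyc_direct_sum : is_direct_sum (fun b : bool => cyc (hg b)) (regular_shift B 0).
Proof.
exists (fun b (x : cyc (hg b)) => val x : regular_shift B 0); split.
- by move=> b; split=> //= i x; rewrite addr0.
- move=> x; have xg b : x ** g b ** g b = x ** g b by have [_ _ h] := hg b; rewrite -dgmA h.
  exists [:: true; false], (fun b => mk_cyc (hg b) (xg b)).
  by rewrite big_cons big_seq1 /= -dgmDr g1 dgmx1.
- move=> s F us h i si; apply: val_inj => /=.
  have := congr1 (fun x : B => x ** g i) h; rewrite /= dgm0l dgm_suml (big_rem i) //=.
  rewrite cyc_valP big_seq big1 ?addr0 // => j.
  rewrite mem_rem_uniq // inE => /andP[ne _].
  have -> : i = ~~ j by move: ne; case: (i); case: (j).
  by rewrite -cyc_valP -dgmA g0 dgm0r.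
Qed.
End Summands.

(** [B e] is a summand of the regular module, with complement generated by [1 - e], and the regular
    module has property P by the filtration that jumps from 0 to everything in one step. *)
Lemma cyc_cofibrant e (he : dg_idem e) : cofibrant p (cyc he).
Proof.
have [e0 de ee] := he; pose f := dga_one B - e.
have ef : e ** f = 0 by rewrite dgmBr dgmx1 ee subrr.
have fe : f ** e = 0 by rewrite dgmBl dgm1x ee subrr.
have hf : dg_idem f.
  split; last by rewrite {1}/f dgmBl dgm1x ef subr0.
  - have [_ _ _ [h1 _] _] := hB; have [sB _ _] := dg_grading.
    by rewrite /f addrC -scaleN1r; apply: (sB 0).2.
  - by rewrite dg_dB dg_d1 de subr0.
have summ e1 f1 (h1 : dg_idem e1) (h2 : dg_idem f1) : e1 ** f1 = 0 -> f1 ** e1 = 0 ->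
    e1 + f1 = dga_one B -> dg_summand p (cyc h1) (regular_shift B 0).
  move=> z1 z2 s1; exists (cyc h2); split; first exact: cyc_lmod.
  pose g b := if b then e1 else f1.
  pose hg b : dg_idem (g b) := if b as b0 return dg_idem (g b0) then h1 else h2.
  (* The choice by [b] is moved from the modules to the idempotents, the form in which
     [cyc_direct_sum] applies. *)
  have -> : (fun b : bool => if b then cyc h1 else cyc h2) = (fun b => cyc (hg b)).
    by apply: funext; case.
  by apply: cyc_direct_sum => //; case.
have ef1 : e + f = dga_one B by rewrite addrC subrK.
have fe1 : f + e = dga_one B by rewrite subrK.
exists (regular_shift B 0); split; [exact: regular_lmod| |exact: (summ _ _ he hf)].
(* Stage 0 is zero and every later stage is the whole module. *)
exists (fun i x => i = 0%N -> x = 0); split.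
- split=> [x|x]; first by split=> [h|-> //]; exact: h.
  by exists 1%N.
- case=> [|i]; split.
  + by split=> [|c x y h1 h2 _] //; rewrite h1 // h2 // scaler0 addr0.
  + move=> x ->//; exists [::], (fun=> 0); rewrite big_nil; split=> // i; split=> //=.
    by have [sB _ _] := dg_grading; exact: (sB _).1.
  + by move=> x h _; rewrite h //; exact: dg_d0.
  + by move=> a x h _; rewrite h //; exact: dgm0r.
  + by split.
  + move=> x _; have [_ h _] := dg_grading; have [s [F [hF ->]]] := h x.
    by exists s, F; split=> // j; split=> //=; rewrite addr0.
  + by move=> x.
  + by move=> a x.
- by move=> [|i] x h.
move=> [|i].
  exists (regular_shift B 0), bool, (fun b => if b then cyc he else cyc hf); split.
  - split; first exact: regular_lmod.
    exists id; split=> //; first by move=> z; exists z.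
    by move=> x _; split=> [h _|h]; [exact: h | exact: h].
  - 
    pose g b := if b then e else f.
    pose hg b : dg_idem (g b) := if b as b0 return dg_idem (g b0) then he else hf.
    have -> : (fun b : bool => if b then cyc he else cyc hf) = (fun b => cyc (hg b)).
      by apply: funext; case.
    by apply: cyc_direct_sum => //; case.
  - by case; (split; first exact: cyc_lmod); exists 0; [exact: (summ _ _ he hf) | exact: (summ _ _ hf he)].
(* The later subquotients vanish: each is the module of the idempotent 0, an empty direct sum. *)
have h0 : dg_idem 0.
  by split; [have [sB _ _] := dg_grading; exact: (sB _).1 | exact: dg_d0 | exact: dgm0r].
have z0 (x : cyc h0) : x = 0 by apply: val_inj; rewrite -cyc_valP dgm0r.
exists (cyc h0), void, (fun v : void => match v with end); split=> //.
- split; first exact: cyc_lmod.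
  exists (fun=> 0); split.
  + by split=> [c x y _ _|a x _]; apply/esym/z0.
  + by split=> [j x _ _|x _]; [have [sB _ _] := dg_grading; exact: (sB _).1 | apply/esym/z0].
  + by move=> z; exists 0 => //; rewrite [z]z0.
  + by move=> x _; split.
- exists (fun v : void => match v with end); split; first by case.
  + by move=> x; exists [::], (fun v : void => match v with end); rewrite big_nil [x]z0.
  + by move=> s F _ _ [].
Qed.

End PdgAlgebra.

(** * Quotients of p-DG algebras with anti-involution *)

Section QuotientAlgebra.
Context (k : fieldType) (p : nat) (A : dgalg k) (star : A -> A) (U : subspace A).
Hypotheses (hA : is_pdg_alg p A) (hs : is_anti_involution star).
Hypothesis hU : is_stable_ideal star (fun x => x \in U).
Local Notation "x ** y" := (dga_mul x y) (at level 40, left associativity).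
Local Notation Q := (quot_dgalg U).
Local Notation pi := (qpi U : A -> Q).

Lemma quot_mulE (x y : A) : pi x ** pi y = pi (x ** y).
Proof.
have [[_ id] _ _ _] := hU; apply/qpi_eq; rewrite /=.
set x' := qrepr _; set y' := qrepr _.
have -> : x' ** y' - x ** y = (x' - x) ** y' + x ** (y' - y).
  by rewrite (dgmBl hA) (dgmBr hA) addrA subrK.
by apply: rpredD; [apply: (id _ _ _).2 | apply: (id _ _ _).1]; exact: qreprP.
Qed.

Lemma quot_dE (x : A) : dg_d (pi x) = pi (dg_d x).
Proof.
have [_ _ ds _] := hU; apply/qpi_eq; rewrite -(dg_dB hA).
by apply: ds; exact: qreprP.
Qed.

Lemma anti_involutionB (x y : A) : star (x - y) = star x - star y.
Proof. by have [l _ _ _] := hs; rewrite addrC -scaleN1r l scaleN1r addrC. Qed.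

Lemma quot_starE (x : A) : quot_star star (pi x) = pi (star x).
Proof.
have [_ _ _ st] := hU; apply/qpi_eq; rewrite -anti_involutionB.
by apply/st; exists (qrepr (pi x) - x) => //; exact: qreprP.
Qed.

Lemma quot_pdg_alg : is_pdg_alg p Q.
Proof.
have [[gA dl dd dp] [mA m1 m1'] mP [d1 dM] dL] := hA.
have piP c x y : pi (c *: x + y) = c *: pi x + pi y by exact: linearP.
split.
- split.
  + by apply: quot_grading => //; case: hU.
  + by move=> c; elim/qpi_ind => x; elim/qpi_ind => y; rewrite -piP !quot_dE -piP dl.
  + by move=> i _ [x hx ->]; rewrite quot_dE; exists (dg_d x) => //; exact: dd.
  + elim/qpi_ind => x; rewrite -[RHS](raddf0 (qpi U)) -(dp x).
    by elim: p => //= r ->; exact: quot_dE.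
- split.
  + by elim/qpi_ind => x; elim/qpi_ind => y; elim/qpi_ind => z; rewrite !quot_mulE mA.
  + by elim/qpi_ind => x; rewrite [LHS]quot_mulE m1.
  + by elim/qpi_ind => x; rewrite [LHS]quot_mulE m1'.
- elim/qpi_ind => x; split=> c; elim/qpi_ind => y; elim/qpi_ind => z;
    by rewrite -piP !quot_mulE -piP ?(dgmPr hA) ?(dgmPl hA).
- split; first by exists (dga_one A).
  by move=> i j _ _ [x hx ->] [y hy ->]; rewrite quot_mulE; exists (x ** y) => //; exact: dM.
- elim/qpi_ind => x; elim/qpi_ind => y.
  by rewrite quot_mulE !quot_dE !quot_mulE dL; exact: qpiD.
Qed.

Lemma quot_anti_involution : is_anti_involution (@quot_star k A star U : Q -> Q).
Proof.
have [sl sM sK sd] := hs.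
have piP c x y : pi (c *: x + y) = c *: pi x + pi y by exact: linearP.
split.
- by move=> c; elim/qpi_ind => x; elim/qpi_ind => y; rewrite -piP !quot_starE -piP sl.
- by elim/qpi_ind => x; elim/qpi_ind => y; rewrite quot_mulE !quot_starE quot_mulE sM.
- by elim/qpi_ind => x; rewrite !quot_starE sK.
- by move=> i _ [x hx ->]; rewrite quot_starE; exists (star x) => //; exact: sd.
Qed.

Lemma quot_stable_ideal (J : A -> Prop) : is_stable_ideal star J ->
  is_stable_ideal (@quot_star k A star U : Q -> Q) (fun x : Q => exists2 y, J y & x = pi y).
Proof.
move=> [[[J0 JP] Ji] gJ dJ sJ]; split.
- split; first split.
  + by exists 0 => //; rewrite (raddf0 (qpi U)).
  + move=> c _ _ [x hx ->] [y hy ->]; exists (c *: x + y); first exact: JP.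
    by rewrite linearP.
  + move=> + _ [y hy ->]; elim/qpi_ind => a.
    by rewrite !quot_mulE; split; eexists; [exact: (Ji a y hy).1| |exact: (Ji a y hy).2|].
- move=> _ [x /gJ[s [f [hf ->]]] ->]; exists s, (fun i => pi (f i)); split.
    by move=> i; have [h1 h2] := hf i; split; exists (f i).
  by rewrite (raddf_sum (qpi U)).
- by move=> _ [x hx ->]; rewrite quot_dE; exists (dg_d x) => //; exact: dJ.
- move=> x; split.
  + move=> [y /sJ[z hz ->] ->]; exists (pi z); first by exists z.
    by rewrite quot_starE.
  + move=> [_ [z hz ->] ->]; rewrite quot_starE; exists (star z) => //.
    by apply/sJ; exists z.
Qed.

End QuotientAlgebra.

(** * The cell module of an idempotent fixed by the anti-involution *)

Section CellIdeal.
Context (k : fieldType) (p : nat) (B : dgalg k) (star : B -> B).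
Hypotheses (hB : is_pdg_alg p B) (hs : is_anti_involution star).
Local Notation "x ** y" := (dga_mul x y) (at level 40, left associativity).
Context (e : B) (he : dg_idem e) (se : star e = e).
Context (N : finType) (b : N -> B) (be : forall a, b a ** e = b a).
Hypothesis b_span : forall z, z ** e = z -> in_span b z.
Hypothesis b_free : free_fam (fun u : N * N => b u.1 ** star (b u.2)).

(** The cell module is [B e], and [phi] sends the tensor of [x] and [y] to [x ** star y]. On basis
    tensors it takes the values of the free family, so it is injective with image [J]; cofibrancy
    comes from the idempotent. *)
Lemma cell_ideal_qh (J : B -> Prop) : is_stable_ideal star J ->
  (forall z, J z <-> in_span (fun u : N * N => b u.1 ** star (b u.2)) z) ->
  pdg_qh_ideal p star J.
Proof.
move=> hJ JE; split=> //; exists (cyc hB he); split; last exact: cyc_cofibrant.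
split; first exact: cyc_lmod.
have [sl sM sK sd] := hs.
have star_d_cyc (x : B) : x \in cyc_sub hB e -> star (dg_d (star x)) \in cyc_sub hB e.
  have [_ de _] := he; move=> /cycP hx; apply/cycP.
  by rewrite -{2}hx sM (dg_dM hB) se de (dgm0l hB) add0r sM se.
(* Since [star] need not commute with the differential, the right module gets the conjugate
   differential; the Leibniz rule for [x ** star y] is then the compatibility required of [phi]. *)
pose d' (x : cyc hB he) : cyc hB he :=
  exist (fun z => z \in cyc_sub hB e) _ (star_d_cyc _ (valP x)).
have bil (y : cyc hB he) : linear (fun x : cyc hB he => val x ** star (val y)).
  by move=> c x x'; rewrite /= (dgmPl hB).
have bir (x : cyc hB he) : linear (fun y : cyc hB he => val x ** star (val y)).
  by move=> c y y'; rewrite /= sl (dgmPr hB).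
have [phi phiE] := tens_lift bil bir.
exists d', phi.
have [gB dl dd dp] := dg_pcomplex hB.
have bcyc a : b a ** e = b a by exact: be.
pose bt a : cyc hB he := mk_cyc hB he (be a).
have btP (x : cyc hB he) : in_span bt x.
  have [c xE] := b_span (cyc_valP x); exists c; apply: val_inj; rewrite xE raddf_sum.
  by apply: eq_bigr => a _.
have tP (t : tensor (cyc hB he) (cyc hB he)) :
    in_span (fun u : N * N => tens (bt u.1) (bt u.2)) t.
  have [m [x [y ->]]] := tensor_sum t; apply: in_span_sum => i _.
  by apply: in_span_bilin => // z; [exact: tens_linearl | exact: tens_linearr].
have phiS (c : N * N -> k) : phi (\sum_u c u *: tens (bt u.1) (bt u.2)) =
    \sum_u c u *: (b u.1 ** star (b u.2)).
  rewrite linear_sum; apply: eq_bigr => u _.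
  by rewrite linearZ_LR phiE.
have phi_inj : injective phi.
  move=> t1 t2 e12; apply: subr0_eq; have [c tE] := tP (t1 - t2).
  have c0 : \sum_u c u *: (b u.1 ** star (b u.2)) = 0.
    by rewrite -phiS -tE linearB e12 subrr.
  by rewrite tE; apply: big1 => u _; rewrite (b_free c0) scale0r.
have phi_im a : J a <-> exists t, a = phi t.
  rewrite JE; split=> [[c ->]|[t ->]].
    by exists (\sum_u c u *: tens (bt u.1) (bt u.2)); rewrite phiS.
  by have [c ->] := tP t; exists c; rewrite phiS.
have p1 (a : B) (x y : cyc hB he) : phi (tens (dgm_act a x) y) = a ** phi (tens x y).
  apply: etrans (phiE (dgm_act a x) y) _; rewrite (phiE x y).
  exact: (esym (dgmA hB _ _ _)).
have p2 (a : B) (x y : cyc hB he) :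
    phi (tens x (dgm_act (star a) y)) = phi (tens x y) ** a.
  apply: etrans (phiE x (dgm_act (star a) y)) _; rewrite (phiE x y) -(dgmA hB).
  by congr (_ ** _); rewrite -{2}[a]sK; exact: sM.
have p3 i j (x y : cyc hB he) : dg_deg i x -> dg_deg j y -> dg_deg (i + j) (phi (tens x y)).
  by rewrite (phiE x y) => hx hy; apply: (dgmH hB) => //; exact: sd.
have p4 (x y : cyc hB he) :
    dg_d (phi (tens x y)) = phi (tens (dg_d x) y) + phi (tens x (d' y)).
  apply: etrans (congr2 +%R (esym (phiE (dg_d x) y)) (esym (phiE x (d' y)))).
  rewrite (phiE x y) (dg_dM hB); congr (_ + _ ** _).
  exact/esym/sK.
have p5 (x y : cyc hB he) : star (phi (tens x y)) = phi (tens y x).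
  apply: etrans (congr1 star (phiE x y)) (etrans _ (esym (phiE y x))).
  by rewrite sM sK.
split.
- split.
  + have [gC _ dC _] := sub_pcomplex (@cyc_d _ _ _ hB _ he) (dg_pcomplex hB) (@cyc_graded _ _ _ hB _ he).
    split=> //.
    * by move=> c x y; apply: val_inj; rewrite /= sl dl sl.
    * by move=> i x hx; rewrite /dg_deg /=; apply/sd/dd/sd.
    * move=> x; apply: val_inj.
      have iE r : val (iter r d' x) = star (iter r (@dg_d k B) (star (val x))).
        by elim: r => [|r IH] /=; rewrite ?sK // IH sK.
      by rewrite [LHS]iE dp; apply: (addrI (star 0)); have := sl 1 0 0; rewrite !scale1r !addr0.
  + split=> [x|x a c]; apply: val_inj; rewrite /=.
      have -> : star (dga_one B) = dga_one B.
        by rewrite -[LHS](dgmx1 hB) -{2}[dga_one B]sK -sM (dgmx1 hB) sK.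
      exact: (dgm1x hB).
    by rewrite sM (dgmA hB).
  + split=> [a c x y|x c a a']; apply: val_inj; rewrite /= ?(dgmPr hB) //.
    by rewrite sl (dgmPl hB).
  + by move=> i j x a hx ha; rewrite addrC; apply: (dgmH hB) => //; exact: sd.
  + move=> x a; apply: val_inj; rewrite /= sM sK (dg_dM hB).
    by have := sl 1; rewrite /= => sl1; have := sl 1 (dg_d (star (val x)) ** a) (star (val x) ** dg_d a);
       rewrite !scale1r => ->; rewrite !sM sK.
- by split.
- split; [exact: p1 | exact: p2].
- split; [exact: p3 | exact: p4].
- exact: p5.
Qed.
End CellIdeal.

(** * Chains of ideals generated by idempotents *)

Section IdempotentChain.
Context (k : fieldType) (p : nat) (A : dgalg k) (star : A -> A).
Hypotheses (hA : is_pdg_alg p A) (hs : is_anti_involution star).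
Local Notation "x ** y" := (dga_mul x y) (at level 40, left associativity).
Context (m : nat) (e : nat -> A).
Hypothesis he : forall i, (i < m)%N -> dg_idem (e i).
Hypothesis se : forall i, (i < m)%N -> star (e i) = e i.
Hypothesis e_sum : \sum_(i < m) e i = dga_one A.

(** The generators are full products, so a linear functional vanishes on the ideal as soon as it
    vanishes on the elements [a ** e r ** b]. *)
Inductive idem_ideal_rel (i : nat) : A -> Prop :=
| IdemGen a b r of (i <= r)%N & (r < m)%N : idem_ideal_rel i (a ** e r ** b)
| IdemZero : idem_ideal_rel i 0
| IdemLin c x y of idem_ideal_rel i x & idem_ideal_rel i y :
    idem_ideal_rel i (c *: x + y).

Definition idem_ideal_pred i : {pred A} := fun x => `[< idem_ideal_rel i x >].

Lemma idem_ideal_closed i : submod_closed (idem_ideal_pred i).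
Proof.
split=> [|c x y]; rewrite !unfold_in; first exact/asboolP/IdemZero.
by move=> /asboolP hx /asboolP hy; apply/asboolP/IdemLin.
Qed.

Definition idem_ideal i : subspace A := Subspace (idem_ideal_closed i).

Lemma idem_idealP i x : x \in idem_ideal i <-> idem_ideal_rel i x.
Proof. by split=> [/asboolP|h] //; apply/asboolP. Qed.

Lemma idem_ideal_sum i (I : Type) (r : seq I) (P : pred I) (F : I -> A) :
  (forall j, P j -> idem_ideal_rel i (F j)) -> idem_ideal_rel i (\sum_(j <- r | P j) F j).
Proof. by move=> h; apply/idem_idealP/rpred_sum => j /h/idem_idealP. Qed.

Lemma idem_ideal_mul i a x : idem_ideal_rel i x ->
  idem_ideal_rel i (a ** x) /\ idem_ideal_rel i (x ** a).
Proof.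
elim=> {x} [b c r ir rm||c x y _ [h1 h2] _ [h3 h4]].
- split; first by rewrite !(dgmA hA); exact: IdemGen.
  by rewrite -(dgmA hA _ c a); exact: IdemGen.
- by rewrite (dgm0l hA) (dgm0r hA); split; exact: IdemZero.
- by rewrite (dgmPl hA) (dgmPr hA); split; exact: IdemLin.
Qed.

Lemma idem_ideal_star i x : idem_ideal_rel i x -> idem_ideal_rel i (star x).
Proof.
have [sl sM sK sd] := hs; elim=> {x} [a b r ir rm||c x y _ h1 _ h2].
- by rewrite !sM (dgmA hA) se //; exact: IdemGen.
- have -> : star 0 = 0 by apply: (addrI (star 0)); have := sl 1 0 0; rewrite !scale1r !addr0.
  exact: IdemZero.
- by rewrite sl; exact: IdemLin.
Qed.

(** Each [e r] has degree 0, is killed by the differential and is fixed by [star]; hence splitting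
    [a] and [b] into components, differentiating them or reversing the product stays within
    combinations of elements [a ** e r ** b]. *)
Lemma idem_ideal_stable i : is_stable_ideal star (fun x => x \in idem_ideal i).
Proof.
have [gA _ _ _] := dg_pcomplex hA; have [pr prP] := grading_proj gA.
have sub : is_subspace (fun x => x \in idem_ideal i).
  split; first exact/idem_idealP/IdemZero.
  by move=> c x y /idem_idealP hx /idem_idealP hy; apply/idem_idealP/IdemLin.
split.
- split=> // a x /idem_idealP/(@idem_ideal_mul _ a)[h1 h2].
  by split; apply/idem_idealP.
- pose H j x := dg_deg j x /\ x \in idem_ideal i; have [sA _ _] := gA.
  have H_sub j : H j 0 /\ forall c x y, H j x -> H j y -> H j (c *: x + y).
    split; first by split; [exact: (sA j).1 | exact: sub.1].
    by move=> c x y [h1 h2] [h3 h4]; split; [exact: (sA j).2 | exact: sub.2].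
  suff h x : idem_ideal_rel i x -> exists s F, is_decomp H x s F.
    move=> x /idem_idealP/h[s [F [_ HF _ ->]]].
    by exists s, F.
  elim=> {x} [a b r ir rm||c x y _ [s [f hf]] _ [t [g hg]]].
  + have [s _ aE] := pr_decomp prP a; have [t _ bE] := pr_decomp prP b.
    have -> : a ** e r ** b = \sum_(u <- [seq (u, v) | u <- s, v <- t])
        pr u.1 a ** e r ** pr u.2 b.
      rewrite {1}aE {1}bE !(dgm_suml hA) big_allpairs; apply: eq_bigr => u _.
      by rewrite (dgm_sumr hA).
    apply: (@decomp_sum _ _ _ H_sub _ _ (fun u : int * int => u.1 + u.2)) => u.
    have [e0 _ _] := he rm; split; last exact/idem_idealP/IdemGen.
    apply: (dgmH hA); last exact: (pr_hom prP).
    by rewrite -[u.1]addr0; apply: (dgmH hA) => //; rewrite addr0; exact: (pr_hom prP).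
  + by exists [::], (fun=> 0); exact: decomp0.
  + by eexists; eexists; exact: (decompP H_sub c hf hg).
- move=> x /idem_idealP h; apply/idem_idealP; elim: h => {x} [a b r ir rm||c x y _ h1 _ h2].
  + have [_ de _] := he rm; rewrite !(dg_dM hA) de (dgm0r hA) addr0.
    by rewrite -[_ ** e r ** b]scale1r; apply: IdemLin; exact: IdemGen.
  + by rewrite (dg_d0 hA); exact: IdemZero.
  + by rewrite (dg_dP hA); exact: IdemLin.
- move=> x; split=> [/idem_idealP/idem_ideal_star h|[y /idem_idealP/idem_ideal_star h ->]].
    by exists (star x); [exact/idem_idealP | have [_ _ sK _] := hs; rewrite sK].
  exact/idem_idealP.
Qed.

Hypothesis cell_basis : forall i, (i < m)%N -> exists (N : finType) (b : N -> A),
  [/\ forall a, b a ** e i = b a,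
      forall z, z ** e i = z -> exists c : N -> k, z - \sum_a c a *: b a \in idem_ideal i.+1
    & forall c : N * N -> k,
        \sum_u c u *: (b u.1 ** star (b u.2)) \in idem_ideal i.+1 -> forall u, c u = 0].

(** Modulo the ideal of the later idempotents, the ideal numbered [i] is generated by the image of
    [e i] alone, so each layer is a case of [cell_ideal_qh] in the quotient algebra. *)
Lemma idem_chain_qh : pdg_qh_cellular p star.
Proof.
split=> //; exists m, idem_ideal; split.
- split=> x; last first.
    move=> /idem_idealP h; have [n mn] : {n | n = m} by exists m.
    by elim: h => {x} [a b r mr rm||c x y _ -> _ ->]; rewrite ?scaler0 ?addr0 //; lia.
  apply/idem_idealP; rewrite -[x](dgm1x hA) -e_sum (dgm_suml hA).
  apply: idem_ideal_sum => i _; rewrite -[e i](dgm1x hA); exact: IdemGen.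
- move=> i im x /idem_idealP h; apply/idem_idealP.
  elim: h => {x} [a b r ir rm||c x y _ h1 _ h2].
  + by apply: IdemGen => //; lia.
  + exact: IdemZero.
  + exact: IdemLin.
- by move=> i _; exact: idem_ideal_stable.
move=> i im; have [N [b [be bspan bfree]]] := cell_basis im.
set U := idem_ideal i.+1; have hU := idem_ideal_stable i.+1.
have [e0 de ee] := he im; have [sl sM sK sd] := hs.
pose pi : A -> quot_dgalg U := qpi U.
have piP c x y : pi (c *: x + y) = c *: pi x + pi y by exact: linearP.
have piM x y : pi x ** pi y = pi (x ** y) := quot_mulE hA hU x y.
have piS x : quot_star star (pi x) = pi (star x) := quot_starE hs hU x.
have pi0 x : pi x = 0 <-> x \in U := qpi_eq0 U x.
have pi_sum (I : finType) (c : I -> k) (F : I -> A) :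
    pi (\sum_j c j *: F j) = \sum_j c j *: pi (F j).
  apply: (big_rec2 (fun x y => pi x = y)) => [|j y x _ <-]; last exact: piP.
  exact: (raddf0 (qpi U)).
have hQ := quot_pdg_alg hA hU; have hsQ := quot_anti_involution hA hs hU.
have heQ : dg_idem (pi (e i)).
  split; [by exists (e i) | | by rewrite piM ee].
  by apply: etrans (quot_dE hA hU (e i)) _; rewrite de; exact: (raddf0 (qpi U)).
have seQ : quot_star star (pi (e i)) = pi (e i) by rewrite piS se.
have spanQ (z : quot_dgalg U) : z ** pi (e i) = z -> in_span (fun a => pi (b a)) z.
  elim/qpi_ind: z => z; rewrite -/(pi z) piM => zE.
  (* The representative [z] equals [z ** e i] only modulo the ideal, whereas [z ** e i] satisfies
     the equation exactly. *)
  have [c hc] := bspan (z ** e i) (etrans (esym (dgmA hA _ _ _)) (congr1 _ ee)).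
  exists c; rewrite -zE -pi_sum; exact/qpi_eq.
apply: (cell_ideal_qh hQ hsQ heQ seQ (b := fun a => pi (b a))) => //.
- by move=> a; rewrite piM be.
- move=> c hc; apply: bfree; apply/pi0; rewrite pi_sum -[RHS]hc.
  by apply: eq_bigr => u _; rewrite piS piM.
- exact: (quot_stable_ideal hA hs hU (idem_ideal_stable i)).
move=> z; split.
- move=> [y /idem_idealP h ->]; elim: h => {y} [a1 a2 r ir rm||c x y _ h1 _ h2].
  + move: ir; rewrite leq_eqVlt => /predU1P[ri|ir]; last first.
      have -> : qpi U (a1 ** e r ** a2) = 0; last exact: in_span0.
      by apply/qpi_eq0/idem_idealP/IdemGen.
    (* The right factor is rewritten as the image under [star] of an element of the left ideal, so
       that both factors can be expanded in the family [b]. *)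
    have -> : qpi U (a1 ** e r ** a2) = pi (a1 ** e i) ** quot_star star (pi (star a2 ** e i)).
      by rewrite piS piM sM se // sK (dgmA hA) -(dgmA hA a1 (e i)) ee ri.
    pose f (x y : quot_dgalg U) := x ** quot_star star y.
    have fl y : linear (f^~ y) by move=> c x x'; rewrite /f (dgmPl hQ).
    have fr x : linear (f x).
      by move=> c y y'; have [sQ _ _ _] := hsQ; rewrite /f sQ (dgmPr hQ).
    apply: (in_span_bilin (b := fun a => pi (b a)) (c := fun a => pi (b a)) fl fr);
      by apply: spanQ; rewrite piM -(dgmA hA) ee.
  + by rewrite (raddf0 (qpi U)); exact: in_span0.
  + by rewrite -/(pi _) piP; exact: in_spanD.
- move=> [c ->]; exists (\sum_u c u *: (b u.1 ** star (b u.2))); last first.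
    by rewrite -/(pi _) pi_sum; apply: eq_bigr => u _; rewrite piS piM.
  apply: rpred_sum => u _; apply: rpredZ; apply/idem_idealP.
  by rewrite -[b u.1]be; exact: IdemGen.
Qed.

End IdempotentChain.

(** * Gradings on the nilHecke algebra *)

Section FreeGrading.
Context (k : fieldType) (n : nat).
Local Notation FA := (free_alg k n).
Implicit Types (x z : FA) (w : word n).

Lemma free_coefP c x z w : ((c *: x + z : FA) : {malg k[word n]})@_w =
  c * (x : {malg k[word n]})@_w + (z : {malg k[word n]})@_w.
Proof. by rewrite -mcoeffZ -mcoeffD. Qed.

Lemma free_coef0 w : ((0 : FA) : {malg k[word n]})@_w = 0.
Proof. exact: mcoeff0. Qed.

Lemma free_degE i x : free_deg i x <-> forall w, word_deg w != i -> (x : {malg k[word n]})@_w = 0.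
Proof.
split=> h w; first by move=> ne; apply: mcoeff_outdom; apply: contra ne => /h ->.
rewrite -mcoeff_neq0 => nz; apply/eqP; apply: contraNT nz => ne.
by rewrite h.
Qed.

Lemma free_deg_sub i : free_deg i (0 : FA) /\
  forall c x z, free_deg i x -> free_deg i z -> free_deg i (c *: x + z).
Proof.
split; first by apply/free_degE => w _; exact: free_coef0.
move=> c x z /free_degE hx /free_degE hz; apply/free_degE => w ne.
by rewrite free_coefP hx // hz // mulr0 addr0.
Qed.

Lemma free_deg_mono w : free_deg (word_deg w) (mono k w).
Proof.
apply/free_degE => v ne; rewrite /mono locked_withE mcoeffU.
by case: eqP => // e; rewrite e eqxx in ne.
Qed.

Lemma free_deg_ind (P : FA -> Prop) i : P 0 ->
  (forall c x z, P x -> P z -> P (c *: x + z)) ->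
  (forall w, word_deg w = i -> P (mono k w)) -> forall x, free_deg i x -> P x.
Proof.
move=> P0 Pl Pm x hx; rewrite (free_sum x) big_seq.
elim/big_rec: _ => [|w z wx Pz]; first exact: P0.
by apply: Pl => //; apply: Pm; exact: hx.
Qed.

Lemma free_degZ i c x : free_deg i x -> free_deg i (c *: x).
Proof. by have [h0 hP] := free_deg_sub i; rewrite -[_ *: _]addr0 => hx; exact: hP. Qed.

Lemma free_grading : is_grading (@free_deg k n).
Proof.
split; first exact: free_deg_sub.
- move=> x; have hw w : free_deg (word_deg w) ((x : {malg k[word n]})@_w *: mono k w).
    exact/free_degZ/free_deg_mono.
  have [s [F [_ hF _ xE]]] := decomp_sum free_deg_sub (enum_fset (msupp (x : {malg k[word n]}))) hw.
  by exists s, F; split=> //; rewrite -xE; exact: free_sum.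
- move=> s f us hf f0 i si.
  have sumE (r : seq int) w : ((\sum_(j <- r) f j : FA) : {malg k[word n]})@_w =
      \sum_(j <- r) (f j : {malg k[word n]})@_w.
    elim: r => [|j r IH]; first by rewrite !big_nil free_coef0.
    by rewrite !big_cons -IH -[f j]scale1r free_coefP mul1r scale1r.
  apply/malgP => w; rewrite free_coef0.
  have [wi|ne] := eqVneq (word_deg w) i; last by have /free_degE -> := hf i.
  have := sumE s w; rewrite f0 free_coef0 (big_rem i) //= big_seq big1 ?addr0 => [<- //|j].
  rewrite mem_rem_uniq // inE => /andP[ne _].
  by have /free_degE -> := hf j; rewrite // wi eq_sym.
Qed.

Lemma word_deg_cat (u v : word n) : word_deg (u ++ v) = word_deg u + word_deg v.
Proof. exact: big_cat. Qed.

Lemma free_degM i j x z : free_deg i x -> free_deg j z -> free_deg (i + j) (x * z).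
Proof.
have [h0 hP] := free_deg_sub (i + j); move=> hx hz.
apply: (free_deg_ind (i := i) (P := fun x => free_deg (i + j) (x * z))) hx => [|c x1 x2 h1 h2|u ui].
- by rewrite mul0r.
- by rewrite mulrDl -scalerAl; exact: hP.
apply: (free_deg_ind (i := j) (P := fun z => free_deg (i + j) (mono k u * z))) hz => [|c x1 x2 h1 h2|v vj].
- by rewrite mulr0.
- by rewrite mulrDr -free_scalerAr; exact: hP.
by rewrite -monoM -ui -vj -word_deg_cat; exact: free_deg_mono.
Qed.

Lemma free_degB i x z : free_deg i x -> free_deg i z -> free_deg i (x - z).
Proof.
by have [_ hP] := free_deg_sub i; move=> hx hz; rewrite addrC -scaleN1r; exact: hP.
Qed.

Lemma free_degN i x : free_deg i x -> free_deg i (- x).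
Proof. by rewrite -scaleN1r; exact: free_degZ. Qed.

Lemma free_deg1 : free_deg 0 (1 : FA).
Proof. by have := @free_deg_mono [::]; rewrite /word_deg big_nil. Qed.

Lemma free_deg_y (i : 'I_n) : free_deg 2 (fy k i).
Proof. by have := @free_deg_mono [:: inl i]; rewrite /word_deg big_seq1. Qed.

Lemma free_deg_psi (j : 'I_n.-1) : free_deg (- 2) (fpsi k j).
Proof. by have := @free_deg_mono [:: inr j]; rewrite /word_deg big_seq1. Qed.

Lemma free_degX i x m : free_deg i x -> free_deg (i *+ m) (x ^+ m).
Proof.
move=> hx; elim: m => [|m IH]; first by rewrite mulr0n expr0; exact: free_deg1.
by rewrite exprS mulrS; exact: free_degM.
Qed.

Lemma free_deg_d i x : free_deg i x -> free_deg (i + 2) (free_d x).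
Proof.
have [h0 hP] := free_deg_sub (i + 2).
apply: (free_deg_ind (P := fun x => free_deg (i + 2) (free_d x))) => [|c x1 x2 h1 h2|w <-].
- by rewrite free_d0.
- by rewrite free_dP; exact: hP.
rewrite free_d_mono; elim: w => [|g w IH] /=; first exact: (free_deg_sub _).1.
have dg : word_deg (g :: w) = word_deg [:: g] + word_deg w by exact: (word_deg_cat [:: g]).
have [_ hP'] := free_deg_sub (word_deg (g :: w) + 2).
rewrite -[gen_d _ _ * _]scale1r; apply: hP'.
  rewrite dg addrAC; apply: free_degM (@free_deg_mono w).
  rewrite /word_deg big_seq1; case: g {dg} => [a|a] /=.
    by rewrite expr2; apply: free_degM; exact: free_deg_y.
  apply: free_degB; last exact: free_degM (@free_deg_psi a) (@free_deg_y _).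
  rewrite mulNr; apply: free_degN; rewrite addrC.
  exact: free_degM (@free_deg_y _) (@free_deg_psi a).
rewrite dg -addrA; apply: free_degM => //; exact: free_deg_mono.
Qed.

Lemma free_deg_star i x : free_deg i x -> free_deg i (free_star x).
Proof.
have [h0 hP] := free_deg_sub i.
apply: (free_deg_ind (P := fun x => free_deg i (free_star x))) => [|c x1 x2 h1 h2|w <-].
- by rewrite free_star0.
- by rewrite free_starP; exact: hP.
rewrite free_star_mono; have -> : word_deg w = word_deg (rev w).
  by apply: perm_big; rewrite perm_sym perm_rev.
exact: free_deg_mono.
Qed.

Section Relations.
Context (l : nat).

Lemma nh_rel_deg x : nh_rel l x -> exists i, free_deg i x.
Proof.
have dy (i : 'I_n) : free_deg 2 (fy k i) by exact: free_deg_y.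
have dp (j : 'I_n.-1) : free_deg (- 2) (fpsi k j) by exact: free_deg_psi.
case=> {x} [i j|i j h1 h2|j|j|j|i j h|i j h|i h].
- by exists (2 + 2); apply: free_degB; exact: free_degM.
- exists (2 + -2); apply: free_degB; first exact: free_degM.
  by rewrite addrC; exact: free_degM.
- exists 0; apply: free_degB (free_deg1); apply: free_degB.
    exact: (free_degM (dy _) (dp j)).
  exact: (free_degM (dp j) (dy _)).
- exists 0; apply: free_degB (free_deg1); apply: free_degB.
    exact: (free_degM (dp j) (dy _)).
  exact: (free_degM (dy _) (dp j)).
- by exists (- 2 *+ 2); exact: free_degX.
- by exists (- 2 + - 2); apply: free_degB; exact: free_degM.
- by exists (- 2 + - 2 + - 2); apply: free_degB; apply: free_degM => //; exact: free_degM.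
- by exists (2 *+ l); exact: free_degX.
Qed.

(** The relations are homogeneous, and every multiplier is a combination of words, which are
    homogeneous. *)
Lemma nh_ideal_graded : @is_graded_sub k (free_dga k n) (fun x => x \in nh_ideal k n l).
Proof.
pose H i x := free_deg i x /\ nh_ideal_rel l x.
have idP c x z : nh_ideal_rel l x -> nh_ideal_rel l z -> nh_ideal_rel l (c *: x + z).
  move=> hx hz; apply: NhAdd => //; rewrite -[x]mul1r scalerAl; exact: NhMull.
have H_sub i : H i 0 /\ forall c x y, H i x -> H i y -> H i (c *: x + y).
  split; first by split; [exact: (free_deg_sub i).1 | exact: NhZero].
  by move=> c x y [h1 h2] [h3 h4]; split; [exact: (free_deg_sub i).2 | exact: idP].
suff h x : nh_ideal_rel l x -> exists s F, is_decomp H x s F.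
  move=> x /nh_idealP/h[s [F [_ HF _ xE]]]; exists s, F; split=> // i.
  by have [h1 h2] := HF i; split=> //; exact/nh_idealP.
have sumH (r : seq (word n * int)) (d : word n * int -> int) F :
    (forall u, H (d u) (F u)) -> exists s G, is_decomp H (\sum_(u <- r) F u) s G.
  exact: decomp_sum.
elim=> {x} [x hx||x z _ [s [F hF]] _ [t [G hG]]|a x _ [s [F [us HF _ ->]]]|a x _ [s [F [us HF _ ->]]]].
- have [i hi] := nh_rel_deg hx; eexists; eexists; apply: (decomp_single H_sub (i := i)).
  by split=> //; exact: NhRel.
- by exists [::], (fun=> 0); exact: decomp0.
- by rewrite -[x]scale1r; eexists; eexists; exact: (decompP H_sub 1 hF hG).
- rewrite {1}(free_sum a) mulr_suml.
  under eq_bigr => w _ do rewrite mulr_sumr.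
  pose r := [seq (w, i) | w <- enum_fset (msupp (a : {malg k[word n]})), i <- s].
  have := sumH r (fun u => word_deg u.1 + u.2)
    (fun u => (a : {malg k[word n]})@_u.1 *: mono k u.1 * F u.2).
  rewrite big_allpairs; apply=> u; have [h1 h2] := HF u.2; split.
    by apply: free_degM => //; exact/free_degZ/free_deg_mono.
  exact: NhMull.
- rewrite {1}(free_sum a) mulr_sumr.
  under eq_bigr => w _ do rewrite mulr_suml.
  pose r := [seq (w, i) | w <- enum_fset (msupp (a : {malg k[word n]})), i <- s].
  have := sumH r (fun u => u.2 + word_deg u.1)
    (fun u => F u.2 * ((a : {malg k[word n]})@_u.1 *: mono k u.1)).
  rewrite big_allpairs; apply=> u; have [h1 h2] := HF u.2; split.
    by apply: free_degM => //; exact/free_degZ/free_deg_mono.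
  exact: NhMulr.
Qed.

End Relations.
End FreeGrading.

From mathcomp.multinomials Require Import mpoly.

(** * The polynomial representation of the nilHecke algebra *)

Section DomainIdentities.
Context (D : idomainType).
Implicit Types a b x y f g sx sf tf stf sg w : D.

Lemma mulf2_cancel (a b x y e : D) : a != 0 -> b != 0 ->
  a * b * x = e -> b * a * y = e -> x = y.
Proof.
move=> a0 b0 <-; rewrite [b * a]mulrC => /esym/mulfI; apply.
by rewrite mulf_eq0 negb_or a0.
Qed.

Lemma mulf3_cancel (a b x y e : D) : a != 0 -> b != 0 -> a + b != 0 ->
  a * b * (a + b) * x = e -> b * a * (b + a) * y = e -> x = y.
Proof.
move=> a0 b0 c0 <-; rewrite [b * a]mulrC [b + a]addrC => /esym/mulfI; apply.
by rewrite !mulf_eq0 !negb_or a0 b0.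
Qed.

Lemma far_identity a b x sx f tf stf : a * x = b - sx ->
  f * b = tf -> f * sx = stf -> a * f * x = tf - stf.
Proof. by move=> e1 <- <-; rewrite mulrAC e1; ring. Qed.

(** The letters stand for the images of [f] under two neighbouring transpositions [s] and [t] with
    roots [a] and [b]. Multiplying by the product of the three positive roots turns the triple
    Demazure operator into the alternating sum over the symmetric group on three letters, which no
    longer depends on which transposition comes first. *)
Lemma braid_identity (a b q1 q2 q3 f sf tq1 sq2 stq1 tf tsf stf stsf : D) :
  a * q1 = f - sf -> b * q2 = q1 - tq1 -> a * q3 = q2 - sq2 ->
  (a + b) * sq2 = q1 - stq1 -> (a + b) * tq1 = tf - tsf -> b * stq1 = stf - stsf ->
  a * b * (a + b) * q3 = f - sf - tf + tsf + stf - stsf.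
Proof.
move=> e1 e2 e3 e4 e5 e6.
have -> : a * b * (a + b) * q3 = b * (a + b) * (a * q3) by ring.
have -> : b * (a + b) * (a * q3) = (a + b) * (b * q2) - b * ((a + b) * sq2).
  by rewrite e3; ring.
rewrite e2 e4 [b * _]mulrBr e6 mulrBr e5 mulrDl e1; ring.
Qed.

Lemma far_swap (f sf tf w : D) : f - sf - (tf - w) = f - tf - (sf - w).
Proof. ring. Qed.

Lemma braid_swap (f sf tf tsf stf w : D) :
  f - sf - tf + tsf + stf - w = f - tf - sf + stf + tsf - w.
Proof. ring. Qed.

Lemma leibniz_identity a x y f sf g sg : a * x = f - sf -> a * y = g - sg ->
  a * (x * g + sf * y) = f * g - sf * sg.
Proof. by move=> e1 e2; rewrite mulrDr mulrA e1 mulrCA e2; ring. Qed.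

Lemma linear_identity a x y f sf g sg : a * x = f - sf -> a * y = g - sg ->
  a * (x + y) = f + g - (sf + sg).
Proof. by move=> e1 e2; rewrite mulrDr e1 e2; ring. Qed.

End DomainIdentities.

Section Demazure.
Context (k : fieldType) (n : nat).
Local Notation R := {mpoly k[n]}.
Implicit Types (f g : R) (j : 'I_n.-1).

Definition sw j : 'S_n := tperm (lo j) (hi j).
Definition droot j : R := 'X_(lo j) - 'X_(hi j).

Lemma lo_neq_hi j : lo j != hi j.
Proof. by apply/eqP => /(congr1 val) /=; lia. Qed.

Lemma mpolyX_inj (i i' : 'I_n) : 'X_i = 'X_i' :> R -> i = i'.
Proof.
move/(congr1 (fun f : R => f@_U_(i))); rewrite !mcoeffX eqxx.
by case: eqP => [/mnmP/(_ i)|_ /eqP]; [rewrite !mnm1E eqxx; case: eqP | rewrite oner_eq0].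
Qed.

Lemma droot_neq0 j : droot j != 0.
Proof. by rewrite subr_eq0; apply: contra_neq (lo_neq_hi j) => /mpolyX_inj. Qed.

Lemma msym_X (s : 'S_n) i : msym s 'X_i = 'X_(s i) :> R.
Proof.
rewrite msymX; congr mpolyX; apply/mnmP => i'.
by rewrite mnmE !mnm1E -(inj_eq (@perm_inj _ s)) permKV.
Qed.

Lemma swK j f : msym (sw j) (msym (sw j) f) = f.
Proof. by rewrite -msymMm tperm2 msym1m. Qed.

Lemma msym_droot j : msym (sw j) (droot j) = - droot j.
Proof. by rewrite msymB !msym_X tpermL tpermR opprB. Qed.

(** Divisibility of [f - msym (sw j) f] by the root passes to sums and, by a twisted Leibniz rule,
    to products; so it is enough to treat variables. *)
Lemma dmz_ex j f : exists q, droot j * q = f - msym (sw j) f.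
Proof.
pose P (f : R) := exists q, droot j * q = f - msym (sw j) f.
have PD f1 f2 : P f1 -> P f2 -> P (f1 + f2).
  by move=> [q1 e1] [q2 e2]; exists (q1 + q2); rewrite msymD; exact: linear_identity.
have PZ c f1 : P f1 -> P (c *: f1).
  by move=> [q1 e1]; exists (c *: q1); rewrite -scalerAr e1 msymZ scalerBr.
have PM f1 f2 : P f1 -> P f2 -> P (f1 * f2).
  move=> [q1 e1] [q2 e2]; exists (q1 * f2 + msym (sw j) f1 * q2).
  by rewrite msymM; exact: leibniz_identity.
have P1 : P 1 by exists 0; rewrite msym1 subrr mulr0.
have PX i : P 'X_i.
  rewrite /P msym_X; case: tpermP => [->|->|_ _].
  - by exists 1; rewrite mulr1.
  - by exists (-1); rewrite mulrN1 opprB.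
  - by exists 0; rewrite subrr mulr0.
elim/mpolyind: f => [|c m f _ _ IH]; first by exists 0; rewrite msym0 subrr mulr0.
have PXn g e : P g -> P (g ^+ e).
  by move=> Pg; elim: e => [|e He]; [exact: P1 | rewrite exprS; exact: PM].
apply: PD IH; apply: PZ; rewrite mpolyXE_id; apply: (big_ind P) => // i _.
exact/PXn/PX.
Qed.

Definition dmz j f : R := projT1 (cid (dmz_ex j f)).

Lemma dmzE j f : droot j * dmz j f = f - msym (sw j) f.
Proof. by rewrite /dmz; case: cid. Qed.

Lemma dmz_uniq j f q : droot j * q = f - msym (sw j) f -> dmz j f = q.
Proof. by rewrite -dmzE => /(mulfI (droot_neq0 j)). Qed.

Lemma dmzP j c f g : dmz j (c *: f + g) = c *: dmz j f + dmz j g.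
Proof.
apply: dmz_uniq; rewrite msymD; apply: linear_identity; last exact: dmzE.
by rewrite -scalerAr dmzE msymZ scalerBr.
Qed.

Lemma dmzD j f g : dmz j (f + g) = dmz j f + dmz j g.
Proof. by have := dmzP j 1 f g; rewrite !scale1r. Qed.

Lemma dmz0 j : dmz j 0 = 0.
Proof. by apply: dmz_uniq; rewrite msym0 subrr mulr0. Qed.

Lemma dmzM j f g : dmz j (f * g) = dmz j f * g + msym (sw j) f * dmz j g.
Proof. by apply: dmz_uniq; rewrite msymM; apply: leibniz_identity; exact: dmzE. Qed.

Lemma dmz_sym j f : msym (sw j) f = f -> dmz j f = 0.
Proof. by move=> h; apply: dmz_uniq; rewrite h subrr mulr0. Qed.

Lemma dmz_symM j f g : msym (sw j) f = f -> dmz j (f * g) = f * dmz j g.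
Proof. by move=> h; rewrite dmzM dmz_sym // mul0r add0r h. Qed.

Lemma msym_dmz j f : msym (sw j) (dmz j f) = dmz j f.
Proof.
apply/esym/dmz_uniq; rewrite -[droot j]opprK -msym_droot mulNr -msymM dmzE.
by rewrite msymB swK opprB.
Qed.

Lemma dmz_dmz j f : dmz j (dmz j f) = 0.
Proof. exact/dmz_sym/msym_dmz. Qed.

Lemma dmz_Xlo j : dmz j 'X_(lo j) = 1.
Proof. by apply: dmz_uniq; rewrite mulr1 msym_X tpermL. Qed.

Lemma dmz_Xhi j : dmz j 'X_(hi j) = -1.
Proof. by apply: dmz_uniq; rewrite mulrN1 msym_X tpermR opprB. Qed.

Lemma msym_sw_X j i : i != lo j -> i != hi j -> msym (sw j) 'X_i = 'X_i :> R.
Proof. by move=> h1 h2; rewrite msym_X tpermD // eq_sym. Qed.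

Lemma dmz_far (i j : 'I_n.-1) f : (i.+1 < j)%N || (j.+1 < i)%N ->
  dmz i (dmz j f) = dmz j (dmz i f).
Proof.
move=> hij.
have sfix (u v : 'I_n.-1) : (u.+1 < v)%N || (v.+1 < u)%N -> msym (sw u) (droot v) = droot v.
  by move=> h; rewrite msymB !msym_sw_X //; apply/eqP => /(congr1 val) /=; lia.
have key (u v : 'I_n.-1) : (u.+1 < v)%N || (v.+1 < u)%N ->
    droot u * droot v * dmz u (dmz v f) =
    f - msym (sw v) f - (msym (sw u) f - msym (sw u) (msym (sw v) f)).
  move=> h; apply: (far_identity (dmzE u _) (dmzE v f)).
  by rewrite -{1}(sfix u v h) -msymM dmzE msymB.
have hji : (j.+1 < i)%N || (i.+1 < j)%N by rewrite orbC.
apply: mulf2_cancel (key i j hij) _; [exact: droot_neq0 | exact: droot_neq0|].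
rewrite (key j i hji).
suff: msym (sw i) (msym (sw j) f) = msym (sw j) (msym (sw i) f).
  by move=> ->; exact: far_swap.
rewrite -!msymMm; congr (msym _ f); rewrite [RHS]conjgC; congr (_ * _)%g.
have [n1 n2 n3 n4] : [/\ lo i != lo j, lo i != hi j, hi i != lo j & hi i != hi j].
  by split; apply/eqP => /(congr1 val) /=; lia.
by rewrite /sw tpermJ !tpermD // eq_sym.
Qed.

(** After multiplication by the three positive roots both sides become the same alternating sum, and
    the roots can be cancelled in a domain. *)
Lemma dmz_braid (i j : 'I_n.-1) f : j = i.+1 :> nat ->
  dmz i (dmz j (dmz i f)) = dmz j (dmz i (dmz j f)).
Proof.
move=> h; have hl : lo j = hi i by apply: val_inj; rewrite /= h.
have n1 := lo_neq_hi i; have n2 := lo_neq_hi j; have n3 : lo i != hi j.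
  by apply/eqP => /(congr1 val) /=; lia.
rewrite hl in n2.
have sij : msym (sw i) (droot j) = droot i + droot j.
  by rewrite msymB !msym_X /sw hl tpermR tpermD // 1?eq_sym // /droot hl addrA subrK.
have sji : msym (sw j) (droot i) = droot i + droot j.
  by rewrite msymB !msym_X /sw hl tpermL tpermD // 1?eq_sym // /droot hl addrA subrK.
(* The third positive root is the image of the root of [j] under the swap at [i]. *)
have nz : droot i + droot j != 0.
  rewrite -sij; apply: contraNneq (droot_neq0 j) => /(congr1 (msym (sw i))).
  by rewrite swK msym0 => ->.
have key (u v : 'I_n.-1) : msym (sw u) (droot v) = droot u + droot v ->
    msym (sw v) (droot u) = droot u + droot v ->
    droot u * droot v * (droot u + droot v) * dmz u (dmz v (dmz u f)) =
    f - msym (sw u) f - msym (sw v) f + msym (sw v) (msym (sw u) f)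
    + msym (sw u) (msym (sw v) f) - msym (sw u) (msym (sw v) (msym (sw u) f)).
  move=> suv svu; set q1 := dmz u f; set q2 := dmz v q1.
  have e1 : droot u * q1 = f - msym (sw u) f by exact: dmzE.
  have e2 : droot v * q2 = q1 - msym (sw v) q1 by exact: dmzE.
  have e3 : droot u * dmz u q2 = q2 - msym (sw u) q2 by exact: dmzE.
  have e4 : (droot u + droot v) * msym (sw u) q2 = q1 - msym (sw u) (msym (sw v) q1).
    have s1 : msym (sw u) q1 = q1 by exact: msym_dmz.
    apply: etrans (congr1 (fun z => z * _) (esym suv)) _.
    apply: etrans (esym (msymM _ _ _)) (etrans (congr1 (msym (sw u)) e2) _).
    by apply: etrans (msymB _ _ _) (congr1 (fun z => z - _) s1).
  have e5 : (droot u + droot v) * msym (sw v) q1 =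
      msym (sw v) f - msym (sw v) (msym (sw u) f).
    by have := congr1 (msym (sw v)) e1; rewrite msymM msymB svu.
  have e6 : droot v * msym (sw u) (msym (sw v) q1) =
      msym (sw u) (msym (sw v) f) - msym (sw u) (msym (sw v) (msym (sw u) f)).
    have := congr1 (msym (sw u)) e5; rewrite msymM msymB msymD suv msym_droot.
    by rewrite addKr.
  exact: braid_identity e1 e2 e3 e4 e5 e6.
apply: mulf3_cancel (key i j sij sji) _; [exact: droot_neq0|exact: droot_neq0|exact: nz|].
rewrite (key j i (etrans sji (addrC _ _)) (etrans sij (addrC _ _))).
suff -> : msym (sw j) (msym (sw i) (msym (sw j) f)) =
          msym (sw i) (msym (sw j) (msym (sw i) f)) by exact: braid_swap.
rewrite -!msymMm; congr (msym _ f).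
have conjE (u v : 'I_n.-1) : (sw v * (sw u * sw v) = sw u ^ sw v)%g.
  by rewrite conjgE tpermV.
rewrite !conjE !tpermJ /sw hl tpermL tpermR !tpermD // eq_sym //.
Qed.

End Demazure.

Lemma leibniz_difference (D : comPzRingType) (a x y f g sf sg : D) :
  a * x = f - sf -> a * y = g - sg -> x * g - f * y = x * sg - sf * y.
Proof.
move=> ex ey; rewrite -(subrK sf f) -(subrK sg g) -ex -ey; ring.
Qed.

(** * The action on polynomials and its matrix coefficients *)

Section PolynomialAction.
Context (k : fieldType) (n : nat).
Local Notation R := {mpoly k[n]}.
Implicit Types (f g h : R) (x y : free_alg k n).

Definition act_gen (u : gen n) f : R :=
  match u with inl i => 'X_i * f | inr j => dmz j f end.
Definition act_word (w : word n) f : R := foldr act_gen f w.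
(** The action of the free algebra does not in general factor through the cyclotomic quotient, since
    multiplication by ['X_i ^+ l] is not zero; only its matrix coefficients through [tau]
    descend. *)
Definition act x f : R := lext (act_word^~ f) (x : {malg k[word n]}).

Lemma actPl c x y f : act (c *: x + y) f = c *: act x f + act y f.
Proof. exact: (@lext_linear k (word n) R (act_word^~ f) c x y). Qed.

Lemma act0l f : act 0 f = 0.
Proof. by have := actPl (-1) 0 0 f; rewrite !scaleN1r !addNr. Qed.

Lemma actDl x y f : act (x + y) f = act x f + act y f.
Proof. by have := actPl 1 x y f; rewrite !scale1r. Qed.

Lemma actBl x y f : act (x - y) f = act x f - act y f.
Proof. by rewrite addrC -scaleN1r actPl scaleN1r addrC. Qed.

Lemma act_mono w f : act (mono k w) f = act_word w f.
Proof. by rewrite /act /mono locked_withE lextU. Qed.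

Lemma act_wordP w c f g : act_word w (c *: f + g) = c *: act_word w f + act_word w g.
Proof.
elim: w => [|[i|j] w IH] //=; rewrite IH; last exact: dmzP.
by rewrite mulrDr scalerAr.
Qed.

Lemma actPr x c f g : act x (c *: f + g) = c *: act x f + act x g.
Proof.
elim/free_ind: x => [|d x y IHx IHy|w]; first by rewrite !act0l scaler0 addr0.
  rewrite !actPl IHx IHy !scalerDr addrACA; congr (_ + _ + _).
  by rewrite !scalerA mulrC.
by rewrite !act_mono act_wordP.
Qed.

Lemma act0r x : act x 0 = 0.
Proof. by have := actPr x (-1) 0 0; rewrite !scaleN1r !addNr. Qed.

Lemma actM x y f : act (x * y) f = act x (act y f).
Proof.
elim/free_ind: x => [|c x x' IH IH'|u]; first by rewrite mul0r !act0l.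
  by rewrite mulrDl -scalerAl !actPl IH IH'.
elim/free_ind: y f => [f|c y y' IH IH' f|v f]; first by rewrite mulr0 !act0l act0r.
  by rewrite mulrDr -free_scalerAr !actPl actPr IH IH'.
by rewrite -monoM !act_mono /act_word foldr_cat.
Qed.

Lemma act1 f : act 1 f = f.
Proof. by rewrite -mono1 act_mono. Qed.

Lemma act_y i f : act (fy k i) f = 'X_i * f.
Proof. by rewrite act_mono. Qed.

Lemma act_psi j f : act (fpsi k j) f = dmz j f.
Proof. by rewrite act_mono. Qed.

Lemma act_yX i e f : act (fy k i ^+ e) f = 'X_i ^+ e * f.
Proof.
elim: e => [|e IH]; first by rewrite !expr0 act1 mul1r.
by rewrite !exprS actM IH act_y mulrA.
Qed.

Lemma mcoeffXM (m0 : 'X_{1..n}) g m : ~~ (m0 <= m)%MM -> ('X_[m0] * g)@_m = 0.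
Proof.
move=> h; rewrite [g]mpolyE mulr_sumr raddf_sum big1 //= => m' _.
rewrite -scalerAr -mpolyXD mcoeffZ mcoeffX.
case: eqP => [e|_]; last by rewrite mulr0.
by rewrite -e lem_addr in h.
Qed.

Section Tau.
Context (b : 'I_n -> nat).

Definition tau_mon (s : 'S_n) : 'X_{1..n} := [multinom b (s i) | i < n].
(** The pairing with the alternating sum of the monomials whose exponents permute [b]; antisymmetry
    makes it blind to polynomials symmetric under one adjacent swap. *)
Definition tau f : k := \sum_(s : 'S_n) (-1) ^+ s * f@_(tau_mon s).

Lemma tauP c f g : tau (c *: f + g) = c * tau f + tau g.
Proof.
rewrite /tau mulr_sumr -big_split; apply: eq_bigr => s _.
by rewrite mcoeffD mcoeffZ mulrDr mulrCA.
Qed.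

Lemma tau0 : tau 0 = 0.
Proof. by rewrite /tau big1 // => s _; rewrite mcoeff0 mulr0. Qed.

Lemma tauD f g : tau (f + g) = tau f + tau g.
Proof. by have := tauP 1 f g; rewrite scale1r mul1r. Qed.

Lemma tauB f g : tau (f - g) = tau f - tau g.
Proof. by rewrite addrC -scaleN1r tauP mulN1r addrC. Qed.

Lemma tau_neq0 f : tau f != 0 -> exists s : 'S_n, f@_(tau_mon s) != 0.
Proof.
move=> h; apply/existsP; apply: contraNT h => /existsPn h.
rewrite /tau big1 // => s _; have /negPn/eqP -> := h s; exact: mulr0.
Qed.

Lemma tau_sym j f : msym (sw j) f = f -> tau f = 0.
Proof.
move=> sf; rewrite /tau (bigID (fun s : 'S_n => odd_perm s)) /=.
(* The permutations [s] and [sw j * s] have the same coefficient, by the symmetry of [f], and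
   opposite signs. *)
rewrite (reindex_inj (mulgI (sw j))) /=.
have odd_sw : odd_perm (sw j) = true by rewrite odd_tperm lo_neq_hi.
under eq_bigl => s do rewrite odd_permM odd_sw.
rewrite -big_split big1 // => s /negPf es /=.
have -> : f@_(tau_mon (sw j * s)) = f@_(tau_mon s).
  rewrite -[in RHS]sf mcoeff_sym; congr (f@__); apply/mnmP => i.
  by rewrite !mnmE permM.
by rewrite odd_permM odd_sw es /= expr1 expr0 mulN1r mul1r addNr.
Qed.

(** The difference of the two arguments is itself a value of [dmz j], hence symmetric and killed by
    [tau]. *)
Lemma tau_dmz j f g : tau (dmz j f * g) = tau (f * dmz j g).
Proof.
apply/eqP; rewrite -subr_eq0 -tauB; apply/eqP/(@tau_sym j).
have -> : dmz j f * g - f * dmz j g = dmz j (f * msym (sw j) g).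
  have dsg : dmz j (msym (sw j) g) = - dmz j g.
    by apply: dmz_uniq; rewrite swK mulrN dmzE opprB.
  rewrite dmzM dsg mulrN.
  exact: leibniz_difference (dmzE j f) (dmzE j g).
exact: msym_dmz.
Qed.

Lemma tau_act x f g : tau (f * act x g) = tau (act (free_star x) f * g).
Proof.
elim/free_ind: x f g => [f g|c x y IHx IHy f g|w].
- by rewrite free_star0 !act0l mulr0 mul0r.
- by rewrite free_starP !actPl mulrDr mulrDl -scalerAr -scalerAl !tauP IHx IHy.
rewrite free_star_mono => f g; rewrite !act_mono.
elim: w f => [|u w IH] f //=; rewrite rev_cons -cats1 /act_word foldr_cat -/(act_word _ _).
have -> : foldr act_gen f [:: u] = act_gen u f by [].
rewrite -IH; case: u => [i|j] /=; first by rewrite mulrA [f * _]mulrC.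
by rewrite -tau_dmz.
Qed.

Lemma tau_cyc l i f : (forall i, b i < l)%N -> tau ('X_i ^+ l * f) = 0.
Proof.
move=> bl; rewrite /tau big1 // => s _.
rewrite mpolyXn mcoeffXM ?mulr0 //; apply/negP => /mnm_lepP/(_ i).
by rewrite mulmnE mnm1E eqxx mnmE mul1n leqNgt bl.
Qed.

End Tau.

Section MatrixCoefficients.
Context (l : nat) (b : 'I_n -> nat).
Hypothesis bl : forall i, (b i < l)%N.
Local Notation NH := (nh k n l).

(** Every relation but the last already holds between operators. The cyclotomic one acts as
    multiplication by ['X_i ^+ l], and all exponents that [tau] reads are below [l]. *)
Lemma act_nh_rel x f g : nh_rel l x -> tau b (f * act x g) = 0.
Proof.
case=> {x} [i j|i j h1 h2|j|j|j|i j h|i j h|i h].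
- by rewrite actBl !actM !act_y mulrCA subrr mulr0 tau0.
- rewrite actBl !actM !act_y !act_psi dmz_symM; last exact: msym_sw_X.
  by rewrite subrr mulr0 tau0.
- rewrite !actBl act1 !actM !act_y !act_psi.
  have -> : dmz j ('X_(hi j) * g) = - g + 'X_(lo j) * dmz j g.
    by rewrite dmzM dmz_Xhi msym_X tpermR mulN1r.
  by rewrite opprD opprK addrCA subrr addr0 subrr mulr0 tau0.
- rewrite !actBl act1 !actM !act_y !act_psi.
  have -> : dmz j ('X_(lo j) * g) = g + 'X_(hi j) * dmz j g.
    by rewrite dmzM dmz_Xlo msym_X tpermL mul1r.
  by rewrite addrK subrr mulr0 tau0.
- by rewrite expr2 actM !act_psi dmz_dmz mulr0 tau0.
- by rewrite actBl !actM !act_psi dmz_far // subrr mulr0 tau0.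
- by rewrite actBl !actM !act_psi dmz_braid // subrr mulr0 tau0.
- by rewrite act_yX mulrCA tau_cyc.
Qed.

(** A right factor is absorbed by [g] and a left factor by [f], through adjointness; this is why
    both polynomials are arbitrary. *)
Lemma act_nh_ideal x f g : nh_ideal_rel l x -> tau b (f * act x g) = 0.
Proof.
move=> h; elim: h f g => {x} [x h f g|f g|x y _ IHx _ IHy f g|a x _ IH f g|a x _ IH f g].
- exact: act_nh_rel.
- by rewrite act0l mulr0 tau0.
- by rewrite actDl mulrDr tauD IHx IHy addr0.
- by rewrite actM tau_act IH.
- by rewrite actM IH.
Qed.

Definition mcoef f g (x : NH) : k := tau b (f * act (qrepr x) g).

Lemma mcoefE f g x : mcoef f g (nhpi l x) = tau b (f * act x g).
Proof.
apply/eqP; rewrite -subr_eq0 /mcoef -tauB -mulrBr -actBl; apply/eqP/act_nh_ideal.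
exact/nh_idealP/qreprP.
Qed.

Lemma mcoefP f g c (x y : NH) : mcoef f g (c *: x + y) = c * mcoef f g x + mcoef f g y.
Proof.
elim/nhpi_ind: x => x; elim/nhpi_ind: y => y.
by rewrite -nhpiZ -nhpiD !mcoefE actPl mulrDr -scalerAr tauP.
Qed.

Lemma mcoef0 f g : mcoef f g 0 = 0.
Proof. by have := mcoefP f g (-1) 0 0; rewrite scaleN1r mulN1r !addNr. Qed.

Lemma mcoef_sum f g (I : Type) (r : seq I) (P : pred I) (c : I -> k) (F : I -> NH) :
  mcoef f g (\sum_(i <- r | P i) c i *: F i) = \sum_(i <- r | P i) c i * mcoef f g (F i).
Proof.
elim: r => [|i r IH]; first by rewrite !big_nil mcoef0.
by rewrite !big_cons; case: (P i) => //; rewrite mcoefP IH.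
Qed.

End MatrixCoefficients.

End PolynomialAction.

(** * Lexicographic order as a numerical weight *)

Section LexWeight.

(** The digits of [a] read in base [N], the first being the most significant: lexicographic
    comparison becomes a weight in [nat], as [triangular_free] requires. *)
Definition lexw (N n : nat) (a : nat -> nat) : nat := (\sum_(i < n) a i * N ^ (n.-1 - i))%N.

Lemma lexwS N n a : lexw N n.+1 a = (a 0 * N ^ n + lexw N n (fun i => a i.+1))%N.
Proof.
rewrite /lexw big_ord_recl /= subn0; congr (_ + _)%N; apply: eq_bigr => i _.
by rewrite /bump /=; congr (_ * _ ^ _)%N; have := ltn_ord i; lia.
Qed.

Lemma lexw_bound N n a : (0 < N)%N -> (forall i, i < n -> a i < N)%N -> (lexw N n a < N ^ n)%N.
Proof.
move=> N0; elim: n a => [|n IH] a h; first by rewrite /lexw big_ord0 expn0.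
rewrite lexwS expnS; have := IH (fun i => a i.+1) (fun i ni => h i.+1 ni).
have : (a 0 * N ^ n + N ^ n <= N * N ^ n)%N by rewrite -mulSnr leq_mul2r h ?orbT.
lia.
Qed.

Lemma lexw_lt N n a b i : (i < n)%N -> (forall i', i' < n -> a i' < N)%N ->
  (forall i', i' < i -> a i' = b i')%N -> (a i < b i)%N -> (lexw N n a < lexw N n b)%N.
Proof.
move=> + hN; have N0 : (i < n)%N -> (0 < N)%N by move=> /hN; case: (N).
move=> ni; move: {N0}(N0 ni) => N0; elim: n i a b ni hN => // n IH i a b ni hN.
rewrite !lexwS; case: i ni => [|i] ni eab lab.
  have := lexw_bound (n := n) N0 (fun i ni => hN i.+1 ni).
  have : (a 0 * N ^ n + N ^ n <= b 0 * N ^ n)%N by rewrite -mulSnr leq_mul2r lab orbT.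
  lia.
rewrite -(eab 0%N) // ltn_add2l; apply: (IH i) => //.
- by move=> i' ni'; exact: hN.
- by move=> i' ii'; exact: eab.
Qed.

Lemma first_diff n (a b : nat -> nat) : (exists2 i, (i < n)%N & a i != b i) ->
  exists i, [/\ (i < n)%N, forall i', (i' < i)%N -> a i' = b i' & a i != b i].
Proof.
move=> [i0 ni0 h0]; have ex : exists i, a i != b i by exists i0.
case: (ex_minnP ex) => i hi mi; exists i; split=> //.
  exact: leq_ltn_trans (mi _ h0) ni0.
by move=> i' ii'; apply/eqP; apply: contraTT ii' => /mi; rewrite -leqNgt.
Qed.

End LexWeight.

(** * Constant terms of Demazure words *)

Section DemazureWords.
Context (k : fieldType) (n : nat).
Local Notation R := {mpoly k[n]}.
Implicit Types (f g q : R).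

(** Indices are natural numbers, so that words can be built with [iota]; a variable or an operator
    out of range is zero. *)
Definition Xn (i : nat) : R := if insub i is Some i' then 'X_i' else 0.
Definition dmzn (j : nat) f : R := if insub j is Some j' then @dmz k n j' f else 0.
Definition dword (w : seq nat) f : R := foldr dmzn f w.

Lemma XnE (i : 'I_n) : Xn i = 'X_i. Proof. by rewrite /Xn valK. Qed.

Lemma dmznE (j : 'I_n.-1) f : dmzn j f = dmz j f. Proof. by rewrite /dmzn valK. Qed.

Lemma dmznD j f g : dmzn j (f + g) = dmzn j f + dmzn j g.
Proof. by rewrite /dmzn; case: insub => [j'|]; rewrite ?addr0 // dmzD. Qed.

Lemma dwordD w f g : dword w (f + g) = dword w f + dword w g.
Proof. by elim: w => //= j w ->; exact: dmznD. Qed.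

Lemma dword_X w i f : (forall j, j \in w -> i < j)%N ->
  dword w (Xn i * f) = Xn i * dword w f.
Proof.
elim: w => //= j w IH h; rewrite IH => [|j' wj']; last by rewrite h ?inE ?wj' ?orbT.
have ij : (i < j)%N by rewrite h ?inE ?eqxx.
rewrite /dmzn; case: insubP => [j' _ /= ej|_]; last by rewrite mulr0.
rewrite /Xn; case: insubP => [i' _ /= ei|_]; last by rewrite !mul0r dmz0.
by rewrite dmz_symM // msym_sw_X //; apply/eqP => /(congr1 val) /=; lia.
Qed.

Lemma dword_Xn w i e f : (forall j, j \in w -> i < j)%N ->
  dword w (Xn i ^+ e * f) = Xn i ^+ e * dword w f.
Proof.
move=> h; elim: e => [|e IH]; first by rewrite !expr0 !mul1r.
by rewrite !exprS -!mulrA dword_X // IH.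
Qed.

Lemma ev0M f g : (f * g)@_0%MM = f@_0%MM * g@_0%MM.
Proof. by have [h _] := @mcoeff0_is_multiplicative n k; exact: h. Qed.

Lemma ev0_Xn i : (Xn i)@_0%MM = 0.
Proof.
rewrite /Xn; case: insub => [i'|]; last exact: mcoeff0.
by rewrite mcoeffX; case: eqP => // /mnmP/(_ i'); rewrite mnm1E mnmE eqxx.
Qed.

Lemma ev0_Xn_exp i e : (Xn i ^+ e)@_0%MM = (e == 0%N)%:R.
Proof.
case: e => [|e]; first by rewrite expr0 mcoeff1 eqxx.
by rewrite exprS ev0M ev0_Xn mul0r.
Qed.

Lemma ev0_msym (s : 'S_n) f : (msym s f)@_0%MM = f@_0%MM.
Proof. by rewrite mcoeff_sym; congr (f@__); apply/mnmP => i; rewrite !mnmE. Qed.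

(** One factor [Xn j] is split off by the twisted Leibniz rule; the other term is the swapped
    remainder, whose power sits on [Xn j.+1] and whose cofactor keeps its constant term. *)
Lemma dmzn_X j e f : (j.+1 < n)%N -> exists q g,
  dmzn j (Xn j ^+ e.+1 * f) = Xn j * q + Xn j.+1 ^+ e * g /\ g@_0%MM = f@_0%MM.
Proof.
move=> jn; have hj : (j < n.-1)%N by lia.
pose j' := Ordinal hj; have -> : j = j' by [].
have -> : Xn j'.+1 = 'X_(hi j') by exact: (XnE (hi j')).
have -> : Xn j' = 'X_(lo j') by exact: (XnE (lo j')).
rewrite dmznE exprSr -mulrA [_ * f]mulrC mulrA dmzM dmz_Xlo mulr1 addrC.
exists (dmz j' ('X_(lo j') ^+ e * f)), (msym (sw j') f); split; last exact: ev0_msym.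
by rewrite addrC mulrC msymM rmorphXn /= msym_X tpermL.
Qed.

(* Modulo the ideal of the first variable, each Demazure operator of the chain moves the
   power of that variable one step to the right and lowers it by one. *)
Lemma ev0_chain c i e f : (i + c < n)%N -> (c <= e)%N ->
  (dword (rev (iota i c)) (Xn i ^+ e * f))@_0%MM = (e == c)%:R * f@_0%MM.
Proof.
elim: c i e f => [|c IH] i e f ic ce; first by rewrite /= ev0M ev0_Xn_exp.
case: e ce => // e ce; rewrite /= rev_cons /dword foldr_rcons -/(dword _ _).
have [|q [g [-> eg]]] := @dmzn_X i e f; first by lia.
rewrite dwordD dword_X ?mcoeffD ?ev0M ?ev0_Xn ?mul0r ?add0r.
  by rewrite IH //; [rewrite eqSS eg | lia].
by move=> j; rewrite mem_rev mem_iota => /andP[].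
Qed.

(* For [i] running down from [n-1] to [0], the chains [i, i+1, .., i + c i - 1]: a reduced word
   of the permutation with Lehmer code [c]. *)
Fixpoint code_word (c : nat -> nat) (r i : nat) : seq nat :=
  if r is r'.+1 then code_word c r' i.+1 ++ iota i (c i) else [::].

Lemma code_word_ge c r i j : j \in code_word c r i -> (i <= j)%N.
Proof.
elim: r i => //= r IH i; rewrite mem_cat => /orP[/IH|]; first lia.
by rewrite mem_iota => /andP[].
Qed.

Definition Xmon (m : nat -> nat) (r i : nat) : R := \prod_(i <= j < i + r) Xn j ^+ m j.

Lemma XmonS m r i : Xmon m r.+1 i = Xn i ^+ m i * Xmon m r i.+1.
Proof. by rewrite /Xmon big_ltn ?addnS ?addSn //; lia. Qed.

(** The chains with a larger start commute with [Xn i], so the chain at [i] meets the full power of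
    that variable and, being of the same length, uses it up exactly. *)
Lemma ev0_code c m r i : (i + r <= n)%N -> (forall j, i <= j < i + r -> j + c j < n)%N ->
  (forall j, (i <= j < i + r)%N -> c j = m j) ->
  (dword (rev (code_word c r i)) (Xmon m r i))@_0%MM = 1.
Proof.
elim: r i => [|r IH] i ir hc ecm; first by rewrite /= /Xmon addn0 big_geq // mcoeff1 eqxx.
rewrite XmonS /= rev_cat /dword foldr_cat -!/(dword _ _) dword_Xn; last first.
  by move=> j; rewrite mem_rev => /code_word_ge.
have ci : c i = m i by apply: ecm; lia.
rewrite -ci ev0_chain // ?eqxx ?mul1r; last by apply: hc; lia.
by apply: IH; [lia | move=> j hj; apply: hc; lia | move=> j hj; apply: ecm; lia].
Qed.

(** Before [d] every variable contributes the factor 1, as for equal codes; at [d] the chain is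
    shorter than the exponent, so a variable survives and the constant term is zero. *)
Lemma ev0_code_lt c m r i d : (i + r <= n)%N -> (forall j, i <= j < i + r -> j + c j < n)%N ->
  (i <= d < i + r)%N -> (forall j, (i <= j < d)%N -> c j = m j) -> (c d < m d)%N ->
  (dword (rev (code_word c r i)) (Xmon m r i))@_0%MM = 0.
Proof.
elim: r i => [|r IH] i ir hc hd ecm lcm; first by lia.
rewrite XmonS /= rev_cat /dword foldr_cat -!/(dword _ _) dword_Xn; last first.
  by move=> j; rewrite mem_rev => /code_word_ge.
have ici : (i + c i < n)%N by apply: hc; lia.
have [ei|ni] := eqVneq i d.
  by rewrite ev0_chain // ?ei; [rewrite gtn_eqF // mul0r | rewrite ltnW].
have ci : c i = m i by apply: ecm; lia.
rewrite -ci ev0_chain // eqxx mul1r.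
by apply: IH => //; [lia | move=> j hj; apply: hc; lia | lia | move=> j hj; apply: ecm; lia].
Qed.

End DemazureWords.

(** * The functionals on monomials *)

Section TauMonomials.
Context (k : fieldType) (n : nat).
Local Notation R := {mpoly k[n]}.

Lemma XmonE (m : nat -> nat) : Xmon k n m n 0 = 'X_[[multinom m i | i < n]].
Proof.
rewrite /Xmon add0n big_mkord mpolyXE_id; apply: eq_bigr => i _.
by rewrite XnE mnmE.
Qed.

Lemma sum_leq_eq (a c : 'I_n -> nat) : (forall i, a i <= c i)%N ->
  (\sum_i c i <= \sum_i a i)%N -> a =1 c.
Proof.
move=> h hs; have := @leqif_sum _ xpredT (fun i => a i == c i) a c.
case=> [i _|le eq]; first exact/leqif_eq.
have : \sum_i a i == \sum_i c i :> nat by rewrite eqn_leq le hs.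
by rewrite eq => /forallP h' i; apply/eqP; have := h' i.
Qed.

Lemma tau_mono_neq0 (b : 'I_n -> nat) (a : 'X_{1..n}) (h : R) :
  tau b ('X_[a] * h) != 0 -> exists s : 'S_n, forall i, (a i <= b (s i))%N.
Proof.
move=> /tau_neq0[s hs]; exists s => i.
have : (a <= tau_mon b s)%MM by apply: contraR hs => /mcoeffXM ->.
by move/mnm_lepP/(_ i); rewrite mnmE.
Qed.

(** A permutation [s] contributes only if [b i <= b (s i)] for all [i]. Both sides have the same
    sum, so equality holds throughout, and injectivity leaves the identity, whose term is the
    constant coefficient of [h]. *)
Lemma tau_self (b : 'I_n -> nat) (h : R) : injective b ->
  tau b ('X_[[multinom b i | i < n]] * h) = h@_0%MM.
Proof.
move=> bI; rewrite /tau (bigD1 1%g) //= odd_perm1 expr0 mul1r big1 ?addr0.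
  rewrite mulrC -[RHS](mcoeffMX _ [multinom b i | i < n]) addm0; congr (_@__).
  by apply/mnmP => i; rewrite !mnmE perm1.
move=> s s1; rewrite mcoeffXM ?mulr0 //; apply: contra s1 => /mnm_lepP h'.
apply/eqP/permP => i; rewrite perm1; apply: bI; symmetry; apply: (sum_leq_eq (c := b \o s)).
  by move=> i'; have := h' i'; rewrite !mnmE.
by rewrite [X in (_ <= X)%N](reindex_inj (@perm_inj _ s)).
Qed.

Section Gram.
Context (l : nat) (e e' : nat -> nat).
Let d (i : 'I_n) := (l.-1 - i)%N.
Let f i := (l.-1 - i - e' i)%N.
Hypothesis he' : forall i, (i < n)%N -> (i + e' i < l)%N.

Lemma gram_mono : Xmon k n e n 0 * Xmon k n f n 0 =
  'X_[[multinom (e i + f i)%N | i < n]].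
Proof. by rewrite !XmonE -mpolyXD; congr 'X_[_]; apply/mnmP => i; rewrite !mnmE. Qed.

(** As [d] is the staircase, a contribution of [s] means [e i + s i = e' i + i]. If [e i > e' i] at
    the first difference, then [s i < i], so [e] and [e'] agree at [s i] and [s] fixes [s i],
    against injectivity. *)
Lemma gram_neq0 : tau d (Xmon k n e n 0 * Xmon k n f n 0) != 0 ->
  (forall i, (i < n)%N -> e i = e' i) \/
  exists i, [/\ (i < n)%N, forall i', (i' < i)%N -> e i' = e' i' & (e i < e' i)%N].
Proof.
rewrite gram_mono => /tau_neq0[s]; rewrite mcoeffX.
have [es _|_] := [multinom (e i + f i)%N | i < n] =P tau_mon d s; last by rewrite eqxx.
have hs (i : 'I_n) : (e i + s i = e' i + i)%N.
  have := (mnmP _ _).1 es i; rewrite !mnmE /d /f; have := he' (ltn_ord i); have := he' (ltn_ord (s i)).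
  by lia.
have [h|[i0 ni0 ne0]] : (forall i, (i < n)%N -> e i = e' i) \/ exists2 i, (i < n)%N & e i != e' i.
- have [h|/existsNP[i]] := pselect (forall i, (i < n)%N -> e i = e' i); [by left | right].
  by exists i; [lia | apply/eqP; lia].
- by left.
right; have [i [ni eq ne]] := first_diff (ex_intro2 _ _ i0 ni0 ne0).
exists i; split=> //; pose io := Ordinal ni.
have := hs io; rewrite /= => hio.
suff : (i <= s io)%N by move/eqP: ne; lia.
rewrite leqNgt; apply/negP => lt.
have := hs (s io); rewrite eq // => hh.
have : s (s io) = s io by apply: val_inj => /=; lia.
by move/perm_inj => /(congr1 val) /=; lia.
Qed.

Lemma gram_self : (forall i, (i < n)%N -> e i = e' i) -> (n <= l)%N ->
  tau d (Xmon k n e n 0 * Xmon k n f n 0) = 1.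
Proof.
move=> ee nl; rewrite gram_mono.
have -> : [multinom (e i + f i)%N | i < n] = [multinom d i | i < n].
  apply/mnmP => i; rewrite !mnmE ee // /f /d.
  by have := he' (ltn_ord i); have := ltn_ord i; lia.
rewrite -['X_[_]]mulr1 tau_self ?mcoeff1 ?eqxx // => i j; rewrite /d => h.
by apply: val_inj => /=; have := ltn_ord i; have := ltn_ord j; lia.
Qed.

End Gram.
End TauMonomials.

(** * Spanning sets of the nilHecke algebra *)

Section LinearSpan.
Context (k : fieldType) (V : lmodType k).

(** The span of a possibly infinite set; [in_span] takes over once the generators are indexed by a
    finite type. *)
Inductive lspan (S : V -> Prop) : V -> Prop :=
| LSpan0 : lspan S 0
| LSpanP c x y of S x & lspan S y : lspan S (c *: x + y).

Lemma lspan_mem (S : V -> Prop) x : S x -> lspan S x.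
Proof. by move=> h; rewrite -[x]scale1r -[_ *: _]addr0; apply: LSpanP => //; exact: LSpan0. Qed.

Lemma lspanD (S : V -> Prop) x y : lspan S x -> lspan S y -> lspan S (x + y).
Proof.
move=> hx hy; elim: hx => {x} [|c x z Sx _ IH]; first by rewrite add0r.
by rewrite -addrA; exact: LSpanP.
Qed.

Lemma lspanZ (S : V -> Prop) c x : lspan S x -> lspan S (c *: x).
Proof.
elim=> {x} [|d x z Sx _ IH]; first by rewrite scaler0; exact: LSpan0.
by rewrite scalerDr scalerA; exact: LSpanP.
Qed.

Lemma lspanN (S : V -> Prop) x : lspan S x -> lspan S (- x).
Proof. by rewrite -scaleN1r; exact: lspanZ. Qed.

Lemma lspan_sum (S : V -> Prop) (I : Type) (r : seq I) (P : pred I) (F : I -> V) :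
  (forall i, P i -> lspan S (F i)) -> lspan S (\sum_(i <- r | P i) F i).
Proof.
by move=> h; elim/big_ind: _ => //; [exact: LSpan0 | exact: lspanD].
Qed.

Lemma lspan_trans (S S' : V -> Prop) x :
  (forall y, S y -> lspan S' y) -> lspan S x -> lspan S' x.
Proof.
move=> h; elim=> {x} [|c x y Sx _ IH]; first exact: LSpan0.
by apply: lspanD => //; apply: lspanZ; exact: h.
Qed.

Lemma lspan_in_span (S : V -> Prop) (T : finType) (b : T -> V) x :
  (forall y, S y -> in_span b y) -> lspan S x -> in_span b x.
Proof.
move=> h; elim=> {x} [|c x y Sx _ IH]; first exact: in_span0.
by apply: in_spanD => //; exact: h.
Qed.

End LinearSpan.

(** * Words in the psi_j and Lehmer codes *)

Section NilHeckeWords.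
Context (k : fieldType) (n l : nat).
Local Notation NH := (nh k n l).
Implicit Types (x z : NH) (e : nat -> nat) (s : seq nat).

Definition yn (i : nat) : NH := if insub i is Some i' then @ynh k n l i' else 0.
Definition psin (j : nat) : NH := if insub j is Some j' then @psinh k n l j' else 0.
Definition psiw s : NH := \prod_(j <- s) psin j.

Lemma ynE (i : 'I_n) : yn i = ynh k l i. Proof. by rewrite /yn valK. Qed.
Lemma psinE (j : 'I_n.-1) : psin j = psinh k l j. Proof. by rewrite /psin valK. Qed.

Lemma yn_comm i j : GRing.comm (yn i) (yn j).
Proof.
rewrite /GRing.comm /yn; case: insub => [i'|]; last by rewrite mul0r mulr0.
by case: insub => [j'|]; [exact: nh_yy | rewrite mul0r mulr0].
Qed.

Lemma yn_psin i j : i != j -> i != j.+1 -> GRing.comm (yn i) (psin j).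
Proof.
move=> h1 h2; rewrite /GRing.comm /yn; case: insubP => [i' _ /= ei|_]; last by rewrite mul0r mulr0.
rewrite /psin; case: insubP => [j' _ /= ej|_]; last by rewrite mul0r mulr0.
by apply: nh_ypsi; apply/eqP => /(congr1 val) /= e; [move/eqP: h1|move/eqP: h2]; lia.
Qed.

Lemma yn_psin_lo j : (j.+1 < n)%N -> yn j * psin j = psin j * yn j.+1 + 1.
Proof.
move=> jn; have hj : (j < n.-1)%N by lia.
pose j' := Ordinal hj; have -> : j = j' by [].
rewrite psinE; have -> : yn j'.+1 = ynh k l (hi j') by exact: (ynE (hi j')).
have -> : yn j' = ynh k l (lo j') by exact: (ynE (lo j')).
exact: nh_nil1.
Qed.

Lemma psin_yn_lo j : (j.+1 < n)%N -> psin j * yn j = yn j.+1 * psin j + 1.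
Proof.
move=> jn; have hj : (j < n.-1)%N by lia.
pose j' := Ordinal hj; have -> : j = j' by [].
rewrite psinE; have -> : yn j'.+1 = ynh k l (hi j') by exact: (ynE (hi j')).
have -> : yn j' = ynh k l (lo j') by exact: (ynE (lo j')).
exact: nh_nil2.
Qed.

Lemma psin_sqr j : psin j * psin j = 0.
Proof. by rewrite /psin; case: insub => [j'|]; [exact: nh_psi2 | rewrite mul0r]. Qed.

Lemma psin_far i j : (i.+1 < j)%N || (j.+1 < i)%N -> GRing.comm (psin i) (psin j).
Proof.
move=> h; rewrite /GRing.comm /psin; case: insubP => [i' _ /= ei|_]; last by rewrite mul0r mulr0.
case: insubP => [j' _ /= ej|_]; last by rewrite mul0r mulr0.
by apply: nh_far; rewrite ei ej.
Qed.

Lemma psin_braid i : psin i * psin i.+1 * psin i = psin i.+1 * psin i * psin i.+1.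
Proof.
rewrite /psin; case: insubP => [i' _ /= ei|_]; last by rewrite !(mul0r, mulr0).
case: insubP => [j' _ /= ej|_]; last by rewrite !(mul0r, mulr0).
by apply: nh_braid; rewrite ei ej.
Qed.

Lemma psin_out j : (n <= j.+1)%N -> psin j = 0.
Proof. by move=> h; rewrite /psin insubN // -leqNgt; lia. Qed.

Lemma yn_out i : (n <= i)%N -> yn i = 0.
Proof. by move=> h; rewrite /yn insubN // -leqNgt. Qed.

Lemma yn_cyc : (0 < n)%N -> yn 0 ^+ l = 0.
Proof.
move=> n0; have -> : yn 0 = ynh k l (Ordinal n0) by exact: (ynE (Ordinal n0)).
rewrite /ynh; have -> : nhpi l (fy k (Ordinal n0)) ^+ l = nhpi l (fy k (Ordinal n0) ^+ l).
  by rewrite rmorphXn.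
by apply: nhpi_rel; exact: RelCyc.
Qed.

Lemma psiw_cat s t : psiw (s ++ t) = psiw s * psiw t.
Proof. exact: big_cat. Qed.

Lemma psiw_cons j s : psiw (j :: s) = psin j * psiw s.
Proof. exact: big_cons. Qed.

Lemma psiw1 j : psiw [:: j] = psin j.
Proof. by rewrite /psiw big_seq1. Qed.

Lemma psiw_nil : psiw [::] = 1.
Proof. by rewrite /psiw big_nil. Qed.

Lemma psiw_comm x s : (forall j, j \in s -> GRing.comm x (psin j)) -> GRing.comm x (psiw s).
Proof.
elim: s => [|j s IH] h; first by rewrite psiw_nil; exact: commr1.
rewrite psiw_cons; apply: commrM; first by apply: h; rewrite inE eqxx.
by apply: IH => j' sj'; apply: h; rewrite inE sj' orbT.
Qed.

(** The chain conjugates the transposition at [j] to the one at [j.+1]: the letters before [j]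
    commute with [psin j.+1], those after [j.+1] commute with [psin j], and one braid relation
    remains. *)
Lemma chain_braid i m j : (i <= j)%N -> (j.+1 < i + m)%N ->
  psiw (iota i m) * psin j = psin j.+1 * psiw (iota i m).
Proof.
move=> ij jm.
have -> : iota i m = iota i (j - i) ++ [:: j; j.+1] ++ iota j.+2 (i + m - j.+2).
  have -> : m = ((j - i) + (2 + (i + m - j.+2)))%N by lia.
  by rewrite !iotaD subnKC //=; congr (_ ++ [:: _, _ & iota _ _]); lia.
rewrite !psiw_cat !psiw_cons psiw_nil mulr1.
have c1 : GRing.comm (psin j) (psiw (iota j.+2 (i + m - j.+2))).
  by apply: psiw_comm => j'; rewrite mem_iota => h; apply: psin_far; lia.
have c2 : GRing.comm (psin j.+1) (psiw (iota i (j - i))).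
  by apply: psiw_comm => j'; rewrite mem_iota => h; apply: psin_far; lia.
rewrite -!mulrA -c1 !mulrA c2 -!mulrA; congr (_ * _).
by rewrite !mulrA psin_braid.
Qed.

Definition is_code (c : nat -> nat) (r i : nat) : Prop :=
  forall j, (i <= j < i + r)%N -> (j + c j < i + r)%N.

(** The chain starting at [i] meets the new letter first. A letter inside the chain passes through
    it as [j.+1], its last letter gives a square and hence zero, the next letter lengthens it, and a
    farther one commutes with it; what passes is multiplied to the chains starting from [i.+1]
    on. *)
Lemma code_mul_psin c r i j : (i + r = n)%N -> is_code c r i -> (i <= j)%N ->
  psiw (code_word c r i) * psin j = 0 \/
  exists c', is_code c' r i /\ psiw (code_word c r i) * psin j = psiw (code_word c' r i).
Proof.
have [nj|jn] := leqP n j.+1; first by move=> *; left; rewrite psin_out // mulr0.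
elim: r i j jn c => [|r IH] i j jn c irn hc ij; first by lia.
have hc' : is_code c r i.+1 by move=> j' hj'; have := hc j'; lia.
have ci : (i + c i < n)%N by have := hc i; lia.
have modif (c' : nat -> nat) : is_code c' r i.+1 -> exists c2, is_code c2 r.+1 i /\
    psiw (code_word c' r i.+1) * psiw (iota i (c i)) = psiw (code_word c2 r.+1 i).
  move=> hc2; exists (fun v => if v == i then c i else c' v); split.
    move=> v hv /=; case: eqP => [->|ne]; first lia.
    by have := hc2 v; lia.
  rewrite /= eqxx psiw_cat; congr (psiw _ * _).
  have : forall r' i', (i < i')%N -> code_word c' r' i' =
      code_word (fun v => if v == i then c i else c' v) r' i'.
    elim=> //= r' IH' i' ii'; rewrite -IH'; last lia.
    by have -> : (i' == i) = false by lia.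
  exact.
have reduce j' : (i < j')%N -> (j'.+1 < n)%N ->
    psiw (iota i (c i)) * psin j = psin j' * psiw (iota i (c i)) ->
    psiw (code_word c r.+1 i) * psin j = 0 \/
    exists c', is_code c' r.+1 i /\ psiw (code_word c r.+1 i) * psin j = psiw (code_word c' r.+1 i).
  move=> ij' j'n e; rewrite /= psiw_cat -mulrA e mulrA.
  have [|z|[c' [hc2 ->]]] := IH i.+1 j' j'n c _ hc' ij'; first lia.
    by left; rewrite z mul0r.
  by right; have [c2 [h1 h2]] := modif _ hc2; exists c2; rewrite h2.
have [jlt|jgt|je] := ltngtP j (i + c i)%N.
- have [jlt2|jge] := ltnP j.+1 (i + c i).
    by apply: (reduce j.+1); rewrite ?chain_braid //; lia.
  left; rewrite /= psiw_cat -mulrA.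
  have -> : iota i (c i) = iota i (c i).-1 ++ [:: j].
    have {1}-> : c i = ((c i).-1 + 1)%N by lia.
    by rewrite iotaD /=; congr (_ ++ [:: _]); lia.
  by rewrite psiw_cat psiw1 -mulrA psin_sqr !mulr0.
- apply: (reduce j) => //; first lia.
  by symmetry; apply: psiw_comm => j'; rewrite mem_iota => h; apply: psin_far; lia.
- right; exists (fun v => if v == i then (c i).+1 else c v); split.
    move=> v hv /=; case: eqP => [->|ne]; first lia.
    by have := hc v; lia.
  rewrite /= eqxx !psiw_cat -mulrA; congr (psiw _ * _).
    have : forall r' i', (i < i')%N -> code_word c r' i' =
        code_word (fun v => if v == i then (c i).+1 else c v) r' i'.
      elim=> //= r' IH' i' ii'; rewrite -IH'; last lia.
      by have -> : (i' == i) = false by lia.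
    exact.
  by rewrite -[(c i).+1]addn1 iotaD psiw_cat /= psiw1 je.
Qed.

Lemma psiw_code s : psiw s = 0 \/ exists c, is_code c n 0 /\ psiw s = psiw (code_word c n 0).
Proof.
elim/last_ind: s => [|s j IH].
  right; exists (fun=> 0%N); split; first by move=> j; lia.
  have : forall r i, code_word (fun=> 0%N) r i = [::] by elim=> //= r IH i; rewrite IH.
  by move=> ->.
rewrite -cats1 psiw_cat psiw1; have [->|[c [hc ->]]] := IH; first by left; rewrite mul0r.
by have [|[c' [h1 h2]]] := @code_mul_psin c n 0 j erefl hc (leq0n j); [left | right; exists c'].
Qed.

End NilHeckeWords.

(** * Truncating polynomials by complete symmetric polynomials *)

Section NilHeckeMonomials.
Context (k : fieldType) (n l : nat).
Local Notation NH := (nh k n l).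
Local Notation yn := (yn k n l).
Local Notation psin := (psin k n l).
Local Notation psiw := (psiw k n l).
Implicit Types (x z : NH) (e d J : nat -> nat) (s : seq nat).

Definition ymon r e : NH := \prod_(i < r) yn i ^+ e i.

Lemma ymonS r e : ymon r.+1 e = ymon r e * yn r ^+ e r.
Proof. by rewrite /ymon big_ord_recr. Qed.

Lemma ymon0 e : ymon 0 e = 1. Proof. by rewrite /ymon big_ord0. Qed.

Lemma comm_ymon x r e : (forall i, (i < r)%N -> GRing.comm x (yn i)) -> GRing.comm x (ymon r e).
Proof.
elim: r => [|r IH] h; first by rewrite ymon0; exact: commr1.
rewrite ymonS; apply: commrM; last by apply: commrX; exact: h.
by apply: IH => i ir; apply: h; lia.
Qed.

Lemma yn_ymon i r e : GRing.comm (yn i) (ymon r e).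
Proof. by apply: comm_ymon => j _; exact: yn_comm. Qed.

Lemma ynX_ymon a i r e : yn i ^+ a * ymon r e = ymon r e * yn i ^+ a.
Proof. exact: commr_sym (commrX _ (commr_sym (yn_ymon i r e))). Qed.

Lemma ymon_ymon r e r' e' : GRing.comm (ymon r e) (ymon r' e').
Proof. by apply: comm_ymon => i _; exact/commr_sym/yn_ymon. Qed.

Lemma ymonD r e e' : ymon r e * ymon r e' = ymon r (fun i => e i + e' i)%N.
Proof.
elim: r => [|r IH]; first by rewrite !ymon0 mulr1.
by rewrite !ymonS -IH exprD -mulrA [_ * (ymon r e' * _)]mulrA ynX_ymon !mulrA.
Qed.

Lemma eq_ymon r e e' : (forall i, (i < r)%N -> e i = e' i) -> ymon r e = ymon r e'.
Proof. by move=> h; apply: eq_bigr => i _; rewrite h. Qed.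

Lemma ymon_eq0 r : ymon r (fun=> 0%N) = 1.
Proof. by rewrite /ymon big1. Qed.

Lemma ymon_set r e i : (i < r)%N -> ymon r (fun v => if v == i then (e v).+1 else e v) =
  yn i * ymon r e.
Proof.
elim: r => // r IH; rewrite ltnS leq_eqVlt => /predU1P[->|ir].
  rewrite !ymonS eqxx exprS !mulrA; congr (_ * _).
  have -> : ymon r (fun v => if v == r then (e v).+1 else e v) = ymon r e.
    by apply: eq_ymon => v vr; rewrite ltn_eqF.
  exact/esym/yn_ymon.
by rewrite !ymonS IH // gtn_eqF // mulrA.
Qed.

(** The complete homogeneous symmetric polynomial of degree [q] in the first [i] variables, expanded
    by the power of the last one. *)
Fixpoint hs (i q : nat) : NH :=
  if i is i'.+1 then \sum_(a < q.+1) yn i' ^+ a * hs i' (q - a) else (q == 0%N)%:R.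

Lemma hsS i q : hs i.+1 q.+1 = hs i q.+1 + yn i * hs i.+1 q.
Proof.
rewrite /= big_ord_recl /= expr0 mul1r subn0; congr (_ + _).
rewrite mulr_sumr; apply: eq_bigr => a _.
by rewrite /bump /= add1n exprS -mulrA subSS.
Qed.

Lemma hs0 i : hs i 0 = 1.
Proof. by elim: i => //= i IH; rewrite big_ord1 expr0 mul1r. Qed.

Lemma comm_hs x i q : (forall j, (j < i)%N -> GRing.comm x (yn j)) -> GRing.comm x (hs i q).
Proof.
elim: i q => [|i IH] q h; first by rewrite /=; case: eqP => _; [exact: commr1 | exact: commr0].
apply: commr_sum => a _; apply: commrM; first by apply: commrX; exact: h.
by apply: IH => j ji; apply: h; lia.
Qed.

(** The Demazure operator at [i] takes the complete symmetric polynomial of degree [q.+1] to that of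
    degree [q] in one more variable, and the swapped term dies because [psin i] squares to zero. *)
Lemma psin_hs_psin i q : (i.+1 < n)%N ->
  psin i * hs i.+1 q.+1 * psin i = hs i.+2 q * psin i.
Proof.
move=> iN; have c0 q' : GRing.comm (psin i) (hs i q').
  by apply: comm_hs => j ji; apply/commr_sym/yn_psin; lia.
elim: q => [|q IH].
  rewrite hsS !hs0 mul1r mulr1 mulrDr mulrDl c0 -mulrA psin_sqr mulr0 add0r.
  by rewrite psin_yn_lo // mulrDl mul1r -mulrA psin_sqr mulr0 add0r.
rewrite hsS mulrDr mulrDl c0 -mulrA psin_sqr mulr0 add0r.
rewrite mulrA psin_yn_lo // !mulrDl mul1r -!mulrA [psin i * (_ * _)]mulrA IH.
by rewrite mulrA -mulrDl addrC -hsS.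
Qed.

(** Induction from [yn 0 ^+ l = 0]: by [psin_hs_psin] the polynomial in one more variable is killed
    by [psin i] on the right, and writing 1 as [psin i * yn i - yn i.+1 * psin i] then kills the
    polynomial itself. *)
Lemma hs_eq0 i q : (i < n)%N -> (l - i <= q)%N -> hs i.+1 q = 0.
Proof.
elim: i q => [|i IH] q iN lq.
  have -> : hs 1 q = yn 0 ^+ q.
    rewrite /= big_ord_recr /= subnn mulr1 big1 ?add0r // => a _.
    by rewrite subn_eq0 leqNgt ltn_ord mulr0.
  have -> : q = (l + (q - l))%N by lia.
  by rewrite exprD yn_cyc // mul0r.
have h : hs i.+2 q * psin i = 0.
  by rewrite -psin_hs_psin // IH ?mulr0 ?mul0r //; lia.
have -> : hs i.+2 q = hs i.+2 q * (psin i * yn i - yn i.+1 * psin i).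
  by rewrite psin_yn_lo // addrC addKr mulr1.
rewrite mulrBr mulrA h mul0r sub0r mulrA.
have -> : hs i.+2 q * yn i.+1 = yn i.+1 * hs i.+2 q.
  by symmetry; apply: comm_hs => j _; exact: yn_comm.
by rewrite -mulrA h mulr0 oppr0.
Qed.

Lemma hs_unroll i q b : hs i.+1 (q + b) =
  \sum_(a < b) yn i ^+ a * hs i (q + b - a) + yn i ^+ b * hs i.+1 q.
Proof.
elim: b => [|b IH]; first by rewrite big_ord0 add0r addn0 expr0 mul1r.
rewrite addnS hsS IH mulrDr mulrA -exprS addrA; congr (_ + _).
rewrite big_ord_recl /= expr0 mul1r subn0; congr (_ + _).
rewrite mulr_sumr; apply: eq_bigr => a _.
by rewrite /bump /= add1n exprS -mulrA subSS.
Qed.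

Lemma lspan_mulr (S S' : NH -> Prop) x z :
  (forall y, S y -> lspan S' (y * z)) -> lspan S x -> lspan S' (x * z).
Proof.
move=> h; elim=> {x} [|c x y Sx _ IH]; first by rewrite mul0r; exact: LSpan0.
by rewrite mulrDl -nh_scalerAl; apply: lspanD => //; exact/lspanZ/h.
Qed.

Lemma lspan_mull (S S' : NH -> Prop) x z :
  (forall y, S y -> lspan S' (z * y)) -> lspan S x -> lspan S' (z * x).
Proof.
move=> h; elim=> {x} [|c x y Sx _ IH]; first by rewrite mulr0; exact: LSpan0.
by rewrite mulrDr -nh_scalerAr; apply: lspanD => //; exact/lspanZ/h.
Qed.

(** Weakly increasing sequences that include the positions of ones: [lam la] gives the monomial
    [ylam k la], and the constant sequence [l] gives 1, hence the whole algebra. *)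
Definition is_bound J : Prop :=
  (forall i, (i < n)%N -> (i < J i <= l)%N) /\
  (forall i i', (i <= i' < n)%N -> (J i <= J i')%N).

Definition ybound J r : NH := ymon r (fun i => l - J i)%N.

Section Bound.
Context (J : nat -> nat) (hJ : is_bound J).

(** In degree [q + (l - J i)] the complete symmetric polynomial vanishes. Its terms with a power of
    [yn i] below [l - J i] have a larger degree in the earlier variables and are killed by the
    earlier factors, so the remaining term [yn i ^+ (l - J i) * hs i.+1 q] is killed too. *)
Lemma ybound_hs i q : (i < n)%N -> (J i - i <= q)%N -> ybound J i.+1 * hs i.+1 q = 0.
Proof.
have [J1 J2] := hJ; elim: i q => [|i IH] q iN Jq; rewrite /ybound ymonS -/(ybound J _).
  rewrite /ybound ymon0 mul1r; have := hs_unroll 0 q (l - J 0).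
  rewrite hs_eq0; [|exact: iN|by have := J1 0%N; lia].
  rewrite big1 ?add0r; first by move <-.
  move=> a _; have -> : hs 0 (q + (l - J 0) - a) = 0; last by rewrite mulr0.
  by rewrite /=; case: eqP => // h; have := ltn_ord a; have := J1 0%N; lia.
rewrite -mulrA; have := hs_unroll i.+1 q (l - J i.+1).
rewrite hs_eq0; [|exact: iN|by have := J1 i.+1; lia].
move/eqP; rewrite eq_sym addrC addr_eq0 => /eqP ->.
rewrite mulrN mulr_sumr big1 ?oppr0 // => a _.
have -> : ybound J i.+1 * (yn i.+1 ^+ a * hs i.+1 (q + (l - J i.+1) - a)) =
   yn i.+1 ^+ a * (ybound J i.+1 * hs i.+1 (q + (l - J i.+1) - a)).
  by rewrite !mulrA; congr (_ * _); rewrite ynX_ymon.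
rewrite IH ?mulr0 //; first lia.
by have := J2 i i.+1; have := ltn_ord a; have := J1 i.+1; have := J1 i; lia.
Qed.

Definition poly_gen r x : Prop := exists e, x = ymon r e.
Definition red_gen r x : Prop :=
  exists e, (forall i, (i < r)%N -> (e i < J i - i)%N) /\ x = ybound J r * ymon r e.

Lemma lspan_poly_mul r x z : lspan (poly_gen r) x -> lspan (poly_gen r) z ->
  lspan (poly_gen r) (x * z).
Proof.
move=> hx hz; apply: lspan_mulr hx => _ [e ->]; apply: lspan_mull hz.
by move=> _ [e' ->]; apply: lspan_mem; eexists; exact: ymonD.
Qed.

Lemma lspan_poly_hs r q : lspan (poly_gen r) (hs r q).
Proof.
elim: r q => [|r IH] q.
  rewrite /=; case: eqP => _; last exact: LSpan0.
  by apply: lspan_mem; exists (fun=> 0%N); rewrite ymon0.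
apply: lspan_sum => a _.
apply: lspan_mull (IH (q - a)%N).
move=> _ [e ->]; apply: lspan_mem; exists (fun v => if v == r then nat_of_ord a else e v).
rewrite ymonS eqxx.
have -> : ymon r (fun v => if v == r then nat_of_ord a else e v) = ymon r e.
  by apply: eq_ymon => v vr; rewrite ltn_eqF.
exact: ynX_ymon.
Qed.

(** [hs r.+1 q] is monic of degree [q] in the last variable, so [ybound_hs] rewrites [yn r ^+ q],
    for [q >= J r - r], through lower powers with coefficients in the earlier variables. *)
Lemma lspan_red r x : (r <= n)%N -> lspan (poly_gen r) x -> lspan (red_gen r) (ybound J r * x).
Proof.
elim: r x => [|r IH] x rn hx.
  have e0 : ybound J 0 = 1 by exact: ymon0.
  rewrite e0 mul1r; apply: lspan_trans hx => _ [e ->]; rewrite !ymon0.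
  by apply: lspan_mem; exists e; rewrite e0 ymon0 mulr1.
have hr : (r < n)%N by [].
have step q z : lspan (poly_gen r) z -> lspan (red_gen r.+1) (ybound J r.+1 * (z * yn r ^+ q)).
  elim/ltn_ind: q z => q IHq z hz.
  have [qd|dq] := ltnP q (J r - r).
    have -> : ybound J r.+1 * (z * yn r ^+ q) =
        (ybound J r * z) * yn r ^+ (l - J r + q).
      rewrite /ybound ymonS exprD !mulrA; congr (_ * _).
      rewrite -!mulrA; congr (_ * _); symmetry.
      have : GRing.comm (yn r ^+ (l - J r)) z; last by move=> ->.
      apply: commr_sym; apply: commrX; elim: hz => [|c u v [e ->] _ hv].
        exact/commr_sym/commr0.
      by rewrite /GRing.comm mulrDl mulrDr hv -nh_scalerAl -nh_scalerAr yn_ymon.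
    apply: lspan_mulr (IH z (ltnW rn) hz).
    move=> _ [e [he ->]]; apply: lspan_mem.
    exists (fun v => if v == r then q else e v); split.
      move=> i ir; case: eqP => [->|ne] //; apply: he; lia.
    have er : ymon r (fun v => if v == r then q else e v) = ymon r e.
      by apply: eq_ymon => v vr; rewrite ltn_eqF.
    rewrite /ybound !ymonS eqxx er exprD !mulrA; congr (_ * _).
    rewrite -!mulrA; congr (_ * _).
    exact/esym/ynX_ymon.
  have : ybound J r.+1 * (z * hs r.+1 q) = 0.
    have cz : GRing.comm z (hs r.+1 q).
      apply: comm_hs => j _; elim: hz => [|c u v [e ->] _ hv].
        exact/commr_sym/commr0.
      by rewrite /GRing.comm mulrDl mulrDr hv -nh_scalerAl -nh_scalerAr yn_ymon.
    by rewrite cz mulrA ybound_hs // mul0r.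
  rewrite /= big_ord_recr /= subnn hs0 mulr1 mulrDr mulrDr => /eqP.
  rewrite addrC addr_eq0 => /eqP ->; apply: lspanN; rewrite !mulr_sumr.
  apply: lspan_sum => a _.
  have -> : z * (yn r ^+ a * hs r (q - a)) = z * hs r (q - a) * yn r ^+ a.
    rewrite -mulrA; congr (_ * _); apply: comm_hs => j _; apply: commr_sym.
    by apply: commrX; exact: yn_comm.
  by apply: IHq => //; apply: lspan_poly_mul => //; exact: lspan_poly_hs.
elim: hx => [|c u v [e ->] _ hv]; first by rewrite mulr0; exact: LSpan0.
rewrite mulrDr -nh_scalerAr; apply: lspanD => //; apply: lspanZ.
by rewrite ymonS; apply: step; apply: lspan_mem; exists e.
Qed.

End Bound.

End NilHeckeMonomials.

(** * Normal forms and divisibility by monomials *)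

Section NilHeckeSpanning.
Context (k : fieldType) (n l : nat).
Local Notation NH := (nh k n l).
Local Notation yn := (yn k n l).
Local Notation psin := (psin k n l).
Local Notation psiw := (psiw k n l).
Local Notation ymon := (ymon k n l).
Implicit Types (x z : NH) (e d J : nat -> nat) (s : seq nat).

Definition word_gen z : Prop := exists e s, z = ymon n e * psiw s.
Definition code_gen z : Prop := exists e c, is_code c n 0 /\ z = ymon n e * psiw (code_word c n 0).

Lemma word_gen_psin z j : lspan word_gen z -> lspan word_gen (z * psin j).
Proof.
apply: lspan_mulr => _ [e [s ->]]; apply: lspan_mem; exists e, (rcons s j).
by rewrite -cats1 psiw_cat psiw1 mulrA.
Qed.

Lemma word_gen_ymon z e : lspan word_gen z -> lspan word_gen (ymon n e * z).
Proof.
apply: lspan_mull => _ [e' [s ->]]; apply: lspan_mem; eexists; exists s.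
by rewrite mulrA ymonD.
Qed.

Lemma yn_ymonE i : (i < n)%N -> yn i = ymon n (fun v => (v == i) : nat).
Proof.
move=> iN; have := @ymon_set k n l n (fun=> 0%N) i iN; rewrite ymon_eq0 mulr1 => <-.
by apply: eq_ymon => v _; case: eqP.
Qed.

Lemma psiw_word_gen s : lspan word_gen (psiw s).
Proof. by apply: lspan_mem; exists (fun=> 0%N), s; rewrite ymon_eq0 mul1r. Qed.

(** The nilHecke relations push [yn i] to the left across each letter, at the price of terms with
    one letter less. *)
Lemma psiw_yn s i : lspan word_gen (psiw s * yn i).
Proof.
elim/last_ind: s i => [|s j IH] i.
  rewrite psiw_nil mul1r; have [ni|iN] := leqP n i; first by rewrite yn_out //; exact: LSpan0.
  by rewrite yn_ymonE //; apply: lspan_mem; eexists; exists [::]; rewrite psiw_nil mulr1.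
rewrite -cats1 psiw_cat psiw1.
have [nj|jn] := leqP n j.+1; first by rewrite psin_out // mulr0 mul0r; exact: LSpan0.
have [->|ij] := eqVneq i j.
  rewrite -mulrA psin_yn_lo // mulrDr mulr1 mulrA; apply: lspanD; last exact: psiw_word_gen.
  exact: word_gen_psin.
have [->|ij'] := eqVneq i j.+1.
  have -> : psiw s * psin j * yn j.+1 = psiw s * yn j * psin j - psiw s.
    by rewrite -[X in _ = X - _]mulrA yn_psin_lo // mulrDr mulr1 addrK mulrA.
  apply: lspanD; last exact/lspanN/psiw_word_gen.
  exact: word_gen_psin.
have -> : psiw s * psin j * yn i = psiw s * yn i * psin j.
  by rewrite -!mulrA (yn_psin k n l ij ij').
exact: word_gen_psin.
Qed.

Lemma word_gen_yn z i : lspan word_gen z -> lspan word_gen (z * yn i).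
Proof.
apply: lspan_mulr => _ [e [s ->]]; rewrite -mulrA; apply: word_gen_ymon; exact: psiw_yn.
Qed.

Lemma nh_word_gen x : lspan word_gen x.
Proof.
elim/nhpi_ind: x => x; elim/free_ind: x => [|c x y IHx IHy|w].
- by rewrite (raddf0 (@nhpi k n l)); exact: LSpan0.
- by rewrite nhpiD nhpiZ; apply: lspanD => //; exact: lspanZ.
elim/last_ind: w => [|w g IH].
  apply: lspan_mem; exists (fun=> 0%N), [::].
  by rewrite ymon_eq0 psiw_nil mulr1.
rewrite -cats1 monoM nhpiM; case: g => [i|j].
  have -> : nhpi l (mono k [:: inl i]) = yn i by rewrite ynE.
  exact: word_gen_yn.
have -> : nhpi l (mono k [:: inr j]) = psin j by rewrite psinE.
exact: word_gen_psin.
Qed.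

Lemma nh_code_gen x : lspan code_gen x.
Proof.
apply: lspan_trans (nh_word_gen x) => _ [e [s ->]].
have [->|[c [hc ->]]] := psiw_code k n l s; first by rewrite mulr0; exact: LSpan0.
by apply: lspan_mem; exists e, c.
Qed.

(* The larger power of [y_j] in [ymon n d] is lowered to that of [y_(j+1)]: the symmetric
   factor commutes with [psi_j]. *)
Lemma psin_ymon_lower j d x : (j.+1 < n)%N -> (d j.+1 <= d j)%N ->
  exists z, psin j * (ymon n d * x) = ymon n (fun v => if v == j then d j.+1 else d v) * z.
Proof.
move=> jn dj; pose d' v := if v == j then d j.+1 else d v; rewrite -/d'.
pose r := ymon n (fun v => if v == j then (d j - d j.+1)%N else 0%N).
have -> : ymon n d = ymon n d' * r.
  by rewrite ymonD; apply: eq_ymon => v _; rewrite /d'; case: eqP => [->|]; lia.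
exists (psin j * (r * x)); rewrite -mulrA !mulrA; congr (_ * _ * _).
pose d0 v := if (v == j) || (v == j.+1) then 0%N else d v.
pose d1 v := if (v == j) || (v == j.+1) then d j.+1 else 0%N.
have -> : ymon n d' = ymon n d0 * ymon n d1.
  rewrite ymonD; apply: eq_ymon => v _; rewrite /d' /d0 /d1.
  by have [->|_] := eqVneq v j => //=; have [->|_] := eqVneq v j.+1; rewrite //= addn0.
have c0 : GRing.comm (psin j) (ymon n d0).
  rewrite /ymon; apply: commr_prod => i _; rewrite /d0; case: ifP => [_|/norP[h1 h2]].
    by rewrite expr0; exact: commr1.
  by apply: commrX; apply: commr_sym; exact: yn_psin.
have c1 : GRing.comm (psin j) (yn j * yn j.+1).
  rewrite /GRing.comm mulrA psin_yn_lo // mulrDl mul1r -mulrA.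
  have -> : psin j * yn j.+1 = yn j * psin j - 1 by rewrite yn_psin_lo // addrK.
  by rewrite mulrBr mulr1 subrK mulrA (yn_comm k n l j.+1 j).
have -> : ymon n d1 = (yn j * yn j.+1) ^+ d j.+1.
  elim: (d j.+1) @d1 => [|m IH] /=.
    by rewrite expr0; rewrite -[RHS](ymon_eq0 k n l n); apply: eq_ymon => v _; case: ifP.
  rewrite exprS -IH -mulrA -!ymon_set //; last lia.
  apply: eq_ymon => v _.
  by case: (eqVneq v j) => vj; case: (eqVneq v j.+1) => vj' //=; lia.
by rewrite mulrA c0 -!mulrA; congr (_ * _); apply: commrX.
Qed.

(** The letters act from the last to the first; each lowers its exponent to that of its right
    neighbour, which is [d (i + m)] by then. *)
Lemma chain_ymon_lower i m d x : (i + m < n)%N -> (forall v, (i <= v < i + m)%N -> (d v.+1 <= d v)%N) ->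
  exists z, psiw (iota i m) * (ymon n d * x) =
    ymon n (fun v => if (i <= v < i + m)%N then d (i + m) else d v) * z.
Proof.
elim: m i => [|m IH] i im hd.
  exists x; rewrite psiw_nil mul1r; congr (_ * _); apply: eq_ymon => v _.
  by rewrite addn0; case: ifP => //; lia.
have [||z hz] := IH i.+1; [lia | by move=> v hv; apply: hd; lia |].
rewrite /= psiw_cons -mulrA hz.
pose d' v := if (i < v < i.+1 + m)%N then d (i.+1 + m)%N else d v; rewrite -/d'.
have [||z' ->] := @psin_ymon_lower i d' z; first by lia.
  have -> : d' i = d i by rewrite /d'; case: ifP => //; lia.
  have -> : d' i.+1 = d (i.+1 + m)%N.
    by rewrite /d'; case: ifP => // h; congr d; lia.
  have mono j : (j <= m)%N -> (d (i.+1 + j) <= d i)%N.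
    elim: j => [|j IHj] jm; first by rewrite addn0; apply: hd; lia.
    by apply: leq_trans (IHj (ltnW jm)); rewrite addnS; apply: hd; lia.
  exact: mono.
exists z'; congr (_ * _); apply: eq_ymon => v _; rewrite /d'.
have [->|ne] := eqVneq v i.
  have -> : (i <= i < i + m.+1)%N by lia.
  by case: ifP => h; congr d; lia.
by do 2 case: ifP => //; try lia; move=> h1 h2; congr d; lia.
Qed.

(* This is the divisibility making [psi_c y^la] an element of the right ideal of [y^a]. *)
Lemma code_ymon_lower a c r i d x : (i + r = n)%N -> is_code c r i ->
  (forall v v', (v <= v' < n)%N -> (d v' <= d v)%N) ->
  (forall v v', (v <= v' < n)%N -> (a v' <= a v)%N) ->
  (forall v, (v < i)%N -> (a v <= d v)%N) ->
  (forall v, (i <= v < n)%N -> (a v <= d (v + c v))%N) ->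
  exists z, psiw (code_word c r i) * (ymon n d * x) = ymon n a * z.
Proof.
elim: r i d x => [|r IH] i d x irn hc hd ha h1 h2.
  exists (ymon n (fun v => d v - a v)%N * x); rewrite psiw_nil mul1r mulrA ymonD.
  by congr (_ * _); apply: eq_ymon => v vn; have := h1 v; lia.
have ci : (i + c i < n)%N by have := hc i; lia.
have [|v hv|z hz] := @chain_ymon_lower i (c i) d x; [lia | by apply: hd; lia |].
rewrite /= psiw_cat -mulrA hz; apply: IH; first lia.
- by move=> v hv; have := hc v; lia.
- move=> v v' vv'; case: ifP => c1; case: ifP => c2; try exact: leqnn; try (apply: hd; lia).
- exact: ha.
- move=> v vi; case: ifP => c1; last first.
    have [e|ne] := eqVneq v i; [| apply: h1; lia].
    have c0 : c i = 0%N by lia.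
    by have := h2 i; rewrite c0 addn0 e; apply; lia.
  have vi0 : v = i by lia.
  rewrite vi0. apply: h2. lia.
- move=> v vi; case: ifP => c1; last by apply: h2; lia.
  by apply: leq_trans (h2 i _); [apply: ha; lia | lia].
Qed.

Lemma eq_code_word c c' r i : (forall j, (i <= j < i + r)%N -> c j = c' j) ->
  code_word c r i = code_word c' r i.
Proof.
elim: r i => //= r IH i h; rewrite h; last lia.
by rewrite (IH i.+1) // => j hj; apply: h; lia.
Qed.

Section FiniteFamilies.

Definition fn m (f : {ffun 'I_n -> 'I_m}) (i : nat) : nat :=
  if insub i is Some i' then nat_of_ord (f i') else 0%N.

Lemma fnE m (f : {ffun 'I_n -> 'I_m}) (i : 'I_n) : fn f i = f i.
Proof. by rewrite /fn valK. Qed.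

Lemma fn_ex m (g : nat -> nat) : (forall i, (i < n)%N -> (g i < m)%N) ->
  exists f : {ffun 'I_n -> 'I_m}, forall i, (i < n)%N -> fn f i = g i.
Proof.
move=> h; exists [ffun i : 'I_n => Ordinal (h i (ltn_ord i))] => i iN.
by rewrite -[i]/(nat_of_ord (Ordinal iN)) fnE ffunE.
Qed.

Lemma fn_inj m (f f' : {ffun 'I_n -> 'I_m}) :
  (forall i, (i < n)%N -> fn f i = fn f' i) -> f = f'.
Proof.
by move=> h; apply/ffunP => i; apply: val_inj; rewrite /= -!fnE; apply: h.
Qed.

Definition codeT : Type := {c : {ffun 'I_n -> 'I_n} | [forall i : 'I_n, (i + c i < n)%N]}.
HB.instance Definition _ := Finite.on codeT.
Definition cfun (c : codeT) : nat -> nat := fn (val c).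

Lemma cfun_code (c : codeT) : is_code (cfun c) n 0.
Proof.
move=> j jn; have hj : (j < n)%N by lia.
have := forallP (valP c) (Ordinal hj).
by rewrite -fnE.
Qed.

Lemma code_ex c : is_code c n 0 -> exists c' : codeT, forall i, (i < n)%N -> cfun c' i = c i.
Proof.
move=> hc; have [i iN|f hf] := @fn_ex n c; first by have := hc i; lia.
have h : [forall i : 'I_n, (i + f i < n)%N].
  by apply/forallP => i; rewrite -fnE hf //; have := hc i; have := ltn_ord i; lia.
by exists (exist _ f h).
Qed.

Lemma cfun_inj (c c' : codeT) : (forall i, (i < n)%N -> cfun c i = cfun c' i) -> c = c'.
Proof. by move=> h; apply: val_inj; exact: fn_inj. Qed.

Definition psic (c : codeT) : NH := psiw (code_word (cfun c) n 0).

Context (J : nat -> nat).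
Definition boxT : Type := {e : {ffun 'I_n -> 'I_l} | [forall i : 'I_n, (e i < J i - i)%N]}.
HB.instance Definition _ := Finite.on boxT.
Definition efun (e : boxT) : nat -> nat := fn (val e).

Lemma efun_lt (e : boxT) i : (i < n)%N -> (efun e i < J i - i)%N.
Proof.
by move=> iN; have := forallP (valP e) (Ordinal iN); rewrite -fnE.
Qed.

Lemma efun_inj (e e' : boxT) : (forall i, (i < n)%N -> efun e i = efun e' i) -> e = e'.
Proof. by move=> h; apply: val_inj; exact: fn_inj. Qed.

Hypothesis hJ : is_bound n l J.

Lemma box_ex e : (forall i, (i < n)%N -> (e i < J i - i)%N) ->
  exists e' : boxT, forall i, (i < n)%N -> efun e' i = e i.
Proof.
have [J1 _] := hJ; move=> he; have [i iN|f hf] := @fn_ex l e.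
  by have := he i iN; have := J1 i iN; lia.
have h : [forall i : 'I_n, (f i < J i - i)%N] by apply/forallP => i; rewrite -fnE hf //; exact: he.
by exists (exist _ f h).
Qed.

Lemma ybound_in_span x :
  in_span (fun u : boxT * codeT => ybound k n l J n * ymon n (efun u.1) * psic u.2)
    (ybound k n l J n * x).
Proof.
apply: (lspan_in_span (S := fun z => exists e c, [/\ forall i, (i < n)%N -> (e i < J i - i)%N,
    is_code c n 0 & z = ybound k n l J n * ymon n e * psiw (code_word c n 0)])).
  move=> _ [e [c [he hc ->]]].
  have [e' ee] := box_ex he; have [c' ec] := code_ex hc.
  have -> : ymon n e = ymon n (efun e') by apply: eq_ymon => i iN; rewrite ee.
  have -> : code_word c n 0 = code_word (cfun c') n 0 by apply: eq_code_word => j hj; rewrite ec.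
  exact: (in_span_mem (fun u : boxT * codeT => ybound k n l J n * ymon n (efun u.1) * psic u.2) (e', c')).
apply: lspan_mull (nh_code_gen x) => _ [e [c [hc ->]]]; rewrite mulrA.
have := @lspan_red k n l J hJ n (ymon n e) (leqnn n) (lspan_mem (ex_intro _ e erefl)).
apply: lspan_mulr => _ [e' [he' ->]]; apply: lspan_mem.
by exists e', c.
Qed.

End FiniteFamilies.

End NilHeckeSpanning.

(** * Counting cell elements *)

Section SequenceCount.
Local Open Scope nat_scope.
Implicit Types (x s : seq nat) (J e : nat -> nat).

Definition lehmer x i : nat := count (fun v => v < nth 0 x i)%N (drop i.+1 x).

Lemma count_lt_mono x a b : (a < b)%N -> a \in x ->
  (count (fun v => v < a)%N x < count (fun v => v < b)%N x)%N.
Proof.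
move=> ab ax; have : (0 < count (fun v => a <= v < b)%N x)%N.
  by rewrite -has_count; apply/hasP; exists a => //; lia.
have -> : count (fun v => v < b)%N x =
    (count (fun v => v < a)%N x + count (fun v => a <= v < b)%N x)%N.
  by elim: x {ax} => //= v x ->; lia.
lia.
Qed.

(** Of two distinct heads in rearrangements of the same list, the larger has strictly more entries
    below it, so the first digit determines the head. *)
Lemma lehmer_inj x s : perm_eq x s -> (forall i, (i < size x)%N -> lehmer x i = lehmer s i) ->
  x = s.
Proof.
elim: x s => [|a x IH] [|b s] //; try by move/perm_size.
move=> ps hl; have h0 := hl 0%N isT; rewrite /lehmer /= !drop0 in h0.
have key a' b' x' s' : perm_eq (a' :: x') (b' :: s') ->
    count (fun v => v < a')%N x' = count (fun v => v < b')%N s' -> ~~ (a' < b')%N.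
  move=> p' h; apply/negP => lt.
  have am : a' \in b' :: s' by rewrite -(perm_mem p') inE eqxx.
  have := count_lt_mono lt am; rewrite -(seq.permP p' (fun v => v < a')%N) /= !ltnn !add0n h.
  by rewrite ltnn.
have ab : a = b.
  have := key _ _ _ _ ps h0; have := key b a s x; rewrite perm_sym ps => /(_ isT (esym h0)).
  by lia.
subst b; congr (_ :: _); apply: IH; first by rewrite perm_cons in ps.
by move=> i ix; exact: (hl i.+1).
Qed.

Lemma sorted_nth_le s B k : sorted leq s -> (k < count (fun v => v <= B)%N s)%N ->
  (nth 0 s k <= B)%N.
Proof.
elim: s k => // a s IH k sa; have so : sorted leq s by exact: path_sorted sa.
have [aB|Ba] := leqP a B; last first.
  have all_gt : all (fun v => B < v)%N s.
    apply/allP => v vs; have /allP/(_ _ vs) := order_path_min leq_trans sa.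
    exact: leq_trans.
  rewrite /= [(a <= B)%N]leqNgt Ba /= add0n => h.
  have : has (fun v => v <= B)%N s by rewrite has_count; lia.
  by case/hasP => v vs vB; have := allP all_gt v vs; rewrite /= ltnNge vB.
case: k => [|k] //=; rewrite aB add1n ltnS; exact: IH.
Qed.

Definition avail J x m : seq nat := [seq v <- iota 1 (J m) | v \notin x].

Fixpoint inj_seq J e m : seq nat :=
  if m is m'.+1 then rcons (inj_seq J e m') (nth 0 (avail J (inj_seq J e m') m') (e m')) else [::].

Section Bounded.
Context (n : nat) (J : nat -> nat).
Hypothesis Jmono : forall i i', (i <= i' < n)%N -> (J i <= J i')%N.
Implicit Types (m : nat).

Definition below e : Prop := forall i, (i < n)%N -> (e i < J i - i)%N.

Lemma size_avail x m : uniq x -> (J m - size x <= size (avail J x m))%N.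
Proof.
move=> ux; have h := count_predC (mem x) (iota 1 (J m)); rewrite size_iota in h.
rewrite size_filter -{1}h leq_subLR; apply: leq_add; last exact: leqnn.
rewrite -size_filter; apply: uniq_leq_size; first by rewrite filter_uniq ?iota_uniq.
by move=> v; rewrite mem_filter => /andP[].
Qed.

Lemma size_inj_seq e m : size (inj_seq J e m) = m.
Proof. by elim: m => //= m IH; rewrite size_rcons IH. Qed.

Lemma inj_seqP e m : below e -> (m <= n)%N ->
  uniq (inj_seq J e m) /\ forall i, (i < m)%N -> (0 < nth 0 (inj_seq J e m) i <= J i)%N.
Proof.
move=> he; elim: m => // m IH mn; have [u h] := IH (ltnW mn).
have av : nth 0 (avail J (inj_seq J e m) m) (e m) \in avail J (inj_seq J e m) m.
  apply: mem_nth; apply: leq_trans (size_avail m u); rewrite size_inj_seq.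
  exact: he.
move: (av); rewrite mem_filter mem_iota => /andP[nin rng]; split.
  by rewrite /= rcons_uniq nin.
move=> i im; rewrite /= nth_rcons size_inj_seq; have [lt|le] := ltnP i m; first exact: h.
have -> : i = m by lia.
by rewrite eqxx; move: rng; rewrite add1n ltnS.
Qed.

Lemma inj_seq_inj e e' m : below e -> below e' -> (m <= n)%N ->
  inj_seq J e m = inj_seq J e' m -> forall i, (i < m)%N -> e i = e' i.
Proof.
move=> he he'; elim: m => // m IH mn /= /rcons_inj[es en].
have [u _] := inj_seqP he (ltnW mn).
have eqm : e m = e' m.
  rewrite -es in en; apply/eqP; rewrite -(nth_uniq 0 (s := avail J (inj_seq J e m) m)).
  - exact/eqP.
  - by apply: leq_trans (size_avail m u); rewrite size_inj_seq; exact: he.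
  - by apply: leq_trans (size_avail m u); rewrite size_inj_seq; exact: he'.
  - by rewrite filter_uniq // iota_uniq.
move=> i; rewrite ltnS leq_eqVlt => /predU1P[-> //|im].
by apply: IH => //; exact: ltnW.
Qed.

(** The first [i.+1] entries are at most [J i] because [J] is monotone, and so are the later entries
    below entry [i]. Sorting the entries turns this into the divisibility condition on the Lehmer
    code. *)
Lemma count_inj_seq e i (x := inj_seq J e n) : below e -> (i < n)%N ->
  (i + lehmer x i < count (fun v => v <= J i)%N x)%N.
Proof.
move=> he iN; have [u h] := inj_seqP he (leqnn n).
rewrite -{2}(cat_take_drop i.+1 x) count_cat.
have -> : count (fun v => v <= J i)%N (take i.+1 x) = i.+1.
  have st : size (take i.+1 x) = i.+1 by rewrite size_takel // size_inj_seq.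
  rewrite -[RHS]st; apply/eqP; rewrite -all_count; apply/(all_nthP 0) => j.
  rewrite st => ji; rewrite nth_take //=; have jn : (j < n)%N by lia.
  have /andP[_ hj] := h j jn; apply: leq_trans hj (Jmono _); lia.
rewrite addSn ltnS leq_add2l; apply: sub_count => v /= vi.
have /andP[_ hi] := h i iN; exact: leq_trans (ltnW vi) hi.
Qed.

Lemma lehmer_lt e i (x := inj_seq J e n) : (i < n)%N -> (i + lehmer x i < n)%N.
Proof.
move=> iN; have := count_size (fun v => v < nth 0 x i)%N (drop i.+1 x).
by rewrite size_drop size_inj_seq /lehmer; lia.
Qed.

End Bounded.

End SequenceCount.

(** * Partitions, codes and the count *)

Section Partitions.
Local Open Scope nat_scope.
Context (n l : nat).
Implicit Types (la : Defs.partn n l).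

Definition lam la i : nat := nth 0 (ones la) i.

Lemma mem_ones la v : (v \in ones la) = (0 < v <= l)%N && nth false (val la) v.-1.
Proof.
apply/mapP/idP => [[i]|].
  by rewrite mem_filter mem_iota => /andP[h1 h2] -> /=; rewrite h1 andbT; lia.
case: v => // v /andP[vl h]; exists v => //.
by rewrite mem_filter mem_iota h; lia.
Qed.

Lemma ones_sorted la : sorted ltn (ones la).
Proof.
rewrite /ones sorted_map; apply: sorted_filter; first by move=> a b c /=; lia.
by rewrite (eq_sorted (e' := ltn)) ?iota_ltn_sorted // => a b /=; lia.
Qed.

Lemma size_ones la : size (ones la) = n.
Proof.
apply: etrans _ (eqP (valP la)); rewrite size_map size_filter.
by rewrite -[in RHS](mkseq_nth false (val (val la))) /mkseq count_map size_tuple.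
Qed.

Lemma lam_lt la i i' : (i < i' < n)%N -> (lam la i < lam la i')%N.
Proof.
move=> h; apply: (sorted_ltn_nth ltn_trans 0 (ones_sorted la)); rewrite ?inE ?size_ones; lia.
Qed.

Lemma lam_range la i : (i < n)%N -> (0 < lam la i <= l)%N.
Proof.
move=> iN; have : lam la i \in ones la by rewrite mem_nth ?size_ones.
by rewrite mem_ones => /andP[].
Qed.

Lemma lam_gt la i : (i < n)%N -> (i < lam la i)%N.
Proof.
elim: i => [|i IH] iN; first by have := lam_range la iN; lia.
by have := @lam_lt la i i.+1; have := IH (ltnW iN); lia.
Qed.

Lemma lam_bound la : is_bound n l (lam la).
Proof.
split=> [i iN|i i' h]; first by have := lam_gt la iN; have := lam_range la iN; lia.
by have [->|] := eqVneq i i'; [|have := @lam_lt la i i'; lia].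
Qed.

Lemma ones_inj la la' : ones la =i ones la' -> la = la'.
Proof.
move=> h; apply/val_inj/val_inj => /=; apply: (@eq_from_nth _ false).
  by rewrite !size_tuple.
move=> i; rewrite size_tuple => il.
by have := h i.+1; rewrite !mem_ones /= il.
Qed.

Lemma lam_inj la la' : (forall i, (i < n)%N -> lam la i = lam la' i) -> la = la'.
Proof.
move=> h; apply: ones_inj; suff -> : ones la = ones la' by [].
apply: (@eq_from_nth _ 0%N); first by rewrite !size_ones.
by move=> i; rewrite size_ones; exact: h.
Qed.

Lemma partn_of_seq x : uniq x -> size x = n -> (forall v, v \in x -> (0 < v <= l)%N) ->
  exists la, ones la =i x.
Proof.
move=> ux sx hx; pose t := [tuple (i.+1 \in x) | i < l].
have tE i : (i < l)%N -> nth false t i = (i.+1 \in x).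
  by move=> il; rewrite -[i]/(nat_of_ord (Ordinal il)) -tnth_nth tnth_mktuple.
have mt v : (0 < v <= l)%N && nth false t v.-1 = (v \in x).
  case: v => [|v] /=; first by apply/esym/negP => /hx.
  by have [vl|lv] := leqP v.+1 l; [rewrite tE | apply/esym/negP => /hx; lia].
have ct : count id t == n.
  rewrite -sx -(mkseq_nth false t) /mkseq count_map size_tuple.
  rewrite -size_filter -(size_map succn); apply/eqP/perm_size/uniq_perm => //.
    by rewrite map_inj_uniq ?filter_uniq ?iota_uniq // => a b [].
  move=> v; rewrite -mt; apply/mapP/idP => [[i]|].
    by rewrite mem_filter mem_iota => /andP[/= h1 h2] -> /=; rewrite h1 andbT; lia.
  case: v => // v /andP[vl /= h]; exists v => //.
  by rewrite mem_filter /= mem_iota h; lia.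
exists (exist _ t ct) => v; by rewrite mem_ones mt.
Qed.

Section Cells.
Context (J : nat -> nat).

(* The divisibility condition: then [ybound J n] divides [psic c * ylam la] on the left. *)
Definition allowed la (c : codeT n) : bool := [forall i : 'I_n, (lam la (i + cfun c i) <= J i)%N].
Definition cellT : Type := {u : Defs.partn n l * codeT n | allowed u.1 u.2}.
HB.instance Definition _ := Finite.on cellT.

Lemma allowedP la c : reflect (forall i, (i < n)%N -> (lam la (i + cfun c i) <= J i)%N) (allowed la c).
Proof.
apply: (iffP forallP) => h i; last exact: h.
by move=> iN; exact: (h (Ordinal iN)).
Qed.

Hypothesis hJ : is_bound n l J.

(** A box exponent becomes a sequence of distinct positions; its set of values is a partition and
    its Lehmer code a code. These two recover the sequence, and the sequence recovers the
    exponent. *)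
Lemma leq_card_box_cell : (#|{: boxT n l J}| <= #|{: cellT}|)%N.
Proof.
have [J1 J2] := hJ.
have bel (e : boxT n l J) : below n J (efun e) by move=> i iN; exact: efun_lt.
pose x e := inj_seq J (@efun n l J e) n.
pose P e (u : cellT) := ones (val u).1 =i x e /\
  forall i, (i < n)%N -> cfun (val u).2 i = lehmer (x e) i.
have /choice[F hF] : forall e, exists u, P e u.
  move=> e; have [u h] := inj_seqP (bel e) (leqnn n).
  have [|v|la hla] := partn_of_seq u; first exact: size_inj_seq.
    move=> /(nthP 0)[i]; rewrite size_inj_seq => iN <-.
    have /andP[-> h3] := h i iN; have /andP[_ h2] := J1 i iN; exact: leq_trans h3 h2.
  have [|c hc] := @code_ex n (lehmer (x e)).
    by move=> i iN; exact: (lehmer_lt J (efun e) iN).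
  have pla : perm_eq (ones la) (x e).
    apply: uniq_perm => //; apply: (sorted_uniq ltn_trans ltnn); exact: ones_sorted.
  have al : allowed la c.
    apply/allowedP => i iN; apply: sorted_nth_le.
      by apply: sub_sorted (ones_sorted la) => a b; exact: ltnW.
    by rewrite hc // (seq.permP pla); exact: count_inj_seq.
  by exists (exist _ (la, c) al).
apply: (@leq_card _ _ F) => e e' eF; apply: efun_inj.
have [h1 h2] := hF e; have [h3 h4] := hF e'; rewrite -eF in h3 h4.
have [u _] := inj_seqP (bel e) (leqnn n); have [u' _] := inj_seqP (bel e') (leqnn n).
apply: (inj_seq_inj (bel e) (bel e') (leqnn n)); apply: lehmer_inj.
  by apply: uniq_perm => // v; rewrite -/(x e) -/(x e') -h1 -h3.
by move=> i; rewrite size_inj_seq => iN; rewrite -/(x e) -/(x e') -h2 // -h4.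
Qed.

End Cells.

End Partitions.

(** * The cell basis *)

Section CellElements.
Context (k : fieldType) (n l : nat).
Local Notation NH := (nh k n l).
Local Notation R := {mpoly k[n]}.
Local Notation psiw := (psiw k n l).
Local Notation ymon := (ymon k n l).
Local Notation psic := (@psic k n l).
Local Notation partn := (Defs.partn n l).
Implicit Types (x z : NH) (f g : R) (s t : seq nat) (la ka : partn) (c : codeT n).

(** Lifts to the free algebra, where the action on polynomials is computed. *)
Definition fpsin (j : nat) : free_alg k n := if insub j is Some j' then fpsi k j' else 0.
Definition fword s : free_alg k n := \prod_(j <- s) fpsin j.
Definition fmon (e : nat -> nat) : free_alg k n := \prod_(i < n) fy k i ^+ e i.

Lemma nhpi_fword s : nhpi l (fword s) = psiw s.
Proof.
elim: s => [|j s IH]; first by rewrite /fword big_nil psiw_nil.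
rewrite /fword big_cons nhpiM -/(fword s) IH psiw_cons; congr (_ * _).
by rewrite /fpsin /psin; case: insub => [j'|] //; exact: raddf0.
Qed.

Lemma nhpi_fmon e : nhpi l (fmon e) = ymon n e.
Proof.
rewrite /fmon /ymon (big_morph (@nhpi k n l) (@nhpiM k n l) (@nhpi1 k n l)).
by apply: eq_bigr => i _; rewrite ynE /ynh rmorphXn.
Qed.

Lemma act_fword s f : act (fword s) f = dword s f.
Proof.
elim: s => [|j s IH]; first by rewrite /fword big_nil act1.
rewrite /fword big_cons actM -/(fword s) IH /= /dmzn /fpsin.
by case: insub => [j'|]; [exact: act_psi | exact: act0l].
Qed.

Lemma act_fmon e f : act (fmon e) f = Xmon k n e n 0 * f.
Proof.
rewrite /Xmon add0n big_mkord /fmon; elim/big_rec2: _ => [|i p q _ IH]; first by rewrite act1 mul1r.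
by rewrite actM IH act_yX XnE mulrA.
Qed.

Lemma star_fword s : free_star (fword s) = fword (rev s).
Proof.
elim: s => [|j s IH]; first by rewrite /fword big_nil free_star1.
rewrite rev_cons -cats1 /fword big_cat big_cons big_seq1 free_starM -!/(fword _) IH.
congr (_ * _); rewrite /fpsin; case: insub => [j'|]; first exact: free_star_gen.
exact: free_star0.
Qed.

Lemma nh_star_psiw s : nh_star (psiw s) = psiw (rev s).
Proof. by rewrite -!nhpi_fword nh_starE star_fword. Qed.

Lemma nh_starP a x z : nh_star (a *: x + z) = a *: nh_star x + nh_star z.
Proof.
elim/nhpi_ind: x => x; elim/nhpi_ind: z => z.
by rewrite -nhpiZ -nhpiD !nh_starE free_starP nhpiD nhpiZ.
Qed.

Lemma nh_starK x : nh_star (nh_star x) = x.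
Proof.
elim/nhpi_ind: x => x; rewrite !nh_starE; congr nhpi.
elim/free_ind: x => [|a x y IHx IHy|w]; first by rewrite !free_star0.
  by rewrite !free_starP IHx IHy.
by rewrite !free_star_mono revK.
Qed.

Lemma nh_star0 : nh_star (0 : NH) = 0.
Proof. by have := nh_starP (-1) 0 0; rewrite !scaleN1r !addNr. Qed.

Lemma nh_star_sum (I : finType) (C : I -> k) (F : I -> NH) :
  nh_star (\sum_i C i *: F i) = \sum_i C i *: nh_star (F i).
Proof.
elim/big_rec2: _ => [|i y x _ <-]; [exact: nh_star0 | exact: nh_starP].
Qed.

Lemma nh_star_ymon e : nh_star (ymon n e) = ymon n e.
Proof.
have : forall r, (r <= n)%N -> nh_star (ymon r e) = ymon r e; last exact.
elim=> [|r IH] rn; first by rewrite ymon0 -psiw_nil nh_star_psiw.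
have sy : nh_star (yn k n l r) = yn k n l r.
  by have := ynE k l (Ordinal rn) => /= ->; exact: nh_star_y.
have sX a : nh_star (yn k n l r ^+ a) = yn k n l r ^+ a.
  elim: a => [|a IHa]; first by rewrite expr0 -psiw_nil nh_star_psiw.
  by rewrite exprS nh_starM IHa sy -exprSr exprS.
by rewrite ymonS nh_starM sX (IH (ltnW rn)) ynX_ymon.
Qed.

Definition bla la (i : 'I_n) : nat := (l - lam la i)%N.

Lemma bla_lt la i : (bla la i < l)%N.
Proof. by have := lam_range la (ltn_ord i); rewrite /bla; lia. Qed.

Lemma bla_inj la : injective (bla la).
Proof.
move=> i j; rewrite /bla => h; apply: val_inj => /=.
have := lam_range la (ltn_ord i); have := lam_range la (ltn_ord j).
have [||//] := ltngtP i j => ij.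
  by have := @lam_lt _ _ la i j; have := ltn_ord j; lia.
by have := @lam_lt _ _ la j i; have := ltn_ord i; lia.
Qed.

Lemma ylamE la : ylam k la = ymon n (fun i => l - lam la i)%N.
Proof. by apply: eq_bigr => i _; rewrite ynE. Qed.

Lemma ylam_ybound la : ylam k la = ybound k n l (lam la) n.
Proof. exact: ylamE. Qed.

Lemma nh_star_ylam la : nh_star (ylam k la) = ylam k la.
Proof. by rewrite ylamE nh_star_ymon. Qed.

Definition sumlam la : nat := (\sum_(i < n) lam la i)%N.

Local Notation coef la := (mcoef (bla la)).

(** Adjointness moves [x] to [f] and lets [z] act on [g], leaving a multiple of the monomial of
    [ka]. If [tau] sees it, some permutation satisfies [lam la (s i) <= lam ka i] for all [i]; equal
    sums then force equal sets of positions. *)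
Lemma coef_neq0 la ka f g x z : coef la f g (x * ylam k ka * z) != 0 ->
  ka = la \/ (sumlam la < sumlam ka)%N.
Proof.
elim/nhpi_ind: x => x; elim/nhpi_ind: z => z.
rewrite ylamE -nhpi_fmon -!nhpiM mcoefE; last exact: bla_lt.
rewrite -mulrA actM tau_act actM act_fmon mulrCA XmonE => /tau_mono_neq0[s hs].
have le i : (lam la (s i) <= lam ka i)%N.
  have := hs i; rewrite mnmE /bla.
  by have := lam_range la (ltn_ord (s i)); have := lam_range ka (ltn_ord i); lia.
have sE : sumlam la = (\sum_(i < n) lam la (s i))%N by rewrite /sumlam (reindex_inj (@perm_inj _ s)).
have [lt|ge] := ltnP (sumlam la) (sumlam ka); [by right | left].
have eq := sum_leq_eq le; rewrite sE in ge; move: {eq}(eq ge) => eq.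
apply: ones_inj => v; apply/idP/idP => /(nthP 0%N)[i]; rewrite size_ones => iN <-.
  by have := eq (Ordinal iN) => /= e; rewrite -[nth _ _ _]e mem_nth // size_ones.
have := eq ((s^-1)%g (Ordinal iN)); rewrite permKV => e.
by rewrite -[nth _ _ _]/(lam la (Ordinal iN)) e mem_nth // size_ones.
Qed.

Definition cval c f : k := (dword (rev (code_word (cfun c) n 0)) f)@_0%MM.

(** On multiples of the monomial of [la] the functional is the constant term of the cofactor, which
    is multiplicative; so the two codes separate. *)
Lemma coef_cell la c c' f g :
  coef la f g (psic c * ylam k la * nh_star (psic c')) = cval c f * cval c' g.
Proof.
rewrite /psic nh_star_psiw ylamE -!nhpi_fword -nhpi_fmon -!nhpiM mcoefE; last exact: bla_lt.
rewrite -mulrA actM tau_act actM act_fmon star_fword !act_fword mulrCA XmonE.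
by rewrite tau_self ?ev0M //; exact: bla_inj.
Qed.

Lemma cval_triangular c : exists f, cval c f != 0 /\
  forall c', cval c' f != 0 -> c' = c \/ (lexw n n (cfun c) < lexw n n (cfun c'))%N.
Proof.
(* The test polynomial is the monomial whose exponents are the digits of [c]. *)
exists (Xmon k n (cfun c) n 0); split.
  rewrite /cval ev0_code ?oner_eq0 // => j hj.
  by have := cfun_code c; move/(_ j hj).
move=> c' nz; have [h|] := pselect (forall i, (i < n)%N -> cfun c' i = cfun c i).
  by left; exact: cfun_inj.
move=> /existsNP[i hi]; right.
have [|d [dn eqd ned]] := @first_diff n (cfun c) (cfun c').
  by exists i; [have [//|h] := ltnP i n; case: hi; lia | apply/eqP => e; case: hi].
have [lt|gt|e] := ltngtP (cfun c d) (cfun c' d); last by rewrite e eqxx in ned.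
  apply: lexw_lt dn _ eqd lt => i' i'n; have := @cfun_code n c i'; lia.
case/negP: nz; apply/eqP; apply: (@ev0_code_lt k n _ _ n 0 d) => //.
  by move=> j hj; have := @cfun_code n c' j hj.
by move=> j hj; rewrite eqd.
Qed.

(** The values are products, so the triangular argument applies to each of the two codes in turn. *)
Lemma coef_free la (C : codeT n -> codeT n -> k) :
  (forall f g, \sum_c \sum_c' C c c' * (cval c f * cval c' g) = 0) ->
  forall c c', C c c' = 0.
Proof.
move=> h c c'; apply: (triangular_free (a := cval) cval_triangular) => g.
pose D c0 := \sum_c' C c0 c' * cval c' g.
apply: (triangular_free (C := D) (a := cval) cval_triangular) => f; rewrite -[RHS](h f g).
apply: eq_bigr => c0 _; rewrite mulr_suml; apply: eq_bigr => c1 _.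
by rewrite -!mulrA [cval c1 g * _]mulrC.
Qed.

Definition cellB (u : partn * codeT n * codeT n) : NH :=
  psic u.1.2 * ylam k u.1.1 * nh_star (psic u.2).

Lemma cellBE la c c' : cellB (la, c, c') = psic c * ylam k la * nh_star (psic c').
Proof. by []. Qed.

(** Induction from the largest sum of positions: the functionals of [la] see only [la] and
    partitions of larger sum, whose coefficients already vanish. *)
Lemma cellB_free : free_fam cellB.
Proof.
move=> C C0; suff h la : forall c c', C (la, c, c') = 0 by case=> [[la c] c'].
pose K := \max_(la : partn) sumlam la.
have [m] := ubnP (K - sumlam la); elim: m la => // m IH la lem.
apply: (coef_free la) => f g.
have := congr1 (coef la f g) C0; rewrite (mcoef_sum (@bla_lt la)) (mcoef0 (@bla_lt la)).
rewrite (bigID (fun u : partn * codeT n * codeT n => u.1.1 == la)) /=.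
rewrite [X in _ + X]big1 ?addr0 => [|[[ka c] c'] /= ne]; last first.
  have [->|nz] := eqVneq (coef la f g (cellB (ka, c, c'))) 0; first by rewrite mulr0.
  have [e|lt] := coef_neq0 nz; first by rewrite (e : ka = la) eqxx in ne.
  move: lt => /= lt; rewrite IH ?mul0r //; have := @leq_bigmax _ sumlam ka; rewrite -/K; lia.
move=> h; rewrite pair_big /= -[RHS]h.
rewrite [RHS](reindex_onto (fun q : codeT n * codeT n => (la, q.1, q.2))
  (fun u => (u.1.2, u.2))) /=.
  by apply: eq_big => [[c c']|[c c'] _] /=; rewrite ?eqxx // coef_cell.
by move=> [[ka c] c'] /= /eqP ->.
Qed.

End CellElements.

(** * Cell bases of right ideals and of morphism spaces *)

Section CellBasis.
Context (k : fieldType) (n l : nat).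
Hypothesis hnl : (n <= l)%N.
Local Notation NH := (nh k n l).
Local Notation ymon := (ymon k n l).
Local Notation psic := (@psic k n l).
Local Notation partn := (Defs.partn n l).
Local Notation cellB := (@cellB k n l).
Local Notation ybound := (ybound k n l).
Implicit Types (x z : NH) (la ka mu nu : partn) (c : codeT n).

(** Stated through coefficients that vanish off [Q], so that two support conditions on one element
    can be intersected by uniqueness of the coefficients. *)
Definition supported (Q : partn * codeT n * codeT n -> bool) x : Prop :=
  exists C : partn * codeT n * codeT n -> k,
    (forall u, ~~ Q u -> C u = 0) /\ x = \sum_u C u *: cellB u.

Lemma supportedP Q a x z : supported Q x -> supported Q z -> supported Q (a *: x + z).
Proof.
move=> [C [C0 ->]] [D [D0 ->]]; exists (fun u => a * C u + D u); split.
  by move=> u Qu; rewrite C0 // D0 // mulr0 addr0.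
by rewrite scaler_sumr -big_split; apply: eq_bigr => u _; rewrite scalerDl scalerA.
Qed.

Lemma supported0 Q : supported Q 0.
Proof. by exists (fun=> 0); split=> //; rewrite big1 // => u _; rewrite scale0r. Qed.

Lemma supported_cell (Q : partn * codeT n * codeT n -> bool) u : Q u -> supported Q (cellB u).
Proof.
move=> Qu; exists (fun v => (v == u)%:R); split.
  by move=> v; case: eqP => // ->; rewrite Qu.
rewrite (bigD1 u) //= eqxx scale1r big1 ?addr0 // => v /negPf ->.
by rewrite scale0r.
Qed.

Lemma supported_span (T : finType) (b : T -> NH) Q x :
  (forall t, supported Q (b t)) -> in_span b x -> supported Q x.
Proof.
move=> h [C ->]; elim/big_rec: _ => [|t y _ IH]; first exact: supported0.
exact: supportedP.
Qed.

Section Bound.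
Context (J : nat -> nat) (hJ : is_bound n l J).

Lemma psic_ylam_divides la c : allowed J la c -> exists z, psic c * ylam k la = ybound J n * z.
Proof.
have [J1 J2] := hJ; move=> /allowedP al.
have [||||v vn|z hz] := @code_ymon_lower k n l (fun i => l - J i)%N (cfun c) n 0
    (fun i => l - lam la i)%N 1 (add0n n).
- exact: cfun_code.
- move=> v v' h; have [_ m] := lam_bound la; have := m v v' h; lia.
- by move=> v v' h; have := J2 v v' h; lia.
- by [].
- by have := al v; lia.
by exists z; rewrite ylamE -[ymon _ _]mulr1 hz.
Qed.

Let bJ (w : cellT n l J * codeT n) : NH := cellB (val w.1, w.2).
Let uJ (w : boxT n l J * codeT n) : NH := ybound J n * ymon n (efun w.1) * psic w.2.

Lemma bJ_free : free_fam bJ.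
Proof.
move=> C C0 [w c'].
(* The coefficients are extended by zero to all cell elements. *)
pose D u : k := if insub u.1 is Some w' then C (w' : cellT n l J, u.2) else 0.
have D0 : \sum_u D u *: cellB u = 0.
  rewrite (bigID (fun u : partn * codeT n * codeT n => allowed J u.1.1 u.1.2)) /=.
  rewrite [X in _ + X]big1 ?addr0; last first.
    by move=> u nu; rewrite /D insubN ?scale0r.
  rewrite -[RHS]C0 (reindex_onto (fun w : cellT n l J * codeT n => (val w.1, w.2))
    (fun u => if insub u.1 is Some w' then (w', u.2) else (w, u.2))) /=.
    apply: eq_big => [[w1 c1]|[w1 c1] _] /=; last by rewrite /D /= valK.
    by rewrite valK (valP w1) eqxx.
  by move=> [u1 u2] /= al; rewrite insubT.
by have := cellB_free D0 (val w, c'); rewrite /D /= valK.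
Qed.

Lemma bJ_span w : in_span uJ (bJ w).
Proof.
case: w => w c'; have [z hz] := psic_ylam_divides (valP w).
by rewrite /bJ (surjective_pairing (val w)) cellBE hz -mulrA; exact: ybound_in_span.
Qed.

(** The cell elements are free, lie in the span of the normal forms and are at least as numerous; so
    each family spans the other and the normal forms are free too. *)
Lemma ybound_basis : (forall s, in_span bJ (uJ s)) /\ free_fam uJ.
Proof.
apply: free_spans; [|exact: bJ_free|exact: bJ_span].
by rewrite !card_prod leq_mul2r leq_card_box_cell ?orbT.
Qed.

Lemma ybound_supported x : supported (fun u => allowed J u.1.1 u.1.2) (ybound J n * x).
Proof.
have [sp _] := ybound_basis.
have : in_span bJ (ybound J n * x).
  by apply: in_span_trans (ybound_in_span hJ x) => s; exact: sp.
apply: supported_span => -[w c']; apply: supported_cell; exact: (valP w).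
Qed.

End Bound.

Lemma nh_star_cellB la c c' : nh_star (cellB (la, c, c')) = cellB (la, c', c).
Proof. by rewrite !cellBE !nh_starM nh_starK nh_star_ylam mulrA. Qed.

(** Left divisibility restricts the first code, and right divisibility, seen on [nh_star z],
    restricts the second; as the cell elements are free, the two expansions have the same
    coefficients. *)
Lemma hom_supported mu nu z : (exists h, z = ylam k mu * h) -> (exists h, z = h * ylam k nu) ->
  supported (fun u => allowed (lam mu) u.1.1 u.1.2 && allowed (lam nu) u.1.1 u.2) z.
Proof.
move=> [h zE] [h' zE'].
have [C [C0 CE]] := ybound_supported (lam_bound mu) h; rewrite -ylam_ybound -zE in CE.
have [D [D0 DE]] := ybound_supported (lam_bound nu) (nh_star h').
have {}DE : z = \sum_u D (u.1.1, u.2, u.1.2) *: cellB u.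
  rewrite -[LHS]nh_starK zE' nh_starM nh_star_ylam ylam_ybound DE nh_star_sum.
  rewrite (reindex_inj (h := fun u : partn * codeT n * codeT n => (u.1.1, u.2, u.1.2))) /=.
    by apply: eq_bigr => -[[la c] c'] _ /=; rewrite nh_star_cellB.
  by move=> [[la c] c'] [[la1 c1] c1'] /= [-> -> ->].
have CD u : C u = D (u.1.1, u.2, u.1.2).
  apply/eqP; rewrite -subr_eq0; apply/eqP.
  apply: (cellB_free (c := fun u => C u - D (u.1.1, u.2, u.1.2))).
  under eq_bigr => v _ do rewrite scalerBl.
  by rewrite sumrB -CE -DE subrr.
exists C; split=> // u; rewrite negb_and => /orP[] nu'; first exact: C0.
by rewrite CD D0.
Qed.

(** * Double annihilators *)

Section DoubleAnnihilator.
Let L : nat -> nat := fun=> l.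

Lemma const_bound : is_bound n l L.
Proof. by split=> [i iN|//]; rewrite /L leqnn andbT; lia. Qed.

Lemma ybound_const r : ybound L r = 1.
Proof. by rewrite -(ymon_eq0 k n l r); apply: eq_ymon => i _; rewrite /L subnn. Qed.

Local Notation E := (boxT n l L).
Local Notation P := (lspan (@poly_gen k n l n)).
Let v (e : E) : NH := ymon n (efun e).

Lemma poly_comm x z : P x -> P z -> x * z = z * x.
Proof.
move=> hx hz; elim: hx => [|a y x' [e ->] _ IH]; first by rewrite mul0r mulr0.
rewrite mulrDl mulrDr IH -nh_scalerAl -nh_scalerAr; congr (_ *: _ + _).
elim: hz => [|b y' z' [e' ->] _ IHz]; first by rewrite mul0r mulr0.
by rewrite mulrDl mulrDr IHz -nh_scalerAl -nh_scalerAr ymon_ymon.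
Qed.

Lemma poly_ymon e : P (ymon n e). Proof. by apply: lspan_mem; exists e. Qed.

Lemma poly_span x : P x -> in_span v x.
Proof.
move=> /(lspan_red const_bound (leqnn n)); rewrite ybound_const mul1r.
apply: lspan_in_span => _ [e [he ->]]; have [e' ee] := box_ex const_bound he.
rewrite ybound_const mul1r; have -> : ymon n e = v e' by apply: eq_ymon => i iN; rewrite ee.
exact: in_span_mem.
Qed.

Let d (i : 'I_n) : nat := (l.-1 - i)%N.
Let d_lt i : (d i < l)%N.
Proof. by rewrite /d; have := ltn_ord i; lia. Qed.
Let t : NH -> k := mcoef d 1 1.

Let tP a x z : t (a *: x + z) = a * t x + t z.
Proof. exact: (mcoefP d_lt). Qed.

Let t0 : t 0 = 0.
Proof. exact: (mcoef0 d_lt). Qed.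

Let t_sum (I : finType) (C : I -> k) (F : I -> NH) :
  t (\sum_i C i *: F i) = \sum_i C i * t (F i).
Proof. exact: (mcoef_sum d_lt). Qed.

Lemma trace_ymon e e' : t (ymon n e * ymon n e') = tau d (Xmon k n e n 0 * Xmon k n e' n 0).
Proof.
rewrite /t -!nhpi_fmon -nhpiM (mcoefE d_lt).
by rewrite actM !act_fmon mul1r mulr1.
Qed.

(* Complementary exponents make the Gram matrix of the monomials unitriangular, so the
   trace form is nondegenerate. *)
Lemma trace_nondegenerate x : P x -> (forall z, P z -> t (x * z) = 0) -> x = 0.
Proof.
move=> /poly_span[C ->] h; apply: big1 => e _; rewrite [C e](_ : _ = 0) ?scale0r //.
pose w (e : E) := lexw l.+1 n (fun i => l - efun e i)%N.
have bnd (e1 : E) i : (i < n)%N -> (i + efun e1 i < l)%N.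
  by move=> iN; have := efun_lt e1 iN; rewrite /L; lia.
apply: (triangular_free (a := fun (e : E) f => t (v e * ymon n f)) (w := w)) => [e1|f].
  exists (fun i => l.-1 - i - efun e1 i)%N; split.
    by rewrite /v trace_ymon (@gram_self k n l _ _ (bnd e1)) ?oner_eq0.
  move=> e2; rewrite /v trace_ymon => /(gram_neq0 (bnd e1))[h1|[i [iN eqi lti]]].
    by left; exact: efun_inj.
  right; apply: (lexw_lt (i := i)) => [//|i' i'n|i' i'i|]; first lia.
    by rewrite eqi.
  by have := bnd e1 i iN; lia.
rewrite -[RHS](h (ymon n f) (poly_ymon f)) mulr_suml.
under [in RHS]eq_bigr => e1 _ do rewrite -nh_scalerAl.
by rewrite t_sum.
Qed.

Lemma poly_mul x z : P x -> P z -> P (x * z).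
Proof. exact: lspan_poly_mul. Qed.

(** By nondegeneracy, [p = a * q] amounts to the linear system [t (a * q * x) = t (p * x)] for all
    monomials [x] of the spanning family. A column of the cokernel matrix gives a polynomial [g]
    with [a * g = 0], hence [p * g = 0] by assumption, and so the system is solvable. *)
Lemma ann_ann a p : P a -> P p -> (forall g, P g -> a * g = 0 -> p * g = 0) ->
  exists2 q, P q & p = a * q.
Proof.
move=> Pa Pp h; have Pv e : P (v e) by exact: poly_ymon.
pose Lm : 'M[k]_#|{: E}| := \matrix_(i, j) t (a * v (enum_val i) * v (enum_val j)).
pose xi : 'rV[k]_#|{: E}| := \row_j t (p * v (enum_val j)).
have Psum (I : finType) (C : I -> k) (F : I -> NH) : (forall i, P (F i)) -> P (\sum_i C i *: F i).
  by move=> hF; apply: lspan_sum => i _; exact: lspanZ.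
have tmul x (C : 'I_#|{: E}| -> k) : t (x * \sum_j C j *: v (enum_val j)) =
    \sum_j C j * t (x * v (enum_val j)).
  rewrite mulr_sumr; under eq_bigr => j _ do rewrite -nh_scalerAr.
  exact: t_sum.
have : (xi <= Lm)%MS.
  rewrite submxE; apply/eqP/rowP => j0; rewrite mxE [RHS]mxE.
  pose g := \sum_j cokermx Lm j j0 *: v (enum_val j).
  have Pg : P g by apply: Psum.
  have ag : a * g = 0.
    apply: trace_nondegenerate; first exact: poly_mul.
    move=> z /poly_span[C ->]; rewrite mulr_sumr.
    under eq_bigr => e _ do rewrite -nh_scalerAr.
    rewrite t_sum big1 // => e _; rewrite -[X in _ * X](_ : 0 = _) ?mulr0 //.
    rewrite -mulrA (poly_comm Pg (Pv e)) mulrA tmul.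
    have := congr1 (fun M : 'M_ _ => M (enum_rank e) j0) (mulmx_coker Lm).
    rewrite !mxE => e0; rewrite -[LHS]e0; apply: eq_bigr => j _.
    by rewrite mxE enum_rankK mulrC.
  have := congr1 t (h g Pg ag); rewrite t0 tmul => e0; rewrite -[RHS]e0.
  by apply: eq_bigr => j _; rewrite mxE mulrC.
move=> /submxP[al xiE].
pose q := \sum_i al 0 i *: v (enum_val i).
have Pq : P q by apply: Psum.
exists q => //; apply: subr0_eq; apply: trace_nondegenerate.
  by apply: lspanD => //; apply: lspanN; exact: poly_mul.
move=> z /poly_span[C ->]; rewrite mulr_sumr.
under eq_bigr => e _ do rewrite -nh_scalerAr.
rewrite t_sum big1 // => e _; rewrite [X in _ * X](_ : _ = 0) ?mulr0 //.
rewrite mulrBl -mulrA (poly_comm Pq (Pv e)) mulrA.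
have tB x y : t (x - y) = t x - t y.
  by rewrite addrC -scaleN1r tP mulN1r addrC.
rewrite tB tmul.
have := congr1 (fun M : 'rV_ _ => M 0 (enum_rank e)) xiE; rewrite !mxE enum_rankK => ->.
apply/eqP; rewrite subr_eq0; apply/eqP; apply: eq_bigr => j _.
by rewrite mxE enum_rankK -!mulrA (poly_comm (Pv (enum_val j)) (Pv e)).
Qed.

(** [m] is a combination of the elements [nh_star (psic c)] with polynomial right coefficients
    [p c]. A polynomial [g] with [ylam k nu * g = 0] kills [m], hence each [p c] by freeness of the
    normal forms, and [ann_ann] then divides [p c] by [ylam k nu]. *)
Lemma double_annihilator nu m : (forall z, ylam k nu * z = 0 -> m * z = 0) ->
  exists h, m = h * ylam k nu.
Proof.
move=> hm; have [_ fr] := ybound_basis const_bound.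
have Py : P (ylam k nu) by rewrite ylamE; exact: poly_ymon.
have [C CE] := ybound_in_span const_bound (nh_star m).
have e1 : ybound L n * nh_star m = nh_star m by rewrite ybound_const mul1r.
rewrite e1 in CE.
pose p c := \sum_e C (e, c) *: v e.
have sE (D : E * codeT n -> k) : nh_star (\sum_u D u *: (ybound L n * ymon n (efun u.1) * psic u.2)) =
    \sum_c nh_star (psic c) * \sum_e D (e, c) *: v e.
  rewrite nh_star_sum.
  under [RHS]eq_bigr => c _ do (rewrite mulr_sumr; under eq_bigr => e _ do rewrite -nh_scalerAr).
  rewrite exchange_big pair_bigA /=; apply: eq_bigr => -[e c] _ /=.
  by rewrite ybound_const mul1r nh_starM nh_star_ymon.
have mE : m = \sum_c nh_star (psic c) * p c.
  by rewrite -[LHS]nh_starK CE sE.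
have Pp c : P (p c) by apply: lspan_sum => e _; apply: lspanZ; exact: poly_ymon.
have pz c g : P g -> ylam k nu * g = 0 -> p c * g = 0.
  move=> Pg /hm; rewrite mE mulr_suml => e0.
  have /choice[D DE] : forall c, exists D : E -> k, p c * g = \sum_e D e *: v e.
    by move=> c'; apply: poly_span; exact: poly_mul.
  have D0 : forall u : E * codeT n, D u.2 u.1 = 0.
    apply: (fr (fun u => D u.2 u.1)).
    rewrite -[LHS]nh_starK; apply: etrans (congr1 (@nh_star k n l) (sE (fun u => D u.2 u.1))) _ => /=.
    under eq_bigr => c' _ do rewrite -DE mulrA.
    by rewrite e0 nh_star0.
  by rewrite DE big1 // => e _; rewrite (D0 (e, c)) scale0r.
have /choice[q qE] : forall c, exists q, P q /\ p c = ylam k nu * q.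
  by move=> c; have [q Pq e] := ann_ann Py (Pp c) (pz c); exists q.
exists (\sum_c nh_star (psic c) * q c); rewrite mulr_suml mE; apply: eq_bigr => c _.
by have [Pq ->] := qE c; rewrite (poly_comm Py Pq) mulrA.
Qed.

End DoubleAnnihilator.

End CellBasis.

(** * Grading and nilpotent differential on the nilHecke algebra *)

Section NilHeckeGraded.
Context (k : fieldType) (p : nat) (n l : nat).
Hypothesis hp : p \in [pchar k].
Local Notation NH := (nh k n l).
Implicit Types (x z : NH).

Lemma nh_grading : is_grading (@nh_deg k n l).
Proof. exact: (quot_grading (V := free_dga k n) (@free_grading k n) (@nh_ideal_graded k n l)). Qed.

Lemma nh_deg_sub i : nh_deg i (0 : NH) /\
  forall c x z, nh_deg i x -> nh_deg i z -> nh_deg i (c *: x + z).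
Proof. by have [h _ _] := nh_grading; exact: h. Qed.

Lemma nh_degP i x : nh_deg i x <-> exists2 y, free_deg i y & x = nhpi l y.
Proof. by []. Qed.

Lemma nh_degM i j x z : nh_deg i x -> nh_deg j z -> nh_deg (i + j) (x * z).
Proof.
move=> /nh_degP[a ha ->] /nh_degP[b hb ->]; apply/nh_degP; exists (a * b); first exact: free_degM.
by rewrite nhpiM.
Qed.

Lemma nh_deg1 : nh_deg 0 (1 : NH).
Proof. by apply/nh_degP; exists 1; [exact: free_deg1 | rewrite nhpi1]. Qed.

Lemma nh_deg_d i x : nh_deg i x -> nh_deg (i + 2) (nh_d x).
Proof.
move=> /nh_degP[a ha ->]; apply/nh_degP; exists (free_d a); first exact: free_deg_d.
exact: nh_dE.
Qed.

Lemma nh_deg_star i x : nh_deg i x -> nh_deg i (nh_star x).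
Proof.
move=> /nh_degP[a ha ->]; apply/nh_degP; exists (free_star a); first exact: free_deg_star.
exact: nh_starE.
Qed.

Lemma nh_deg_y i : nh_deg 2 (yn k n l i).
Proof.
rewrite /yn; case: insub => [i'|]; last exact: (nh_deg_sub 2).1.
by apply/nh_degP; exists (fy k i') => //; exact: free_deg_y.
Qed.

Lemma nh_degX i x m : nh_deg i x -> nh_deg (i *+ m) (x ^+ m).
Proof.
move=> hx; elim: m => [|m IH]; first by rewrite mulr0n expr0; exact: nh_deg1.
by rewrite exprS mulrS; exact: nh_degM.
Qed.

Lemma nh_deg_ymon r (e : nat -> nat) : nh_deg (\sum_(i < r) 2 *+ e i) (ymon k n l r e).
Proof.
elim: r => [|r IH]; first by rewrite big_ord0 ymon0; exact: nh_deg1.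
by rewrite big_ord_recr ymonS; apply: nh_degM => //; exact/nh_degX/nh_deg_y.
Qed.

Lemma nh_mulrn_pchar x : x *+ p = 0.
Proof. by rewrite -scaler_nat (pcharf0 hp) scale0r. Qed.

Lemma nh_d1 : nh_d (1 : NH) = 0.
Proof. by rewrite -(@nhpi1 k n l) nh_dE free_d1 (raddf0 (@nhpi k n l)). Qed.

Lemma nh_dD : {morph @nh_d k n l : x z / x + z}.
Proof. by move=> x z; exact: raddfD. Qed.

Lemma nh_d0 : nh_d (0 : NH) = 0. Proof. exact: raddf0. Qed.

Lemma iter_nh_dM x z :
  iter p (@nh_d k n l) (x * z) = iter p (@nh_d k n l) x * z + x * iter p (@nh_d k n l) z.
Proof.
apply: (iter_leibniz_pchar (m := fun a b : NH => a * b)).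
- exact: nh_dD.
- exact: nh_dM.
- exact: pcharf_prime hp.
- exact: nh_mulrn_pchar.
Qed.

Lemma iter_nh_d_y (i : 'I_n) r : iter r (@nh_d k n l) (ynh k l i) = ynh k l i ^+ r.+1 *+ r`!.
Proof.
have dX m : nh_d (ynh k l i ^+ m) = ynh k l i ^+ m.+1 *+ m.
  elim: m => [|m IH]; first by rewrite expr0 nh_d1.
  by rewrite exprS nh_dM IH nh_d_y -exprD mulrnAr -exprS -mulrS.
elim: r => [|r IH]; first by rewrite fact0 expr1.
by rewrite iterS IH raddfMn /= dX -mulrnA -factS.
Qed.

Lemma nh_d2_psi (j : 'I_n.-1) : nh_d (nh_d (psinh k l j)) =
  (ynh k l (lo j) * psinh k l j * ynh k l (hi j)) *+ 2 /\
  nh_d (ynh k l (lo j) * psinh k l j * ynh k l (hi j)) = 0.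
Proof.
set a := ynh k l (lo j); set b := ynh k l (hi j); set s := psinh k l j.
have da : nh_d a = a * a by rewrite nh_d_y expr2.
have db : nh_d b = b * b by rewrite nh_d_y expr2.
have ds : nh_d s = - (a * s) - s * b by exact: nh_d_psi.
have d1 : nh_d (a * s) = - (a * s * b).
  by rewrite nh_dM da ds mulrBr mulrN !mulrA addrA subrr add0r.
have d2 : nh_d (s * b) = - (a * s * b).
  by rewrite nh_dM db ds mulrBl mulNr !mulrA subrK.
split; last by rewrite nh_dM d1 db mulNr -!mulrA addNr.
by rewrite ds raddfB raddfN /= d1 d2 !opprK mulr2n.
Qed.

(** The [p]-th iterate is a derivation, so generators suffice: on [ynh k l i] it produces the factor
    [p!], and on [psinh k l j] the third iterate is zero while the second has the factor 2, which
    settles characteristic 2. *)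
Lemma iter_nh_d x : iter p (@nh_d k n l) x = 0.
Proof.
have iD : {morph iter p (@nh_d k n l) : u v / u + v}.
  by move=> u v; elim: p => //= r ->; exact: nh_dD.
have i0 : iter p (@nh_d k n l) 0 = 0 by elim: p => //= r ->; exact: nh_d0.
have pp : prime p := pcharf_prime hp.
elim/nhpi_ind: x => x; elim/free_ind: x => [|c x z IHx IHz|w].
- by rewrite (raddf0 (@nhpi k n l)).
- rewrite nhpiD nhpiZ iD IHz addr0.
  have iZ u : iter p (@nh_d k n l) (c *: u) = c *: iter p (@nh_d k n l) u.
    by elim: p => //= r ->; rewrite linearZ_LR.
  by rewrite iZ IHx scaler0.
elim: w => [|g w IH].
  rewrite mono1 nhpi1; case: p pp => // r _; rewrite iterSr.
  rewrite nh_d1; by elim: r => //= r ->; exact: nh_d0.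
have -> : mono k (g :: w) = mono k [:: g] * mono k w by exact: (monoM k [:: g] w).
rewrite nhpiM iter_nh_dM IH mulr0 addr0 (_ : iter _ _ _ = 0) ?mul0r //.
case: g => [i|j].
  rewrite (iter_nh_d_y i) -[p in p`!]prednK ?prime_gt0 // factS mulrnA prednK ?prime_gt0 //.
  by rewrite nh_mulrn_pchar mul0rn.
have [h1 h2] := nh_d2_psi j; have [p2|p2] := eqVneq p 2%N.
  have -> : iter p (@nh_d k n l) (psinh k l j) = nh_d (nh_d (psinh k l j)) by rewrite p2.
  by rewrite h1 -p2 nh_mulrn_pchar.
have p3 : (2 < p)%N by rewrite ltn_neqAle eq_sym p2 prime_gt1.
have -> : p = ((p - 3) + 3)%N by rewrite subnK.
rewrite iterD /= h1 raddfMn /= h2 mul0rn.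
by elim: (p - 3)%N => //= r ->; exact: nh_d0.
Qed.

End NilHeckeGraded.

(** * The quiver Schur algebra *)

Section QuiverSchurAlgebra.
Context (k : fieldType) (p : nat) (n l : nat).
Hypotheses (hp : p \in [pchar k]) (hnl : (n <= l)%N).
Local Notation NH := (nh k n l).
Local Notation S := (qschur k n l).
Local Notation Mod := (qs_mod k n l).
Local Notation partn := (Defs.partn n l).
Local Notation gen := (@qs_gen k n l).
Implicit Types (x z : NH) (f g : S) (v : Mod) (mu nu la ka : partn).

Lemma qs_coord_act v h mu : qs_coord (qs_act v h) mu = qs_coord v mu * h.
Proof. by rewrite qs_coordK ffunE. Qed.

Lemma qs_coord_gen nu mu : qs_coord (gen nu) mu = if mu == nu then ylam k nu else 0.
Proof. by rewrite qs_coordK ffunE. Qed.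

Lemma qs_coord0 mu : qs_coord (0 : Mod) mu = 0.
Proof. by rewrite /qs_coord /= ffunE. Qed.

Lemma qs_mod_ext v v' : (forall mu, qs_coord v mu = qs_coord v' mu) -> v = v'.
Proof. by move=> h; apply: qs_coord_inj; apply/ffunP. Qed.

Lemma qs_funP f c v v' : f (c *: v + v') = c *: f v + f v'.
Proof. by have [h _] := qs_endP f; exact: h. Qed.

Lemma qs_fun_act f v h : f (qs_act v h) = qs_act (f v) h.
Proof. by have [_ e] := qs_endP f; exact: e. Qed.

Lemma qs_funD f v v' : f (v + v') = f v + f v'.
Proof. by have := qs_funP f 1 v v'; rewrite !scale1r. Qed.

Lemma qs_fun0 f : f 0 = 0.
Proof. by have := qs_funP f (-1) 0 0; rewrite !scaleN1r !addNr. Qed.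

Lemma qs_coord_sum (I : Type) (r : seq I) (P : pred I) (F : I -> Mod) mu :
  qs_coord (\sum_(i <- r | P i) F i) mu = \sum_(i <- r | P i) qs_coord (F i) mu.
Proof.
elim: r => [|i r IH]; first by rewrite !big_nil qs_coord0.
rewrite !big_cons; case: (P i) => //.
by rewrite -IH -[F i]scale1r qs_coordP !ffunE !scale1r.
Qed.

Definition ent f mu nu : NH := qs_coord (f (gen nu)) mu.

Lemma ent_ext f g : (forall mu nu, ent f mu nu = ent g mu nu) -> f = g.
Proof. by move=> h; apply: qs_mod_gen_ext => nu; apply: qs_mod_ext => mu; exact: h. Qed.

Lemma qs_fun_lin c f g v : (c *: f + g : S) v = c *: f v + g v.
Proof.
have e : val (c *: f + g) = c *: val f + val g by exact: linearP.
exact: (congr1 (fun F => F v) e).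
Qed.

Lemma entP c f g mu nu : ent (c *: f + g) mu nu = c *: ent f mu nu + ent g mu nu.
Proof. by rewrite /ent qs_fun_lin qs_coordP !ffunE. Qed.

Lemma ent0 mu nu : ent 0 mu nu = 0.
Proof. by have := entP (-1) 0 0 mu nu; rewrite !scaleN1r !addNr. Qed.

Lemma entD f g mu nu : ent (f + g) mu nu = ent f mu nu + ent g mu nu.
Proof. by have := entP 1 f g mu nu; rewrite !scale1r. Qed.

Lemma entZ c f mu nu : ent (c *: f) mu nu = c *: ent f mu nu.
Proof. by have := entP c f 0 mu nu; rewrite ent0 !addr0. Qed.

Lemma ent_sum (I : Type) (r : seq I) (P : pred I) (F : I -> S) mu nu :
  ent (\sum_(i <- r | P i) F i) mu nu = \sum_(i <- r | P i) ent (F i) mu nu.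
Proof.
elim: r => [|i r IH]; first by rewrite !big_nil ent0.
by rewrite !big_cons; case: (P i) => //; rewrite entD IH.
Qed.

(** The possible values at [ylam k nu] of morphisms from G(nu) to G(mu). *)
Definition in_hom mu nu x : Prop :=
  (exists h, x = ylam k mu * h) /\ (exists h, x = h * ylam k nu).

(** The value at the generator is killed on the right by all that kills [ylam k nu];
    [double_annihilator] turns this into divisibility. *)
Lemma ent_hom f mu nu : in_hom mu nu (ent f mu nu).
Proof.
split; first exact: qs_modP.
apply: double_annihilator => // z yz.
rewrite -qs_coord_act -qs_fun_act.
have -> : qs_act (gen nu) z = 0; last by rewrite qs_fun0 qs_coord0.
apply: qs_mod_ext => ka; rewrite qs_coord_act qs_coord_gen qs_coord0.
by case: eqP => _; rewrite ?mul0r.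
Qed.

Lemma in_hom0 mu nu : in_hom mu nu 0.
Proof. by split; exists 0; rewrite ?mulr0 ?mul0r. Qed.

Lemma in_hom_star mu nu x : in_hom mu nu x -> in_hom nu mu (nh_star x).
Proof.
move=> [[a ea] [b eb]]; split; first by exists (nh_star b); rewrite eb nh_starM nh_star_ylam.
by exists (nh_star a); rewrite ea nh_starM nh_star_ylam.
Qed.

(** The morphism is left multiplication by the matrix of cofactors [q], with
    [F mu nu = q mu nu * ylam k nu]; it lands in the module because [F mu nu] is also a right
    multiple of [ylam k mu]. *)
Lemma mk_ex (F : partn -> partn -> NH) : (forall mu nu, in_hom mu nu (F mu nu)) ->
  exists f : S, forall mu nu, ent f mu nu = F mu nu.
Proof.
move=> hF; have /choice[q0 q0E] : forall u : partn * partn, exists h, F u.1 u.2 = h * ylam k u.2.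
  by move=> u; have [_ h] := hF u.1 u.2.
pose q mu nu := q0 (mu, nu); have qE mu nu : F mu nu = q mu nu * ylam k nu by exact: (q0E (mu, nu)).
pose Fv v : {ffun partn -> NH} := [ffun mu => \sum_nu q mu nu * qs_coord v nu].
have hv v : in_qs_mod (Fv v).
  move=> mu; rewrite ffunE; have /choice[h hE] := qs_modP v.
  have /choice[a aE] : forall nu, exists a, F mu nu = ylam k mu * a by move=> nu; have [h1 _] := hF mu nu.
  exists (\sum_nu a nu * h nu); rewrite mulr_sumr; apply: eq_bigr => nu _.
  by rewrite hE mulrA -qE aE -mulrA.
pose f v := mk_qs_mod (hv v).
have fE : is_qs_end f.
  split=> [c v v'|v h]; apply: qs_coord_inj; rewrite ?qs_coordP !qs_coordK; apply/ffunP => mu.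
    rewrite !ffunE scaler_sumr -big_split; apply: eq_bigr => nu _.
    by rewrite qs_coordP !ffunE mulrDr -nh_scalerAr.
  rewrite !ffunE mulr_suml; apply: eq_bigr => nu _.
  by rewrite ffunE mulrA.
exists (mk_qschur fE) => mu nu; rewrite /ent.
have -> : qs_coord (mk_qschur fE (gen nu)) mu = \sum_ka q mu ka * qs_coord (gen nu) ka.
  by rewrite qs_coordK ffunE.
rewrite (bigD1 nu) //= qs_coord_gen eqxx -qE big1 ?addr0 // => ka /negPf ne.
by rewrite qs_coord_gen ne mulr0.
Qed.

Lemma act_coord f v h mu : (forall nu, qs_coord v nu = ylam k nu * h nu) ->
  qs_coord (f v) mu = \sum_nu ent f mu nu * h nu.
Proof.
move=> eh; have -> : v = \sum_nu qs_act (gen nu) (h nu).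
  apply: qs_mod_ext => ka; rewrite qs_coord_sum (bigD1 ka) //= qs_coord_act qs_coord_gen eqxx -eh.
  rewrite big1 ?addr0 // => nu ne; rewrite qs_coord_act qs_coord_gen eq_sym (negPf ne).
  by rewrite mul0r.
rewrite (big_morph _ (qs_funD f) (qs_fun0 f)) qs_coord_sum; apply: eq_bigr => nu _.
by rewrite qs_fun_act qs_coord_act.
Qed.

Local Notation A := (qschur_dga k n l).
Local Notation "f ** g" := (@dga_mul k A f g) (at level 40, left associativity).

Lemma mulE f g v : (f ** g : S) v = f (g v).
Proof. by []. Qed.

(** Entries compose with the generator of the middle summand divided out once: [ylam k ka] is a
    factor of both entries and appears once in the product. *)
Lemma ent_mul f g mu nu h : (forall ka, ent g ka nu = ylam k ka * h ka) ->
  ent (f ** g) mu nu = \sum_ka ent f mu ka * h ka.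
Proof. by move=> e; rewrite /ent mulE (act_coord f mu e). Qed.

Definition elem_spec (E : partn -> partn -> NH -> S) : Prop :=
  forall mu nu x, in_hom mu nu x -> forall mu' nu',
    ent (E mu nu x) mu' nu' = if (mu' == mu) && (nu' == nu) then x else 0.

Lemma elem_ex : exists E, elem_spec E.
Proof.
have /choice[E hE] : forall u : partn * partn * NH, exists f : S, in_hom u.1.1 u.1.2 u.2 ->
    forall mu' nu', ent f mu' nu' = if (mu' == u.1.1) && (nu' == u.1.2) then u.2 else 0.
  move=> [[mu nu] x] /=; have [h|h] := pselect (in_hom mu nu x); last by exists 0.
  have [|f fE] := @mk_ex (fun mu' nu' => if (mu' == mu) && (nu' == nu) then x else 0).
    by move=> mu' nu'; case: ifP => [/andP[/eqP -> /eqP ->] //|_]; exact: in_hom0.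
  by exists f.
by exists (fun mu nu x => E (mu, nu, x)) => mu nu x; exact: (hE (mu, nu, x)).
Qed.

(** The matrix unit with entry [x]; its value is unspecified when [x] is not the value of a
    morphism. *)
Definition elem : partn -> partn -> NH -> S := projT1 (cid elem_ex).

Lemma elemE mu nu x : in_hom mu nu x -> forall mu' nu',
  ent (elem mu nu x) mu' nu' = if (mu' == mu) && (nu' == nu) then x else 0.
Proof. by move=> h; rewrite /elem; case: cid => E hE /=; exact: hE. Qed.

Lemma elem_mul mu ka nu x z h : in_hom mu ka x -> in_hom ka nu z -> z = ylam k ka * h ->
  in_hom mu nu (x * h) -> elem mu ka x ** elem ka nu z = elem mu nu (x * h).
Proof.
move=> hx hz zE hxh; apply: ent_ext => mu' nu'; rewrite (elemE hxh).
rewrite (@ent_mul _ _ mu' nu' (fun ka' => if (ka' == ka) && (nu' == nu) then h else 0)); last first.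
  by move=> ka'; rewrite (elemE hz); case: ifP => [/andP[/eqP -> _] //|_]; rewrite mulr0.
rewrite (bigD1 ka) //= big1 ?addr0 => [|ka' /negPf ne]; last by rewrite ne mulr0.
by rewrite (elemE hx) eqxx andbT /=; case: eqP => _; case: eqP => _ /=; rewrite ?mul0r ?mulr0.
Qed.

Lemma sum_elem f : f = \sum_mu \sum_nu elem mu nu (ent f mu nu).
Proof.
apply: ent_ext => mu nu; rewrite ent_sum (bigD1 mu) //= ent_sum (bigD1 nu) //=.
rewrite (elemE (ent_hom f mu nu)) !eqxx /= !big1 ?addr0 // => [mu' ne|nu' ne].
  rewrite ent_sum big1 // => nu' _; rewrite (elemE (ent_hom f mu' nu')).
  by rewrite eq_sym (negPf ne).
by rewrite (elemE (ent_hom f mu nu')) [nu == _]eq_sym (negPf ne) andbF.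
Qed.

Lemma star_ex : exists star : S -> S, is_qs_star star.
Proof.
have /choice[star sE] : forall f, exists g : S, forall mu nu, ent g mu nu = nh_star (ent f nu mu).
  by move=> f; apply: mk_ex => mu nu; apply: in_hom_star; exact: ent_hom.
by exists star => f mu nu; exact: (sE f nu mu).
Qed.

Lemma nh_starD : {morph @nh_star k n l : x z / x + z}.
Proof. by move=> x z; have := nh_starP 1 x z; rewrite !scale1r. Qed.

Section Star.
Context (star : S -> S) (hs : is_qs_star star).

Lemma ent_star f mu nu : ent (star f) mu nu = nh_star (ent f nu mu).
Proof. exact: (hs f nu mu). Qed.

Lemma star_mul f g : star (f ** g) = star g ** star f.
Proof.
apply: ent_ext => mu nu; rewrite ent_star.
have /choice[h hE] : forall ka, exists h, ent g ka mu = ylam k ka * h.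
  by move=> ka; have [h _] := ent_hom g ka mu.
(* With cofactors on both sides, the entries of the product are sums of [q ka * ylam k ka * h ka],
   which [nh_star] reverses term by term. *)
have /choice[q qE] : forall ka, exists q, ent f nu ka = q * ylam k ka.
  by move=> ka; have [_ h'] := ent_hom f nu ka.
rewrite [in RHS](@ent_mul _ _ mu nu (fun ka => nh_star (q ka))); last first.
  by move=> ka; rewrite ent_star qE nh_starM nh_star_ylam.
rewrite (@ent_mul _ _ nu mu h) //.
rewrite (big_morph _ nh_starD (@nh_star0 k n l)); apply: eq_bigr => ka _.
by rewrite ent_star hE qE !nh_starM !nh_star_ylam mulrA.
Qed.

Lemma star_linear : linear star.
Proof.
by move=> c f g; apply: ent_ext => mu nu; rewrite entP !ent_star entP nh_starP.
Qed.

Lemma star_involutive : involutive star.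
Proof. by move=> f; apply: ent_ext => mu nu; rewrite !ent_star nh_starK. Qed.

End Star.

End QuiverSchurAlgebra.

(** * Grading and differential on the quiver Schur algebra *)

Section QuiverSchurGraded.
Context (k : fieldType) (p : nat) (n l : nat).
Hypotheses (hp : p \in [pchar k]) (hnl : (n <= l)%N).
Local Notation NH := (nh k n l).
Local Notation S := (qschur k n l).
Local Notation Mod := (qs_mod k n l).
Local Notation partn := (Defs.partn n l).
Local Notation gen := (@qs_gen k n l).
Local Notation A := (qschur_dga k n l).
Local Notation "f ** g" := (@dga_mul k A f g) (at level 40, left associativity).
Local Notation sh := (@shift_lam n l).
Implicit Types (x z : NH) (f g : S) (v : Mod) (mu nu la ka : partn).

Lemma shift_lamE la : sh la = \sum_(i < n) ((lam la i)%:Z - l%:Z).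
Proof.
rewrite /shift_lam sumrB addrC; congr (_ - _); last first.
  by rewrite sumr_const card_ord PoszM -natz mulr_natl.
by rewrite (big_nth 0%N) big_mkord size_ones.
Qed.

(** The shift is minus half the degree of [ylam k la]; this makes the degree condition on entries
    symmetric in source and target, so the anti-involution is homogeneous. *)
Lemma nh_deg_ylam la : nh_deg (- sh la - sh la) (ylam k la).
Proof.
have -> : - sh la - sh la = \sum_(i < n) 2 *+ (l - lam la i)%N.
  rewrite shift_lamE -!sumrN -big_split; apply: eq_bigr => i _ /=.
  by have := lam_range la (ltn_ord i); lia.
by rewrite ylamE; exact: nh_deg_ymon.
Qed.

Lemma qs_deg_gen nu : qs_mod_deg (- sh nu) (gen nu).
Proof.
move=> la; rewrite qs_coord_gen; case: eqP => [->|_]; first exact: nh_deg_ylam.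
exact: (nh_deg_sub k n l _).1.
Qed.

Lemma nh_deg_sum i (I : Type) (r : seq I) (P : pred I) (F : I -> NH) :
  (forall j, P j -> nh_deg i (F j)) -> nh_deg i (\sum_(j <- r | P j) F j).
Proof.
have [h0 hP] := nh_deg_sub k n l i.
move=> h; apply: (big_ind (fun x => nh_deg i x)) => // x z hx hz.
by rewrite -[x]scale1r; exact: hP.
Qed.

Lemma homogeneous_factor la i x : nh_deg i (ylam k la * x) ->
  exists2 h, nh_deg (i + sh la + sh la) h & ylam k la * x = ylam k la * h.
Proof.
move=> hx; have [pr prP] := grading_proj (nh_grading k n l).
exists (pr (i + sh la + sh la) x); first exact: (pr_hom prP).
have mD : {morph (fun y : NH => ylam k la * y) : y z / y + z} by move=> y z; exact: mulrDr.
have mH j y : nh_deg j y -> nh_deg (j + (- sh la - sh la)) (ylam k la * y).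
  by move=> hy; rewrite addrC; apply: nh_degM => //; exact: nh_deg_ylam.
have e := pr_morph prP prP mD mH (i + sh la + sh la) x.
apply: etrans e; have -> : i + sh la + sh la + (- sh la - sh la) = i by ring.
by symmetry; exact: (pr_id prP).
Qed.

(** Homogeneous elements of the module have homogeneous cofactors, so the degree of an endomorphism
    can be tested on the generators. *)
Lemma qs_degE i f : qs_deg i f <-> forall mu nu, nh_deg (i - sh nu - sh mu) (ent f mu nu).
Proof.
split=> [hf mu nu|hf j v hv mu]; first exact: (hf _ _ (qs_deg_gen nu)).
have /choice[h hE] : forall nu, exists h, nh_deg (j + sh nu) h /\ qs_coord v nu = ylam k nu * h.
  move=> nu; have [h0 e0] := qs_modP v nu.
  have := hv nu; rewrite e0 => /homogeneous_factor[h hh ->]; exists h; split=> //.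
  by rewrite subrK in hh.
rewrite (act_coord f mu (fun nu => (hE nu).2)); apply: nh_deg_sum => nu _.
have -> : i + j - sh mu = (i - sh nu - sh mu) + (j + sh nu) by ring.
by apply: nh_degM => //; exact: (hE nu).1.
Qed.

Lemma qs_deg_sub i : qs_deg i (0 : S) /\
  forall c f g, qs_deg i f -> qs_deg i g -> qs_deg i (c *: f + g).
Proof.
split=> [|c f g /qs_degE hf /qs_degE hg]; apply/qs_degE => mu nu.
  by rewrite ent0; exact: (nh_deg_sub k n l _).1.
by rewrite entP; exact: (nh_deg_sub k n l _).2.
Qed.

Lemma qs_deg_elem mu nu i x : in_hom mu nu x -> nh_deg (i - sh nu - sh mu) x ->
  qs_deg i (elem mu nu x).
Proof.
move=> hx dx; apply/qs_degE => mu' nu'; rewrite (elemE hx).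
case: ifP => [/andP[/eqP -> /eqP ->] //|_]; exact: (nh_deg_sub k n l _).1.
Qed.

Lemma in_hom_pr pr mu nu i x : is_proj (@nh_deg k n l) pr -> in_hom mu nu x ->
  in_hom mu nu (pr i x).
Proof.
move=> prP [[a ea] [b eb]]; split.
  have mD : {morph (fun y : NH => ylam k mu * y) : y z / y + z} by move=> y z; exact: mulrDr.
  have mH j y : nh_deg j y -> nh_deg (j + (- sh mu - sh mu)) (ylam k mu * y).
    by move=> hy; rewrite addrC; apply: nh_degM => //; exact: nh_deg_ylam.
  exists (pr (i - (- sh mu - sh mu)) a); apply: etrans (pr_morph prP prP mD mH _ _).
  by rewrite ea subrK.
have mD : {morph (fun y : NH => y * ylam k nu) : y z / y + z} by move=> y z; exact: mulrDl.
have mH j y : nh_deg j y -> nh_deg (j + (- sh nu - sh nu)) (y * ylam k nu).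
  by move=> hy; apply: nh_degM => //; exact: nh_deg_ylam.
exists (pr (i - (- sh nu - sh nu)) b); apply: etrans (pr_morph prP prP mD mH _ _).
by rewrite eb subrK.
Qed.

Lemma qs_grading : is_grading (@qs_deg k n l).
Proof.
have [pr prP] := grading_proj (nh_grading k n l).
split=> [|f|s F us hF F0 i si]; first exact: qs_deg_sub.
- suff [s [G [_ hG _ e]]] : exists s G, is_decomp (@qs_deg k n l) f s G by exists s, G.
  pose D f := exists s G, is_decomp (@qs_deg k n l) f s G.
  have D0 : D 0 by exists [::], (fun=> 0); exact: (decomp0 qs_deg_sub).
  have DD f1 f2 : D f1 -> D f2 -> D (f1 + f2).
    move=> [s1 [G1 h1]] [s2 [G2 h2]]; rewrite -[f1]scale1r.
    by eexists; eexists; exact: (decompP qs_deg_sub 1 h1 h2).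
  rewrite (sum_elem hnl f); apply: (big_ind D) => // mu _; apply: (big_ind D) => // nu _.
  have hx := ent_hom hnl f mu nu; have [s _ e] := pr_decomp prP (ent f mu nu).
  have -> : elem mu nu (ent f mu nu) = \sum_(j <- s) elem mu nu (pr j (ent f mu nu)).
    apply: ent_ext => mu' nu'; rewrite ent_sum (elemE hx); case: ifP => h.
      by rewrite {1}e; apply: eq_bigr => j _; rewrite (elemE (in_hom_pr j prP hx)) h.
    by rewrite big1 // => j _; rewrite (elemE (in_hom_pr j prP hx)) h.
  apply: (@decomp_sum _ _ _ qs_deg_sub _ s (fun j => j + sh mu + sh nu)) => j.
  apply: qs_deg_elem; first exact: in_hom_pr.
  have -> : j + sh mu + sh nu - sh nu - sh mu = j by ring.
  exact: (pr_hom prP).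
- apply: ent_ext => mu nu; rewrite ent0; pose d := - sh nu - sh mu.
  have [_ _ uniq_nh] := nh_grading k n l.
  (* The indices are translated by [d] because an endomorphism of degree [j] has its entry at [mu],
     [nu] in degree [j + d]. *)
  have := uniq_nh [seq j + d | j <- s] (fun j => ent (F (j - d)) mu nu).
  have -> : ent (F i) mu nu = ent (F (i + d - d)) mu nu by rewrite addrK.
  apply.
  + by rewrite map_inj_uniq //; exact: addIr.
  + move=> j; have := (qs_degE _ _).1 (hF (j - d)) mu nu.
    by have -> : j - d - sh nu - sh mu = j by rewrite /d; ring.
  + rewrite big_map -[RHS](ent0 k mu nu) -F0 ent_sum.
    by apply: eq_bigr => j _; rewrite addrK.
  + by apply: map_f.
Qed.

Lemma qs_fun_ext f g : (forall v, f v = g v) -> f = g.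
Proof. by move=> h; apply: val_inj; apply: funext. Qed.

Lemma qs_dE f v : qs_d f v = qs_mod_d (f v) - f (qs_mod_d v).
Proof. by []. Qed.

Lemma qs_d_linear : linear (@qs_d k n l).
Proof.
move=> c f g; apply: qs_fun_ext => v.
rewrite qs_fun_lin !qs_dE !qs_fun_lin qs_mod_d_linear scalerBr.
by rewrite opprD addrACA.
Qed.

Lemma qs_coordB v v' la : qs_coord (v - v') la = qs_coord v la - qs_coord v' la.
Proof. by rewrite -scaleN1r addrC qs_coordP !ffunE scaleN1r addrC. Qed.

Lemma qs_deg_d i f : qs_deg i f -> qs_deg (i + 2) (qs_d f).
Proof.
have dM j v : qs_mod_deg j v -> qs_mod_deg (j + 2) (qs_mod_d v).
  by move=> hv la; rewrite qs_coordK ffunE addrAC; exact: nh_deg_d.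
move=> hf j v hv la; rewrite qs_dE qs_coordB.
have h1 : nh_deg (i + 2 + j - sh la) (qs_coord (qs_mod_d (f v)) la).
  have -> : i + 2 + j = i + j + 2 by ring.
  exact: (dM _ _ (hf _ _ hv) la).
have h2 : nh_deg (i + 2 + j - sh la) (qs_coord (f (qs_mod_d v)) la).
  have -> : i + 2 + j = i + (j + 2) by ring.
  exact: (hf _ _ (dM _ _ hv) la).
have := (nh_deg_sub k n l _).2 (-1) _ _ h2 h1.
by rewrite scaleN1r [- _ + _]addrC.
Qed.

Lemma iter_qs_mod_d v : iter p (@qs_mod_d k n l) v = 0.
Proof.
apply: qs_mod_ext => la; rewrite qs_coord0 -[RHS](iter_nh_d hp (qs_coord v la)).
by elim: p => //= r <-; rewrite qs_coordK ffunE.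
Qed.

(** Evaluation at a vector obeys the Leibniz rule, so in characteristic [p] the [p]-th iterate on
    endomorphisms is governed by the [p]-th iterate on the module, which vanishes. *)
Lemma iter_qs_d f : iter p (@qs_d k n l) f = 0.
Proof.
apply: qs_fun_ext => v.
have mD : {morph @qs_mod_d k n l : v v' / v + v'}.
  by move=> v1 v2; have := qs_mod_d_linear 1 v1 v2; rewrite !scale1r.
have mM (g : S) v' : qs_mod_d (g v') = qs_d g v' + g (qs_mod_d v').
  by rewrite qs_dE subrK.
have M0 v' : v' *+ p = 0 by rewrite -scaler_nat (pcharf0 hp) scale0r.
have := iter_leibniz_pchar mD mM f v (pcharf_prime hp) M0.
rewrite !iter_qs_mod_d qs_fun0 addr0 => <-.
by have := qs_fun_lin (-1) 0 (0 : S) v; rewrite !scaleN1r !addNr.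
Qed.

Lemma qs_funB f v v' : f (v - v') = f v - f v'.
Proof. by rewrite addrC -scaleN1r qs_funP scaleN1r addrC. Qed.

Lemma qs_d_mul f g : qs_d (f ** g) = qs_d f ** g + f ** qs_d g.
Proof.
apply: qs_fun_ext => v.
have := qs_fun_lin 1 (qs_d f ** g) (f ** qs_d g) v; rewrite !scale1r => ->.
rewrite qs_dE (mulE f g) (mulE f g) (mulE (qs_d f) g) (mulE f (qs_d g)) !qs_dE qs_funB.
by rewrite addrA subrK.
Qed.

Lemma qs_mulPr f c g (h : S) : f ** (c *: g + h : S) = c *: (f ** g : S) + (f ** h : S).
Proof.
by apply: qs_fun_ext => v; rewrite qs_fun_lin (mulE f) (mulE f g) (mulE f h) qs_fun_lin qs_funP.
Qed.

Lemma qs_mulPl f c g (h : S) : (c *: g + h : S) ** f = c *: (g ** f : S) + (h ** f : S).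
Proof.
apply: qs_fun_ext => v.
by rewrite qs_fun_lin (mulE _ f v) (mulE g f v) (mulE h f v) qs_fun_lin.
Qed.

Lemma qschur_pdg_alg : is_pdg_alg p A.
Proof.
split.
- split; [exact: qs_grading | exact: qs_d_linear | exact: qs_deg_d | exact: iter_qs_d].
- by split=> [f g h|f|f]; apply: qs_fun_ext => v; rewrite ?mulE.
- by move=> f; split=> c g h; [exact: qs_mulPr | exact: qs_mulPl].
- split=> [j v|i j f g hf hg j' v hv]; first by rewrite add0r.
  by rewrite -addrA; apply: hf; exact: hg.
- exact: qs_d_mul.
Qed.

Lemma star_anti_involution (star : S -> S) : is_qs_star star -> is_anti_involution (A := A) star.
Proof.
move=> hs; split.
- exact: star_linear.
- exact: star_mul.
- exact: star_involutive.
- move=> i f /qs_degE hf; apply/qs_degE => mu nu; rewrite ent_star // addrAC.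
  by apply: nh_deg_star; exact: hf.
Qed.

End QuiverSchurGraded.

(** * The cell chain of the quiver Schur algebra *)

Section QuiverSchurCells.
Context (k : fieldType) (p : nat) (n l : nat).
Hypotheses (hp : p \in [pchar k]) (hnl : (n <= l)%N).
Local Notation NH := (nh k n l).
Local Notation S := (qschur k n l).
Local Notation partn := (Defs.partn n l).
Local Notation A := (qschur_dga k n l).
Local Notation "f ** g" := (@dga_mul k A f g) (at level 40, left associativity).
Local Notation psic := (@psic k n l).
Local Notation cellB := (@cellB k n l).
Implicit Types (x z : NH) (f g : S) (mu nu la ka : partn) (c : codeT n).

Lemma in_hom_ylam la : in_hom la la (ylam k la).
Proof. by split; exists 1; rewrite ?mulr1 ?mul1r. Qed.

Definition proj la : S := elem la la (ylam k la).

Lemma ent_proj la mu nu : ent (proj la) mu nu = if (mu == la) && (nu == la) then ylam k la else 0.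
Proof. exact/elemE/in_hom_ylam. Qed.

Lemma ent_mul_proj f la mu nu : ent (f ** proj la) mu nu = if nu == la then ent f mu nu else 0.
Proof.
rewrite (@ent_mul k n l _ _ _ _ (fun ka => if (ka == la) && (nu == la) then 1 else 0)); last first.
  by move=> ka; rewrite ent_proj; case: ifP => [/andP[/eqP -> _]|_]; rewrite ?mulr1 ?mulr0.
rewrite (bigD1 la) //= eqxx big1 ?addr0 => [|ka /negPf ne]; last by rewrite ne mulr0.
by case: eqP => [->|_] /=; rewrite ?mulr1 ?mulr0.
Qed.

(** Factoring through the summand of [la] puts the entries in the two-sided ideal of [ylam k la],
    where [coef_neq0] applies. *)
Lemma ent_mul_proj_mul f g la mu nu :
  exists a b, ent (f ** proj la ** g) mu nu = a * ylam k la * b.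
Proof.
have /choice[h hE] : forall ka, exists h, ent g ka nu = ylam k ka * h.
  by move=> ka; have [h _] := ent_hom hnl g ka nu.
have [_ [a aE]] := ent_hom hnl f mu la; exists a, (h la).
rewrite (ent_mul _ mu hE) (bigD1 la) //= big1 ?addr0 => [|ka /negPf ne].
  by rewrite ent_mul_proj eqxx -aE.
by rewrite ent_mul_proj ne mul0r.
Qed.

Lemma proj_coord la v mu : qs_coord (proj la v) mu = if mu == la then qs_coord v la else 0.
Proof.
have /choice[h hE] := qs_modP v.
rewrite (act_coord (proj la) mu hE) (bigD1 la) //= ent_proj eqxx andbT.
rewrite big1 ?addr0 => [|ka /negPf ne]; last by rewrite ent_proj ne andbF mul0r.
by case: eqP => _; rewrite ?mul0r // hE.
Qed.

Lemma qs_coord_zero v mu : qs_coord ((0 : S) v) mu = 0.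
Proof.
have := qs_fun_lin (-1) 0 (0 : S) v; rewrite !scaleN1r !addNr => ->.
exact: qs_coord0.
Qed.

Lemma proj_idem la : dg_idem (proj la : A).
Proof.
split.
- have : qs_deg 0 (proj la); last exact.
  apply: (qs_deg_elem hp hnl (in_hom_ylam la)).
  by rewrite sub0r; exact: (nh_deg_ylam hp hnl).
- have : qs_d (proj la) = 0 :> S; last exact.
  apply: qs_fun_ext => v; apply: qs_mod_ext => mu.
  apply: etrans _ (esym (qs_coord_zero v mu)).
  rewrite qs_dE qs_coordB proj_coord !qs_coordK !ffunE proj_coord.
  by case: ifP => _; rewrite ?nh_d0 ?subrr.
- by apply: ent_ext => mu nu; rewrite ent_mul_proj ent_proj; case: eqP => // _; rewrite andbF.
Qed.

Lemma star_proj (star : S -> S) la : is_qs_star star -> star (proj la) = proj la.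
Proof.
move=> hs; apply: ent_ext => mu nu; rewrite ent_star // !ent_proj andbC.
by case: ifP => _; rewrite ?nh_star_ylam ?nh_star0.
Qed.

Lemma sum_proj : \sum_la proj la = dga_one A.
Proof.
apply: ent_ext => mu nu; rewrite ent_sum.
have -> : ent (dga_one A) mu nu = qs_coord (qs_gen k nu) mu by [].
rewrite qs_coord_gen (bigD1 nu) //= big1 ?addr0 => [|la ne]; last first.
  by rewrite ent_proj [nu == _]eq_sym (negPf ne) andbF.
by rewrite ent_proj eqxx andbT.
Qed.

Lemma psic_ylam_hom mu la c : allowed (lam mu) la c -> in_hom mu la (psic c * ylam k la).
Proof.
move=> al; split; last by exists (psic c).
have [z ->] := psic_ylam_divides k hnl (lam_bound mu) al.
by exists z; rewrite ylam_ybound.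
Qed.

Lemma ylam_psic_hom mu la c : allowed (lam mu) la c ->
  in_hom la mu (ylam k la * nh_star (psic c)).
Proof. by move=> /psic_ylam_hom/in_hom_star; rewrite nh_starM nh_star_ylam. Qed.

Lemma cellB_hom mu nu la c c' : allowed (lam mu) la c -> allowed (lam nu) la c' ->
  in_hom mu nu (cellB (la, c, c')).
Proof.
move=> al al'; rewrite cellBE.
have [[a aE] _] := psic_ylam_hom al; have [_ [b bE]] := ylam_psic_hom al'.
split; first by exists (a * nh_star (psic c')); rewrite aE mulrA.
by exists (psic c * b); rewrite -mulrA bE mulrA.
Qed.

(** This factorization through the summand of [la] places cell elements in the ideal of
    [proj la]. *)
Lemma elem_cellB mu nu la c c' : allowed (lam mu) la c -> allowed (lam nu) la c' ->
  elem mu nu (cellB (la, c, c')) =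
  elem mu la (psic c * ylam k la) ** elem la nu (ylam k la * nh_star (psic c')).
Proof.
move=> al al'; have h1 := psic_ylam_hom al; have h2 := ylam_psic_hom al'.
by have h3 := cellB_hom al al'; rewrite cellBE in h3 *; rewrite (elem_mul h1 h2 erefl).
Qed.

Lemma elem_mul_proj mu la x : in_hom mu la x -> elem mu la x ** proj la = elem mu la x.
Proof.
move=> hx; apply: ent_ext => mu' nu'; rewrite ent_mul_proj (elemE hx).
by case: eqP => // _; rewrite andbF.
Qed.

Lemma allowed_leq la ka c : allowed (lam la) ka c -> forall i, (i < n)%N -> (lam ka i <= lam la i)%N.
Proof.
move=> /allowedP al i iN; apply: leq_trans (al i iN).
have := @cfun_code n c i; have [->|c0] := posnP (cfun c i); first by rewrite addn0.
by move=> h; apply/ltnW/lam_lt; lia.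
Qed.

Lemma allowed_sumlam la ka c : allowed (lam la) ka c -> ka = la \/ (sumlam ka < sumlam la)%N.
Proof.
move=> al; have le := allowed_leq al.
have [lt|ge] := ltnP (sumlam ka) (sumlam la); [by right | left].
apply: lam_inj => i iN.
have := @sum_leq_eq n (fun i => lam ka i) (fun i => lam la i) (fun i => le i (ltn_ord i)) ge.
by move/(_ (Ordinal iN)).
Qed.

(** Positions increase strictly, so a nonzero digit would violate the condition, and the code word
    is empty. *)
Lemma allowed_self la c : allowed (lam la) la c -> psic c = 1.
Proof.
move=> /allowedP al; have c0 i : (i < n)%N -> cfun c i = 0%N.
  move=> iN; have := al i iN; have := @cfun_code n c i; have [//|ci] := posnP (cfun c i).
  by have := @lam_lt n l la i (i + cfun c i)%N; lia.
rewrite /psic (@eq_code_word _ (fun=> 0%N)) => [|j hj]; last by apply: c0; lia.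
suff -> r i : code_word (fun=> 0%N) r i = [::] by exact: psiw_nil.
by elim: r i => //= r IH i; rewrite IH.
Qed.

Section Ranking.
Context (la0 : partn).

(** Decreasing sums serve both halves of the cell basis: the functionals of one partition vanish on
    the ideal of the later ones, and the cell elements out of its summand that go through another
    partition fall into that ideal. *)
Definition ranked : seq partn := sort (fun la ka => sumlam ka <= sumlam la)%N (enum {: partn}).
Local Notation la_ := (nth la0 ranked).

Lemma perm_ranked : perm_eq ranked (enum {: partn}).
Proof. by rewrite perm_sort. Qed.

Lemma ranked_index la : exists2 i, (i < size ranked)%N & la_ i = la.
Proof.
have h : la \in ranked by rewrite (perm_mem perm_ranked) mem_enum.
by exists (index la ranked); rewrite ?index_mem ?nth_index.
Qed.

Lemma ranked_mono i j : (i < j < size ranked)%N -> (sumlam (la_ j) <= sumlam (la_ i))%N.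
Proof.
move=> /andP[ij js].
have so : sorted (fun la ka => sumlam ka <= sumlam la)%N ranked.
  by apply: sort_sorted => la ka; exact: leq_total.
apply: (sorted_ltn_nth _ la0 so) => //; last by rewrite inE; exact: ltn_trans js.
by move=> a b c h1 h2; exact: leq_trans h2 h1.
Qed.

Lemma ranked_neq i j : (i < j < size ranked)%N -> la_ j != la_ i.
Proof.
by move=> /andP[ij js]; rewrite nth_uniq ?(perm_uniq perm_ranked) ?enum_uniq ?gtn_eqF // (ltn_trans ij).
Qed.

Lemma sum_ranked (F : partn -> S) : \sum_(i < size ranked) F (la_ i) = \sum_la F la.
Proof.
rewrite -(big_mkord xpredT (fun i => F (la_ i))) -(big_nth la0 xpredT F).
by rewrite (perm_big _ perm_ranked) big_enum.
Qed.

Local Notation e_ := (fun i => proj (la_ i) : A).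
Local Notation ideal := (@idem_ideal k A (size ranked) e_).

Lemma ideal_mcoef i f : (i < size ranked)%N -> f \in ideal i.+1 ->
  forall u v mu nu, mcoef (bla (la_ i)) u v (ent f mu nu) = 0.
Proof.
move=> im /idem_idealP h u v mu nu.
have bl := @bla_lt n l (la_ i).
elim: h => {f} [a b r ir rm||c f g _ h1 _ h2].
- have [x [z ->]] := ent_mul_proj_mul a b (la_ r) mu nu.
  apply/eqP/negP => /negP/coef_neq0[e|lt].
    by have := @ranked_neq i r; rewrite e eqxx ir rm => /(_ isT).
  by have := @ranked_mono i r; rewrite ir rm => /(_ isT); lia.
- by rewrite ent0 (mcoef0 bl).
- by rewrite entP (mcoefP bl) h1 h2 mulr0 addr0.
Qed.

Lemma elem_cellB_ideal i mu ka c c' : (i < size ranked)%N ->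
  allowed (lam mu) ka c -> allowed (lam (la_ i)) ka c' -> ka != la_ i ->
  elem mu (la_ i) (cellB (ka, c, c')) \in ideal i.+1.
Proof.
move=> im al al' ne; have [r rm rE] := ranked_index ka.
have [e|lt] := allowed_sumlam al'; first by rewrite e eqxx in ne.
have ir : (i < r)%N.
  have [//|ri|ri] := ltngtP i r; last by rewrite -rE -ri eqxx in ne.
  by have := @ranked_mono r i; rewrite ri im => /(_ isT); rewrite rE; lia.
rewrite elem_cellB // -(elem_mul_proj (psic_ylam_hom al)); apply/idem_idealP.
by rewrite -rE; exact: IdemGen.
Qed.

(** The target [mu] varies: these pairs index a basis of the left ideal of [proj (la_ i)] modulo the
    later projections. *)
Definition cell_index i : Type := {w : partn * codeT n | allowed (lam w.1) (la_ i) w.2}.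
HB.instance Definition _ i := Finite.on (cell_index i).

Definition cell_elem i (w : cell_index i) : A :=
  elem (val w).1 (la_ i) (psic (val w).2 * ylam k (la_ i)).

(** Each entry expands in cell elements. Those of a partition other than [la_ i] lie in the later
    ideal; for [la_ i] itself the second code is trivial by [allowed_self], which leaves a
    [cell_elem]. *)
Lemma cell_elem_span i (z : A) : (i < size ranked)%N -> z ** proj (la_ i) = z ->
  exists c : cell_index i -> k, z - \sum_w c w *: cell_elem w \in ideal i.+1.
Proof.
move=> im ze.
pose D (f : A) := exists c : cell_index i -> k, f - \sum_w c w *: cell_elem w \in ideal i.+1.
have Did (f : A) : f \in ideal i.+1 -> D f.
  by exists (fun=> 0); rewrite big1 ?subr0 // => w _; rewrite scale0r.
have DP a (f g : A) : D f -> D g -> D (a *: f + g).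
  move=> [c hc] [d hd]; exists (fun w => a * c w + d w).
  under eq_bigr => w _ do rewrite scalerDl -scalerA.
  rewrite big_split /= -scaler_sumr opprD addrACA -scalerBr.
  by apply/idem_idealP/IdemLin; exact/idem_idealP.
have D0 : D 0 by exact/Did/idem_idealP/IdemZero.
have Dw (w : cell_index i) : D (cell_elem w).
  exists (fun w' => (w' == w)%:R); rewrite (bigD1 w) //= eqxx scale1r big1 ?addr0.
    by rewrite subrr; exact/idem_idealP/IdemZero.
  by move=> w' /negPf ->; rewrite scale0r.
have DD (f g : A) : D f -> D g -> D (f + g) by move=> hf hg; rewrite -[f]scale1r; exact: DP.
have zE mu nu : ent z mu nu = if nu == la_ i then ent z mu nu else 0.
  by rewrite -{1}ze ent_mul_proj.
have -> : z = \sum_mu elem mu (la_ i) (ent z mu (la_ i)).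
  apply: ent_ext => mu nu; rewrite zE ent_sum (bigD1 mu) //= big1 ?addr0.
    by rewrite (elemE (ent_hom hnl z mu (la_ i))) eqxx /=; case: eqP => [->|].
  move=> mu' ne; rewrite (elemE (ent_hom hnl z mu' (la_ i))).
  by rewrite eq_sym (negPf ne).
apply: (big_ind D) => // mu _.
have hz := ent_hom hnl z mu (la_ i); have [C [C0 CE]] := hom_supported hnl hz.1 hz.2.
have -> : elem mu (la_ i) (ent z mu (la_ i)) = \sum_u C u *: elem mu (la_ i) (cellB u).
  apply: ent_ext => mu' nu'; rewrite ent_sum (elemE hz).
  transitivity (\sum_u if (mu' == mu) && (nu' == la_ i) then C u *: cellB u else 0).
    by case: ifP => _; [exact: CE | rewrite big1].
  apply: eq_bigr => u _; rewrite entZ.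
  have [al|al] := boolP (allowed (lam mu) u.1.1 u.1.2 && allowed (lam (la_ i)) u.1.1 u.2).
    case: u al => [[ka c] c'] /andP[al al']; rewrite (elemE (cellB_hom al al')).
    by case: ifP; rewrite ?scaler0.
  by rewrite C0 // !scale0r; case: ifP.
apply: (big_ind D) => // -[[ka c] c'] _.
case al: (allowed (lam mu) ka c && allowed (lam (la_ i)) ka c'); last first.
  by rewrite C0 /= ?al // scale0r.
case/andP: al => al al'; rewrite -[_ *: _]addr0; apply: DP => //.
have [e|ne] := eqVneq ka (la_ i); last exact/Did/elem_cellB_ideal.
subst ka; rewrite cellBE (allowed_self al') -(psiw_nil k n l) nh_star_psiw psiw_nil mulr1.
exact: (Dw (exist _ (mu, c) al)).
Qed.

(** The functionals of [la_ i] applied to one entry vanish on the later ideal, so they give the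
    relations to which [coef_free] applies. *)
Lemma cell_elem_free (star : S -> S) i : is_qs_star star -> (i < size ranked)%N ->
  forall c : cell_index i * cell_index i -> k,
    \sum_u c u *: (cell_elem u.1 ** star (cell_elem u.2)) \in ideal i.+1 -> forall u, c u = 0.
Proof.
move=> hs im c hc u0; set la := la_ i.
pose mu := (val u0.1).1; pose nu := (val u0.2).1.
pose P (u : cell_index i * cell_index i) (q : codeT n * codeT n) :=
  (val u.1 == (mu, q.1)) && (val u.2 == (nu, q.2)).
(* A sum with at most one term: it extends the coefficients for the targets [mu] and [nu] by zero to
   all pairs of codes, including those that are not allowed. *)
pose C c1 c2 := \sum_(u | P u (c1, c2)) c u.
have entE (u : cell_index i * cell_index i) : ent (cell_elem u.1 ** star (cell_elem u.2)) mu nu =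
    if (mu == (val u.1).1) && (nu == (val u.2).1)
    then cellB (la, (val u.1).2, (val u.2).2) else 0.
  rewrite (@ent_mul k n l _ _ _ _ (fun ka => if (ka == la) && (nu == (val u.2).1)
    then nh_star (psic (val u.2).2) else 0)); last first.
    move=> ka; rewrite ent_star // (elemE (psic_ylam_hom (valP u.2))) -/la.
    case: (nu == _); case: eqP => [->|_] /=; rewrite ?nh_star0 ?mulr0 //.
    by rewrite nh_starM nh_star_ylam.
  rewrite (bigD1 la) //= big1 ?addr0 => [|ka /negPf ne]; last by rewrite ne mulr0.
  rewrite (elemE (psic_ylam_hom (valP u.1))) !eqxx andbT /= cellBE.
  by case: eqP => _; case: eqP => _ /=; rewrite ?mul0r ?mulr0.
have : C (val u0.1).2 (val u0.2).2 = 0.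
  apply: (@coef_free k n l la) => f g.
  pose X u (q : codeT n * codeT n) := if P u q then c u * (cval q.1 f * cval q.2 g) else 0.
  have -> : \sum_c1 \sum_c2 C c1 c2 * (cval c1 f * cval c2 g) = \sum_q \sum_u X u q.
    rewrite pair_big; apply: eq_bigr => -[c1 c2] _ /=.
    by rewrite mulr_suml big_mkcond.
  rewrite exchange_big -[RHS](ideal_mcoef im hc f g mu nu) ent_sum.
  transitivity (mcoef (bla la) f g
    (\sum_u c u *: ent (cell_elem u.1 ** star (cell_elem u.2)) mu nu)); last first.
    by congr mcoef; apply: eq_bigr => u _; rewrite entZ.
  rewrite (mcoef_sum (@bla_lt n l la)); apply: eq_bigr => u _; rewrite entE.
  case: ifP => [/andP[/eqP e1 /eqP e2]|h].
    rewrite coef_cell (bigD1 ((val u.1).2, (val u.2).2)) //= big1 ?addr0.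
      by rewrite /X /P /= e1 e2 -!surjective_pairing !eqxx.
    move=> q ne; rewrite /X; case: ifP => // /andP[/eqP h1 /eqP h2].
    by rewrite h1 h2 /= -surjective_pairing eqxx in ne.
  rewrite (mcoef0 (@bla_lt n l la)) mulr0 big1 // => q _; rewrite /X.
  by case: ifP => // /andP[/eqP h1 /eqP h2]; rewrite h1 h2 /= !eqxx in h.
have PE u : P u ((val u0.1).2, (val u0.2).2) = (u == u0).
  rewrite /P /mu /nu -2!surjective_pairing.
  exact: erefl.
rewrite /C (eq_bigl _ _ PE); exact: (etrans (esym (big_pred1_eq _ _ _))).
Qed.

Lemma qschur_cellular (star : S -> S) : is_qs_star star -> pdg_qh_cellular p (A := A) star.
Proof.
move=> hs; apply: (idem_chain_qh (qschur_pdg_alg hp hnl) (star_anti_involution hp hnl hs)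
  (m := size ranked) (e := fun i => proj (la_ i))).
- by move=> i _; exact: proj_idem.
- by move=> i _; exact: star_proj.
- by rewrite -sum_proj; exact: sum_ranked.
move=> i im; exists (cell_index i), (@cell_elem i); split.
- by move=> [[mu c] al]; exact: (elem_mul_proj (psic_ylam_hom al)).
- by move=> z; exact: cell_elem_span.
- by move=> c; exact: cell_elem_free.
Qed.

End Ranking.

End QuiverSchurCells.

(** The anti-involution [star] is uniquely determined by [is_qs_star]
    (lemma [qs_star_unique]). *)
Theorem theorem7p17 (k : fieldType) (p : nat) (hp : p \in [pchar k]%R)
    (n l : nat) (hnl : (n <= l)%N) :
  exists star : qschur_dga k n l -> qschur_dga k n l,
    is_qs_star star /\ pdg_qh_cellular p star.
Proof.
have [star hs] := star_ex k hnl; exists star; split=> //.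
(* The ranking needs a partition as the default value of [nth]; the positions [1, ..., n] give one
   because [n <= l]. *)
have [||v|la0 _] := @partn_of_seq n l (iota 1 n); rewrite ?iota_uniq ?size_iota //.
  by rewrite mem_iota; lia.
exact: (qschur_cellular hp hnl la0 hs).
Qed.
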